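(* Let $X$ be an infinite compact abelian group with Haar measure $\alpha$ (any positive normalization), and let $\hat X$ be its (discrete) dual group equipped with the dual Haar measure $\hat\alpha$ normalized as described in the context. For $0<p,q\le\infty$ let $C_{p,q}$ be the $(p,q)$-norm of the Fourier operator as defined in the context. Consider the regions $$R_1=\Big\{\Big(\tfrac1p,\tfrac1q\Big)\in[0,\infty)^2:\ \tfrac1p+\tfrac1q\le 1,\ \tfrac1q\le\tfrac12\Big\},$$ $$R_2=\Big\{\Big(\tfrac1p,\tfrac1q\Big)\in[0,\infty)^2:\ \tfrac1p+\tfrac1q> 1,\ \tfrac1p>\tfrac12\Big\},$$ $$R_3=\Big\{\Big(\tfrac1p,\tfrac1q\Big)\in[0,\infty)^2:\ \tfrac1p\le\tfrac12,\ \tfrac1q>\tfrac12\Big\}.$$ Then $$C_{p,q}=\begin{cases}\alpha(X)^{1-1/p-1/q} & \text{if } (1/p,1/q)\in R_1,\\ \infty & \text{if } (1/p,1/q)\in R_2\cup R_3.\end{cases}$$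
   Context: For a locally compact abelian group $X$ with Haar measure $\alpha$, $\hat X$ denotes the group of continuous homomorphisms $\gamma:X\to\mathbb T=\{z\in\mathbb C:|z|=1\}$ under pointwise multiplication, and the Fourier transform of $f\in L^1(X)$ is $\hat f(\gamma)=\int_X f(x)\overline{\gamma(x)}\,\alpha(dx)$. When $X$ is compact, $\hat X$ is discrete and its Haar measure $\hat\alpha$ is normalized to give mass $\alpha(X)^{-1}$ to each point (this is the normalization for which Fourier inversion and the Plancherel identity $\|f\|_2=\|\hat f\|_2$ hold). For $0<p<\infty$, $\|f\|_p=(\int|f|^p)^{1/p}$ (a quasi-norm if $p<1$), and $\|f\|_\infty$ is the essential supremum. For compact $X$ and $0<p\le\infty$, $C_{p,q}:=\sup\{\|\hat f\|_{L^q(\hat X,\hat\alpha)}: f\in L^1(X)\cap L^p(X),\ \|f\|_{L^p(X,\alpha)}=1\}$ (note $L^1\cap L^p=L^p$ if $p\ge1$ and $=L^1$ if $p<1$). *)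

(* Defs.v *)
From HB Require Import structures.
From mathcomp Require Import all_boot all_order all_algebra.
From mathcomp Require Import all_classical all_reals all_analysis.
From mathcomp Require Import complex.

Set Implicit Arguments.
Unset Strict Implicit.
Unset Printing Implicit Defensive.

Import Order.TTheory GRing.Theory Num.Theory.
Import numFieldNormedType.Exports.

Local Open Scope classical_set_scope.
Local Open Scope ring_scope.

(* (a copy of) X pointed at 0, needed to build the measurable structure *)
Definition ptd (X : topologicalZmodType) : Type := X.
HB.instance Definition _ (X : topologicalZmodType) := Topological.on (ptd X).
HB.instance Definition _ (X : topologicalZmodType) := isPointed.Build (ptd X) (0 : X).
Definition borel (X : topologicalZmodType) := g_sigma_algebraType (@open (ptd X)).

Section FourierDefs.
Context {R : realType} {X : topologicalZmodType}.
Local Notation BX := (borel X).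

Definition is_haar (a : {measure set BX -> \bar R}) : Prop :=
  [/\ (0 < a [set: BX])%E, (a [set: BX] < +oo)%E,
      (forall (x : X) (A : set BX), measurable A ->
          a [set x + y | y in A] = a A),
      (forall A : set BX, measurable A ->
          a A = ereal_inf [set a U | U in [set U : set BX | open (U : set X) /\ A `<=` U]])
    & (forall U : set BX, open (U : set X) ->
          a U = ereal_sup [set a K | K in [set K : set BX | compact (K : set X) /\ K `<=` U]])].

Definition character (g : X -> R[i]) : Prop :=
  [/\ continuous (fun x => complex.Re (g x)), continuous (fun x => complex.Im (g x)),
      (forall x y, g (x + y) = g x * g y)
    & (forall x, ComplexField.Normc.normc (g x) = 1)].

Definition dual_group : set (X -> R[i]) := [set g | character g].

Definition cmeasurable (f : BX -> R[i]) : Prop :=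
  measurable_fun [set: BX] (fun x => complex.Re (f x)) /\
  measurable_fun [set: BX] (fun x => complex.Im (f x)).

Definition cintegrable (a : {measure set BX -> \bar R}) (f : BX -> R[i]) : Prop :=
  cmeasurable f /\ (\int[a]_x (ComplexField.Normc.normc (f x))%:E < +oo)%E.

Definition cintegral (a : {measure set BX -> \bar R}) (f : BX -> R[i]) : R[i] :=
  Complex (Rintegral a [set: BX] (fun x => complex.Re (f x)))
          (Rintegral a [set: BX] (fun x => complex.Im (f x))).

Definition cLnorm (a : {measure set BX -> \bar R}) (p : \bar R) (f : BX -> R[i]) : \bar R :=
  Lnorm a p (fun x => (ComplexField.Normc.normc (f x))%:E).

Definition fourier (a : {measure set BX -> \bar R}) (f : BX -> R[i]) (g : X -> R[i]) : R[i] :=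
  cintegral a (fun x => f x * conjc (g x)).

(* L^q norm on the discrete dual group, whose Haar measure gives mass
   alpha(X)^{-1} to each point: for q finite
   (\int |F|^q d\hat alpha)^{1/q} = (alpha(X)^{-1} \sum_gamma |F gamma|^q)^{1/q},
   for q = +oo the (essential) supremum, i.e. the supremum over \hat X. *)
Definition dual_Lnorm (a : {measure set BX -> \bar R}) (q : \bar R)
    (F : (X -> R[i]) -> R[i]) : \bar R :=
  match q with
  | r%:E => (((fine (a [set: BX]))^-1)%:E *
              esum dual_group (fun g => ((ComplexField.Normc.normc (F g))%:E `^ r)%E)) `^ r^-1
  | +oo%E => ereal_sup [set (ComplexField.Normc.normc (F g))%:E | g in dual_group]
  | -oo%E => 0%E
  end.

Definition Cpq (a : {measure set BX -> \bar R}) (p q : \bar R) : \bar R :=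
  ereal_sup [set dual_Lnorm a q (fourier a f) |
             f in [set f : BX -> R[i] | cintegrable a f /\ cLnorm a p f = 1%E]].

End FourierDefs.

Definition recip {R : realType} (p : \bar R) : R :=
  match p with r%:E => r^-1 | _ => 0 end.

(* Main.v *)
(** An infinite compact group has arbitrarily large finite sets of characters,
    and sums of characters make the constant infinite outside R1.  For R3,
    Rudin-Shapiro polynomials of [2 ^ n] characters have unimodular coefficients
    and sup norm at most [sqrt (2 ^ n.+1)].  For R2 with [1 <= p], take the square
    of a Dirichlet kernel over a long progression or a large finite subgroup of
    the dual; with [p < 1], take the indicator of an open set of small measure.

    Infinitely many characters come from spectral theory: iterating the
    convolution by a symmetric kernel [k], suitably normalised, converges to a
    nonzero idempotent [phi].  A minimal such idempotent, normalised by its value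
    at 0, satisfies d'Alembert's equation [s (x + y) + s (x - y) = 2 s x s y], hence
    is the real part of a character.  Distinct solutions are orthogonal, and
    finitely many of them cannot exhaust a bump supported near 0.

    On R1 the constant function gives the lower bound.  The upper bound is the
    Hausdorff-Young inequality for trigonometric polynomials, proved by F. Riesz's
    method and then dualised.  At a maximiser of [mean (|g| ^ q)] over coefficients
    with [l^p] norm 1, [1/p + 1/q = 1], equality holds in Young's inequality; with
    Bessel's inequality this bounds the best constant at [q] by the square root of
    the one at [2 q - 2].  Iterating from the trivial bound [n] yields 1. *)

Require Import Defs.
From HB Require Import structures.
From mathcomp Require Import all_boot all_order all_algebra.
From mathcomp Require Import all_classical all_reals all_analysis.
From mathcomp Require Import measurable_realfun ess_sup_inf complex.
From mathcomp Require Import ring lra zify.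

Set Implicit Arguments.
Unset Strict Implicit.
Unset Printing Implicit Defensive.

Import Order.TTheory GRing.Theory Num.Theory.
Import numFieldNormedType.Exports.
Local Open Scope classical_set_scope.
Local Open Scope ring_scope.

(** * Means over a compact group *)

(** Working with the normalised mean keeps the mass of [alpha] out of the convolution algebra and of
    the Hausdorff-Young inequality. Haar measure is given as translation invariant and regular;
    Fubini and invariance under negation are derived, for continuous functions, from Riemann sums
    whose nodes serve all functions at once. The kernels are real and even, so a projection sees a
    character only together with its conjugate; hence d'Alembert's equation in place of
    multiplicativity, and the separate recovery of the imaginary part. No eigenvector has to be
    found: log-convexity and submultiplicativity of the L2 norms of the convolution powers supply
    the growth rate by which to normalise. For the upper bound, the iteration of square roots
    attracted by 1 takes the place of complex interpolation. Maximisers exist because finitely many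
    coefficients are in play, and this is enough: the norm on the dual is a supremum over finite
    sets of characters, so trigonometric polynomials never have to approximate [f]. *)

Section CompactContinuity.
Context {R : realType} {X : topologicalType}.
Hypothesis cX : compact [set: X].

(** The tube lemma: product neighbourhoods of the points [(t, x)] control [F], and compactness makes
    the neighbourhood of [t] independent of [x]. *)
Lemma compact_uniform_near (T : topologicalType) (F : T * X -> R) (t : T)
    (e : R) : continuous F -> 0 < e ->
  \forall t' \near t, forall x, `|F (t', x) - F (t, x)| < e.
Proof.
move=> cF e0.
have /compact_near_coveringP cov := cX.
have H : \forall t' \near t, [set: X] `<=` [set x | `|F (t', x) - F (t, x)| < e].
  apply: cov => x _.
  have e2 : 0 < e / 2 by rewrite divr_gt0.
  have /cvgrPdist_lt/(_ _ e2) := cF (t, x).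
  case=> -[A B] /= [At Bx] AB.
  exists (B, A) => //= -[x' t'] /= [Bx' At'].
  have h1 := AB (t', x') (conj At' Bx').
  have h2 := AB (t, x') (conj (nbhs_singleton At) Bx').
  rewrite /= in h1 h2.
  have -> : F (t', x') - F (t, x') =
    (F (t, x) - F (t, x')) - (F (t, x) - F (t', x')) by ring.
  rewrite (splitr e); apply: le_lt_trans (ler_normB _ _) _.
  by rewrite ltrD.
by apply: filterS H => t' H x; apply: H.
Qed.

Lemma compact_continuous_bounded (u : X -> R) : continuous u ->
  exists2 M, 0 < M & forall x, `|u x| <= M.
Proof.
move=> cu; have /compact_bounded [M [_ HM]] : compact (u @` [set: X]).
  by apply: continuous_compact => //; exact: continuous_subspaceT.
exists (`|M| + 1); first by rewrite ltr_wpDl.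
move=> x; apply: HM; last by exists x.
by rewrite ltr_pwDr// ler_norm.
Qed.

End CompactContinuity.

Section HaarMean.
Context {R : realType} {X : topologicalZmodType}.
Local Notation BX := (borel X).
Variable alpha : {measure set BX -> \bar R}.
Hypotheses (cX : compact [set: X]) (haar : is_haar alpha).

Let mass := fine (alpha [set: BX]).

Lemma haar_fin_num : (alpha [set: BX] \is a fin_num)%E.
Proof. by case: haar => h1 h2 _ _ _; rewrite ge0_fin_numE// ltW. Qed.

Lemma haar_lty A : measurable A -> (alpha A < +oo)%E.
Proof.
move=> mA; case: haar => _ h _ _ _; apply: le_lt_trans h.
by apply: le_measure => //; rewrite inE.
Qed.

Lemma mass_gt0 : 0 < mass.
Proof. by case: haar => h1 h2 _ _ _; rewrite fine_gt0// h1. Qed.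

Lemma massE : (alpha [set: BX] = mass%:E)%E.
Proof. by rewrite fineK// haar_fin_num. Qed.

Lemma open_borel (U : set X) : open U -> measurable (U : set BX).
Proof. by move=> oU; exact: sub_sigma_algebra. Qed.

Lemma continuous_borel (u : X -> R) : continuous u ->
  measurable_fun [set: BX] (u : BX -> R).
Proof.
move=> /continuousP cu.
apply: (measurability _ (RGenOpens.measurableE R)) => //.
move=> _ [_ [a [b ->]] <-]; rewrite setTI.
by apply: open_borel; apply: cu; exact: interval_open.
Qed.

Lemma continuous_integrable (u : X -> R) : continuous u ->
  alpha.-integrable [set: BX] (EFin \o (u : BX -> R)).
Proof.
move=> cu; apply: measurable_bounded_integrable => //.
- exact: haar_lty.
- exact: continuous_borel.
- have [M M0 HM] := compact_continuous_bounded cX cu.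
  by exists M; split; [exact: num_real | move=> y My x _; apply: le_trans (HM x) (ltW My)].
Qed.

Lemma addl_continuous (x : X) : continuous (fun y : X => x + y).
Proof.
move=> y; apply: (@continuous_comp _ _ _ (fun z : X => (x, z)) (fun z : X * X => z.1 + z.2)).
  by apply: cvg_pair => /=; [exact: cvg_cst|exact: cvg_id].
exact: add_continuous.
Qed.

Lemma continuous_borel_map (f : X -> X) : continuous f ->
  measurable_fun [set: BX] (f : BX -> BX).
Proof.
move=> /continuousP cf.
apply: (measurability _ (erefl : @measurable _ BX = <<s @open (ptd X) >>)) => //.
by move=> _ [U oU <-]; rewrite setTI; apply: open_borel; apply: cf.
Qed.

Lemma image_addl (x : X) (A : set X) :
  [set x + y | y in A] = (fun y => - x + y) @^-1` A.
Proof.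
apply/seteqP; split=> [_ [y Ay <-]|y Ay] /=; first by rewrite addKr.
by exists (- x + y) => //; rewrite addrA subrr add0r.
Qed.

Lemma addl_open (x : X) (U : set X) : open U -> open [set x + y | y in U].
Proof. by rewrite image_addl => oU; apply: open_comp => // y _; exact: addl_continuous. Qed.

Lemma haar_preimage_addl (x : X) (A : set BX) : measurable A ->
  alpha ((fun y => x + y) @^-1` A) = alpha A.
Proof.
move=> mA; case: haar => _ _ inv _ _.
by rewrite -[RHS](inv (- x) A)// image_addl opprK.
Qed.

Lemma finite_translates (V : set X) : open V -> V 0 ->
  exists l : seq X, forall x, has (fun y => x - y \in V) l.
Proof.
move=> oV V0; have : @cover_compact (ptd X) [set: X] by rewrite -compact_cover.
move=> /(_ X [set: X] (fun y => [set x | V (x - y)])) [].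
- move=> y _; have -> : [set x | V (x - y)] = (fun x => - y + x) @^-1` V.
    by apply/seteqP; split=> x /=; rewrite addrC.
  by apply: open_comp => // z _; exact: addl_continuous.
- by move=> x _; exists x => //=; rewrite subrr.
move=> D _ HD; exists (finmap.enum_fset D) => x.
have [y /= Dy Vy] := HD x I.
by apply/hasP; exists y => //; rewrite inE.
Qed.

(** Finitely many translates of [U] cover the group; were [U] null, so would be the whole space. *)
Lemma haar_open_gt0 (U : set X) (x : X) : open U -> U x -> (0 < alpha (U : set BX))%E.
Proof.
move=> oU Ux; rewrite lt0e measure_ge0 andbT; apply/eqP => U0.
pose V := (fun y => x + y) @^-1` U.
have oV : open V by apply: open_comp => // y _; exact: addl_continuous.
have mV := open_borel oV.
have V0 : V 0 by rewrite /V /= addr0.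
have aV : alpha V = 0%E by rewrite haar_preimage_addl ?U0//; exact: open_borel.
have [l Hl] := finite_translates oV V0.
have aux (k : seq X) : alpha (\big[setU/set0]_(y <- k) [set y + z | z in V]) = 0%E.
  elim: k => [|y k IH]; first by rewrite big_nil measure0.
  rewrite big_cons; apply: null_set_setU => //.
  - by apply: open_borel; exact: addl_open.
  - by rewrite big_seq; apply: bigsetU_measurable => z _; apply: open_borel; exact: addl_open.
  - by case: haar => _ _ inv _ _; rewrite inv.
have /eqP := aux l.
have -> : \big[setU/set0]_(y <- l) [set y + z | z in V] = [set: BX].
  apply/seteqP; split=> // z _.
  have /hasP[y yl] := Hl z; rewrite inE => Vy.
  rewrite -bigcup_seq; exists y => //=; exists (z - y) => //.
  by rewrite addrC subrK.
by case: haar => + _ _ _ _ => /gt_eqF ->.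
Qed.

Definition haar_mean (u : X -> R) : R := mass^-1 * Rintegral alpha [set: BX] u.

Local Notation mean := haar_mean.
Implicit Types (u v : X -> R) (k : R).

Lemma meanD u v : continuous u -> continuous v ->
  mean (fun x => u x + v x) = mean u + mean v.
Proof.
by move=> cu cv; rewrite /haar_mean -mulrDr; congr (_ * _); rewrite RintegralD//;
  exact: continuous_integrable.
Qed.

Lemma meanB u v : continuous u -> continuous v ->
  mean (fun x => u x - v x) = mean u - mean v.
Proof.
by move=> cu cv; rewrite /haar_mean -mulrBr; congr (_ * _); rewrite RintegralB//;
  exact: continuous_integrable.
Qed.

Lemma meanZ k u : continuous u -> mean (fun x => k * u x) = k * mean u.
Proof.
move=> cu; rewrite /haar_mean mulrCA; congr (_ * _); rewrite RintegralZl//.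
exact: continuous_integrable.
Qed.

Lemma mean_cst k : mean (fun=> k) = k.
Proof.
rewrite /haar_mean Rintegral_cst// -/mass mulrCA mulVf ?mulr1//.
by rewrite gt_eqF// mass_gt0.
Qed.

Lemma ler_mean u v : continuous u -> continuous v -> (forall x, u x <= v x) ->
  mean u <= mean v.
Proof.
move=> cu cv uv; rewrite /haar_mean ler_pM2l ?invr_gt0 ?mass_gt0//.
by apply: le_Rintegral => //; exact: continuous_integrable.
Qed.

Lemma mean_ge0 u : (forall x, 0 <= u x) -> 0 <= mean u.
Proof.
move=> u0; rewrite /haar_mean mulr_ge0 ?invr_ge0 ?(ltW mass_gt0)//.
by apply: Rintegral_ge0.
Qed.

Lemma mean_translate x u : continuous u -> mean (fun y => u (x + y)) = mean u.
Proof.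
move=> cu; rewrite /haar_mean /Rintegral; congr (_ * fine _).
have mphi := continuous_borel_map (@addl_continuous x).
have := @integral_pushforward _ _ BX BX R _ mphi alpha [set: BX] (EFin \o u).
rewrite preimage_setT => <-//.
- by apply: eq_measure_integral => A mA _; exact: haar_preimage_addl.
- by apply/measurable_EFinP; exact: continuous_borel.
- apply: (@continuous_integrable (fun y => u (x + y))) => y.
  by apply: continuous_comp; [exact: addl_continuous|exact: cu].
Qed.

Lemma integral_mean u : continuous u -> (\int[alpha]_x (u x)%:E = (mass * mean u)%:E)%E.
Proof.
move=> cu; rewrite /haar_mean mulrA divff ?gt_eqF ?mass_gt0// mul1r /Rintegral fineK//.
by apply: integrable_fin_num => //; exact: continuous_integrable.
Qed.

Lemma mean_gt0 u x : continuous u -> (forall x, 0 <= u x) -> 0 < u x -> 0 < mean u.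
Proof.
move=> cu u0 ux; pose U := [set y | u x / 2 < u y].
have oU : open U by apply: (@open_comp _ _ u [set z | u x / 2 < z]) => [y _|]; [exact: cu|exact: open_gt].
have Ux : U x by rewrite /U /= ltr_pdivrMr// ltr_pMr// ltr1n.
rewrite /haar_mean mulr_gt0 ?invr_gt0 ?mass_gt0//.
have mU := open_borel oU.
apply: (@lt_le_trans _ _ (\int[alpha]_(y in (U : set BX)) (u x / 2))).
  rewrite Rintegral_cst// mulr_gt0 ?divr_gt0// fine_gt0// (haar_open_gt0 oU Ux)/=.
  exact: haar_lty.
apply: (@le_trans _ _ (\int[alpha]_(y in (U : set BX)) u y)).
  apply: le_Rintegral => //.
  - apply: integrableS (continuous_integrable (@cst_continuous _ _ (u x / 2))) => //.
  - by apply: integrableS (continuous_integrable cu) => //.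
  - by move=> y /ltW.
rewrite /Rintegral fine_le//.
- apply: integrable_fin_num => //.
  by apply: integrableS (continuous_integrable cu) => //.
- by apply: integrable_fin_num => //; exact: continuous_integrable.
apply: ge0_subset_integral => //.
- by apply/measurable_EFinP; exact: continuous_borel.
- by move=> y _; rewrite lee_fin.
Qed.

End HaarMean.

Section HaarFubini.
Context {R : realType} {X : topologicalZmodType}.
Local Notation BX := (borel X).
Variable alpha : {measure set BX -> \bar R}.
Hypotheses (cX : compact [set: X]) (haar : is_haar alpha).

Let mass := fine (alpha [set: BX]).
Local Notation mean := (haar_mean alpha).
Implicit Types (u v : X -> R) (V : set X) (e : R).

(** Each centre in [l] takes the part of [A] near it that is not yet assigned, weighted by its
    measure. The weights and nodes are chosen before [u], so one sum serves a whole family of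
    functions; [mean_fubini] depends on this. *)
Lemma riemann_sum_on V (l : seq X) (A : set BX) : open V -> measurable A ->
  (forall x, A x -> has (fun y => x - y \in V) l) ->
  exists W : seq (R * X), [/\ forall i, i \in W -> 0 <= i.1,
    \sum_(i <- W) i.1 = fine (alpha A) &
    forall u e, continuous u -> (forall x y, V (x - y) -> `|u x - u y| <= e) ->
      `|\int[alpha]_(x in A) u x - \sum_(i <- W) i.1 * u i.2| <= e * fine (alpha A)].
Proof.
move=> oV; elim: l A => [|y l IH] A mA Al.
  have -> : A = set0 by apply/seteqP; split=> // x /Al.
  exists [::]; split=> //; first by rewrite big_nil measure0.
  by move=> u e _ _; rewrite big_nil Rintegral_set0 measure0 subrr normr0 mulr0.
pose B : set BX := [set x | V (x - y)].
have mB : measurable B.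
  apply: open_borel; have -> : B = (fun x => - y + x) @^-1` V.
    by apply/seteqP; split=> x; rewrite /B /= addrC.
  by apply: open_comp => // z _; exact: addl_continuous.
have mAB : measurable (A `&` B) by exact: measurableI.
have mAD : measurable (A `\` B) by exact: measurableD.
have [|W [W0 W1 W2]] := IH _ mAD.
  by move=> x [/Al/= /orP[/set_mem|]].
have fin C : measurable C -> (alpha C \is a fin_num)%E.
  by move=> mC; rewrite ge0_fin_numE// haar_lty.
have AE : alpha A = (alpha (A `&` B) + alpha (A `\` B))%E.
  by rewrite [RHS]addeC -measureDI.
have iu u C : continuous u -> measurable C -> alpha.-integrable C (EFin \o (u : BX -> R)).
  by move=> cu mC; apply: integrableS (continuous_integrable cX haar cu).
exists ((fine (alpha (A `&` B)), y) :: W); split.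
- by move=> i; rewrite inE => /orP[/eqP->/=|/W0//]; rewrite fine_ge0.
- by rewrite big_cons W1 /= AE fineD// fin.
move=> u e cu Vu; rewrite big_cons /= AE fineD ?fin// mulrDr.
rewrite -[X in Rintegral _ X _](setUIDK A B) Rintegral_setU//; last 2 first.
- by rewrite setUIDK; exact: iu.
- by rewrite disj_set2E; apply/eqP/seteqP; split=> // z [[_ +] [_]].
rewrite opprD addrACA; apply: le_trans (ler_normD _ _) _.
apply: lerD; last exact: W2.
rewrite mulrC -Rintegral_cst// -RintegralB//; [|exact: iu|exact: (iu (cst (u y)) _ (@cst_continuous _ _ _))].
have cuy : continuous (fun x => u x - u y).
  by move=> x; apply: cvgB; [exact: cu|exact: cvg_cst].
apply: le_trans (le_normr_Rintegral _ _) _ => //; first exact: (iu _ _ cuy).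
rewrite -Rintegral_cst//; apply: le_Rintegral => //.
- by apply: (iu (fun x => `|u x - u y|)) => // x; apply: cvg_norm; exact: cuy.
- exact: (iu (cst e) _ (@cst_continuous _ _ _)).
- by move=> x [_ /Vu].
Qed.

Lemma riemann_sum V : open V -> V 0 ->
  exists W : seq (R * X), [/\ forall i, i \in W -> 0 <= i.1,
    \sum_(i <- W) i.1 = 1 &
    forall u e, continuous u -> (forall x y, V (x - y) -> `|u x - u y| <= e) ->
      `|mean u - \sum_(i <- W) i.1 * u i.2| <= e].
Proof.
move=> oV V0; have [l Hl] := finite_translates cX oV V0.
have [W [W0 W1 W2]] := riemann_sum_on oV (@measurableT _ BX) (fun x _ => Hl x).
have m0 := mass_gt0 haar.
exists [seq (mass^-1 * i.1, i.2) | i <- W]; split.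
- by move=> _ /mapP[i /W0 ? ->]/=; rewrite mulr_ge0// invr_ge0 ltW.
- by rewrite big_map/= -mulr_sumr W1 mulVf// gt_eqF.
move=> u e cu Vu; have := W2 _ _ cu Vu; rewrite -/mass => h.
rewrite big_map/=; under eq_bigr do rewrite -mulrA.
by rewrite -mulr_sumr /haar_mean -mulrBr normrM gtr0_norm ?invr_gt0// mulrC ler_pdivrMr.
Qed.

Section Parametrized.
Variables (T : topologicalType) (F : T * X -> R).
Hypothesis cF : continuous F.

Lemma slice_continuous t : continuous (fun x => F (t, x)).
Proof.
move=> x; apply: (@continuous_comp _ _ _ (fun x => (t, x)) F); last exact: cF.
by apply: cvg_pair => /=; [exact: cvg_cst|exact: cvg_id].
Qed.

Lemma mean_continuous : continuous (fun t => mean (fun x => F (t, x))).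
Proof.
move=> t; apply/cvgrPdist_le => e e0.
apply: filterS (compact_uniform_near cX t cF e0) => t' H.
rewrite /= -(meanB cX haar (@slice_continuous t) (@slice_continuous t')).
have cd : continuous (fun x => F (t, x) - F (t', x)).
  by move=> x; apply: cvgB; exact: slice_continuous.
have H1 x : `|F (t, x) - F (t', x)| <= e by rewrite distrC ltW.
rewrite ler_norml -[X in _ <= _ <= X](mean_cst haar) -(mean_cst haar (- e)).
by apply/andP; split; apply: ler_mean => //= x;
  try exact: cst_continuous; have := H1 x; rewrite ler_norml => /andP[].
Qed.

End Parametrized.

(** Continuity of the sum is proved along with its mean because the induction step of [meanD] asks
    for it. *)
Lemma mean_sum (I : Type) (r : seq I) (f : I -> X -> R) (w : I -> R) :
  (forall i, continuous (f i)) ->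
  mean (fun x => \sum_(i <- r) w i * f i x) = \sum_(i <- r) w i * mean (f i) /\
  continuous (fun x => \sum_(i <- r) w i * f i x).
Proof.
move=> cf; elim: r => [|i r [IH1 IH2]].
  have -> : (fun x : X => \sum_(i <- [::]) w i * f i x) = (fun=> 0).
    by apply/funext => x; rewrite big_nil.
  by rewrite big_nil mean_cst//; split=> //; exact: cst_continuous.
have cw : continuous (fun x => w i * f i x).
  by move=> x; apply: cvgM; [exact: cvg_cst|exact: cf].
have -> : (fun x => \sum_(j <- i :: r) w j * f j x) =
    (fun x => w i * f i x + \sum_(j <- r) w j * f j x).
  by apply/funext => x; rewrite big_cons.
rewrite big_cons meanD// meanZ// IH1; split=> // x.
by apply: cvgD; [exact: cw|exact: IH2].
Qed.

Lemma uniform_translate (F : X * X -> R) (e : R) : continuous F -> 0 < e ->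
  exists2 V : set X, open V /\ V 0 &
    forall x x' y, V (x - x') -> `|F (x, y) - F (x', y)| <= e.
Proof.
(* With the displacement as parameter and [X * X] as the compact space, uniform continuity under
   translation becomes [compact_uniform_near] at displacement 0. *)
move=> cF e0; pose G (p : X * (X * X)) := F (p.1 + p.2.1, p.2.2).
have cG : continuous G.
  have cadd : continuous (fun p : X * (X * X) => p.1 + p.2.1).
    move=> p; apply: (@continuous_comp _ _ _ (fun p : X * (X * X) => (p.1, p.2.1)) (fun z : X * X => z.1 + z.2)).
      apply: cvg_pair; first exact: cvg_fst.
      by apply: (@continuous_comp _ _ _ snd fst); [exact: cvg_snd|exact: cvg_fst].
    exact: add_continuous.
  move=> p; apply: (@continuous_comp _ _ _ (fun p : X * (X * X) => (p.1 + p.2.1, p.2.2)) F); last exact: cF.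
  apply: cvg_pair; first exact: cadd.
  by apply: (@continuous_comp _ _ _ snd snd); exact: cvg_snd.
have cXX : compact [set: X * X].
  by rewrite -setXTT; exact: compact_setX.
have H := compact_uniform_near cXX (0 : X) cG e0.
exists (interior [set v | forall p, `|G (v, p) - G (0, p)| < e]).
  by split; [exact: open_interior|exact: H].
move=> x x' y /interior_subset /(_ (x', y)).
by rewrite /G /= subrK add0r => /ltW.
Qed.

(** Replace the mean over [x] by one Riemann sum, valid up to [e / 2] for all [y] simultaneously. A
    finite sum commutes with the mean over [y], so both iterated means lie within [e / 2] of the
    same number [S]. *)
Lemma mean_fubini (F : X * X -> R) : continuous F ->
  mean (fun x => mean (fun y => F (x, y))) = mean (fun y => mean (fun x => F (x, y))).
Proof.
move=> cF; pose F' (p : X * X) := F (p.2, p.1).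
have cF' : continuous F'.
  move=> -[x y]; apply: (@continuous_comp _ _ _ (fun p : X * X => (p.2, p.1)) F); last exact: cF.
  by apply: cvg_pair => /=; [exact: cvg_snd|exact: cvg_fst].
apply/eqP; rewrite -subr_eq0 -normr_le0; apply/ler_addgt0Pl => e e0; rewrite addr0.
have e2 : 0 < e / 2 by rewrite divr_gt0.
have [V [oV V0] HV] := uniform_translate cF e2.
have [W [W0 W1 W2]] := riemann_sum oV V0.
have c1 : continuous (fun x => mean (fun y => F (x, y))) := mean_continuous cF.
have c2 : continuous (fun y => mean (fun x => F (x, y))) := mean_continuous cF'.
have cs x : continuous (fun y => F (x, y)) := slice_continuous cF (t := x).
have cs' y : continuous (fun x => F (x, y)) := slice_continuous cF' (t := y).
have mle u v e' : continuous u -> continuous v -> (forall x, `|u x - v x| <= e') ->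
    `|mean u - mean v| <= e'.
  move=> cu cv uv; rewrite -meanB// ler_norml -(mean_cst haar (- e')).
  rewrite -[X in _ && (_ <= X)](mean_cst haar e').
  have cuv : continuous (fun x => u x - v x) by move=> x; apply: cvgB; [exact: cu|exact: cv].
  by apply/andP; split; apply: ler_mean => //;
    try exact: cst_continuous; move=> x /=; have := uv x; rewrite ler_norml => /andP[].
pose S := \sum_(i <- W) i.1 * mean (fun y => F (i.2, y)).
have h1 : `|mean (fun x => mean (fun y => F (x, y))) - S| <= e / 2.
  apply: W2 => // x x' Vxx'; apply: mle => // y; exact: HV.
have [h2 c3] := mean_sum W (fun i => i.1) (fun i : R * X => cs i.2).
have h3 : `|mean (fun y => mean (fun x => F (x, y))) - S| <= e / 2.
  rewrite /S -h2; apply: mle => // y.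
  by apply: (W2 (fun x => F (x, y))) => // x x' Vxx'; exact: HV.
by rewrite (splitr e); apply: le_trans (ler_distD S _ _) _; rewrite lerD// distrC.
Qed.

(** Evaluate the double mean of [u (x - y)] in both orders: by translation invariance one inner mean
    is that of the reflected function, the other that of [u]. *)
Lemma mean_opp u : continuous u -> mean (fun x => u (- x)) = mean u.
Proof.
move=> cu; pose F (p : X * X) := u (p.1 - p.2).
have cF : continuous F.
  by move=> p; apply: (@continuous_comp _ _ _ (fun p : X * X => p.1 - p.2) u);
    [exact: sub_continuous|exact: cu].
have cuo : continuous (fun x => u (- x)).
  by move=> x; apply: (@continuous_comp _ _ _ -%R u); [exact: opp_continuous|exact: cu].
transitivity (mean (fun x => mean (fun y => F (x, y)))).
  rewrite -[LHS](mean_cst haar); congr (mean _); apply/funext => x.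
  rewrite -(mean_translate cX haar (- x) cuo); congr (mean _); apply/funext => y.
  by rewrite /F /= opprD opprK.
rewrite mean_fubini// -[RHS](mean_cst haar); congr (mean _); apply/funext => y.
rewrite -(mean_translate cX haar (- y) cu); congr (mean _); apply/funext => x.
by rewrite /F /= addrC.
Qed.

End HaarFubini.

(** * Characters from spectral projections *)

Section PowerSequence.
Variables (R : realType) (m : nat -> R) (C : R).
Hypothesis m_gt0 : forall n, 0 < m n.
Hypothesis m_logconvex : forall n, m n.+1 ^+ 2 <= m n * m n.+2.
Hypothesis m_double : forall n, m (n + n).+1 <= m n ^+ 2.
Hypothesis m_bound : forall n, m n.+1 <= C * m n.

Let r n := m n.+1 / m n.

Let r_gt0 n : 0 < r n. Proof. by rewrite divr_gt0. Qed.

Let mS n : m n.+1 = r n * m n. Proof. by rewrite /r divfK// gt_eqF. Qed.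

Let r_nd : nondecreasing_seq r.
Proof.
apply/nondecreasing_seqP => n.
rewrite /r ler_pdivrMr// mulrAC ler_pdivlMr// mulrC [leRHS]mulrC.
by have := m_logconvex n; rewrite expr2.
Qed.

Let r_ub : has_ubound (range r).
Proof. by exists C => _ [n _ <-]; rewrite ler_pdivrMr. Qed.

(** A constant factor disappears under roots of order [2 ^ j]: if [x < y], the powers of [x / y]
    tend to 0 and cannot stay above [c]. *)
Lemma ler_pow2_root (c x y : R) : 0 < c -> 0 <= x -> 0 <= y ->
  (forall j, c * y ^+ (2 ^ j) <= x ^+ (2 ^ j)) -> y <= x.
Proof.
move=> c0 x0 y0 H; rewrite leNgt; apply/negP => xy.
have yp : 0 < y by apply: le_lt_trans xy.
have q0 : 0 <= x / y by rewrite divr_ge0.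
have q1 : x / y < 1 by rewrite ltr_pdivrMr// mul1r.
have : (fun n => (x / y) ^+ n) @ \oo --> 0 by apply: cvg_expr; rewrite ger0_norm.
move=> /cvgrPdist_lt/(_ c c0)[n _ /(_ n (leqnn n))].
rewrite /= sub0r normrN ger0_norm ?exprn_ge0// ltNge => /negP; apply.
apply: (@le_trans _ _ ((x / y) ^+ (2 ^ n))).
  by rewrite expr_div_n ler_pdivlMr ?exprn_gt0.
by apply: ler_wiXn2l => //; [exact: ltW|exact/ltnW/ltn_expl].
Qed.

Let m_up s k n : (k + n <= s)%N -> m (k + n) <= m n * r s ^+ k.
Proof.
elim: k => [|k IH] ks; first by rewrite add0n mulr1.
rewrite addSn mS exprS mulrCA; apply: ler_pM => //.
- exact: ltW.
- exact: ltW.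
- by apply: r_nd; lia.
- by apply: IH; lia.
Qed.

(** A log-convex sequence lies above the geometric sequence of ratio [r s] that meets it at [s]; the
    cases are [n] after and before [s]. *)
Let m_low s n : m s * r s ^+ n <= m n * r s ^+ s.
Proof.
have [/subnK <-|sn] := leqP s n.
  elim: (n - s)%N => [|k IH]; first by rewrite add0n.
  rewrite addSn mS exprS mulrCA -mulrA; apply: ler_pM => //.
  - exact: ltW.
  - by rewrite mulr_ge0 ?exprn_ge0// ltW.
  - by apply: r_nd; rewrite leq_addl.
have := @m_up s (s - n) n; rewrite subnK ?(ltnW sn)// => /(_ (leqnn _)) h.
have -> : r s ^+ s = r s ^+ (s - n) * r s ^+ n by rewrite -exprD subnK// ltnW.
by rewrite mulrA ler_pM2r ?exprn_gt0.
Qed.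

(** [m_double] sends [n] to [2 n + 1], which doubles the successor of the index; hence the shape
    [(i.+1 * 2 ^ j).-1]. *)
Let m_pow2 i j : m (i.+1 * 2 ^ j).-1 <= m i ^+ (2 ^ j).
Proof.
elim: j => [|j IH]; first by rewrite muln1 expr1.
have e1 : (0 < i.+1 * 2 ^ j)%N by rewrite muln_gt0 expn_gt0.
have -> : (i.+1 * 2 ^ j.+1).-1 = ((i.+1 * 2 ^ j).-1 + (i.+1 * 2 ^ j).-1).+1.
  by rewrite expnS mulnCA; move: (i.+1 * 2 ^ j)%N e1 => [//|k] _; lia.
apply: le_trans (m_double _) _.
by rewrite expnS (mulnC 2%N) exprM ler_sqr// nnegrE ?exprn_ge0// ltW.
Qed.

(** Along the indices of [m_pow2], [m_low] gives growth at least like powers of [r s], up to the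
    constant [m s / r s ^+ s.+1], which [ler_pow2_root] removes. *)
Let m_ge_r i s : r s ^+ i.+1 <= m i.
Proof.
apply: (@ler_pow2_root (m s / r s ^+ s.+1)).
- by rewrite divr_gt0// exprn_gt0.
- exact: ltW.
- by rewrite exprn_ge0// ltW.
move=> j; apply: le_trans (m_pow2 i j).
have := m_low s (i.+1 * 2 ^ j).-1.
have e1 : (0 < i.+1 * 2 ^ j)%N by rewrite muln_gt0 expn_gt0.
rewrite -(ler_pM2l (r_gt0 s)) -exprM.
move: (i.+1 * 2 ^ j)%N e1 => [//|n] _ /= h.
rewrite mulrAC ler_pdivrMr ?exprn_gt0// !exprS.
by move: h; rewrite [X in _ -> X <= _]mulrCA [X in _ -> _ <= X]mulrCA.
Qed.

(* [m n] stands for the value at 0 of the convolution power [2 n + 2] of a kernel;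
   [Lam], the limit of the increasing ratios [m n.+1 / m n], is then the square of
   its spectral radius. *)
Lemma power_sequence_growth : exists2 Lam : R, 0 < Lam &
  (forall n, m n.+1 / Lam ^+ n.+2 <= m n / Lam ^+ n.+1) /\
  (forall n, 1 <= m n / Lam ^+ n.+1).
Proof.
have r_cvg : r @ \oo --> sup (range r) := nondecreasing_cvgn r_nd r_ub.
have rL n : r n <= sup (range r) by apply: ub_le_sup => //; exists n.
have L0 : 0 < sup (range r) by apply: lt_le_trans (rL 0%N).
exists (sup (range r)) => //; split=> n.
  rewrite mS exprS invfM mulrACA ler_piMl//.
    by rewrite divr_ge0 ?exprn_ge0 ?(ltW L0)// ltW.
  by rewrite ler_pdivrMr// mul1r.
rewrite ler_pdivlMr ?exprn_gt0// mul1r.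
have h : (fun s => r s ^+ n.+1) @ \oo --> sup (range r) ^+ n.+1.
  exact: (continuous_cvg _ (@exprn_continuous R n.+1 _) r_cvg).
rewrite -(cvg_lim _ h)//; apply: limr_le; first by apply/cvg_ex; eexists; exact: h.
by apply: nearW => s; exact: m_ge_r.
Qed.

End PowerSequence.

Section ContinuousFunctions.
Context {R : realType} {X : topologicalType}.
Implicit Types (u v : X -> R) (k : R).

Lemma continuousMf u v : continuous u -> continuous v -> continuous (fun x => u x * v x).
Proof. by move=> cu cv x; apply: cvgM; [exact: cu|exact: cv]. Qed.

Lemma continuousDf u v : continuous u -> continuous v -> continuous (fun x => u x + v x).
Proof. by move=> cu cv x; apply: cvgD; [exact: cu|exact: cv]. Qed.

Lemma continuousBf u v : continuous u -> continuous v -> continuous (fun x => u x - v x).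
Proof. by move=> cu cv x; apply: cvgB; [exact: cu|exact: cv]. Qed.

Lemma continuousZf k u : continuous u -> continuous (fun x => k * u x).
Proof. by apply: continuousMf; exact: cst_continuous. Qed.

Lemma continuousXf u n : continuous u -> continuous (fun x => u x ^+ n).
Proof. by move=> cu x; apply: (continuous_cvg _ (@exprn_continuous R n _)); exact: cu. Qed.

Lemma continuous_sumf (I : Type) (r : seq I) (F : I -> X -> R) :
  (forall i, continuous (F i)) -> continuous (fun x => \sum_(i <- r) F i x).
Proof.
move=> cF; elim: r => [|i r IH].
  rewrite (_ : (fun x => _) = fun=> 0); first by move=> ?; exact: cvg_cst.
  by apply/funext => x; rewrite big_nil.
rewrite (_ : (fun x => _) = fun x => F i x + \sum_(j <- r) F j x).
  exact: continuousDf.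
by apply/funext => x; rewrite big_cons.
Qed.

End ContinuousFunctions.

Section Convolution.
Context {R : realType} {X : topologicalZmodType}.
Local Notation BX := (borel X).
Variable alpha : {measure set BX -> \bar R}.
Hypotheses (cX : compact [set: X]) (haar : is_haar alpha).

Local Notation mean := (haar_mean alpha).
Implicit Types (u v w : X -> R) (k e : R).

Lemma continuous_translate u x : continuous u -> continuous (fun y => u (x + y)).
Proof.
by move=> cu y; apply: (@continuous_comp _ _ _ (fun y => x + y) u);
  [exact: addl_continuous|exact: cu].
Qed.

Lemma continuous_reflect u x : continuous u -> continuous (fun y => u (x - y)).
Proof.
move=> cu y; apply: (@continuous_comp _ _ _ -%R (fun y => u (x + y))).
  exact: opp_continuous.
exact: continuous_translate.
Qed.

Lemma mean_reflect u x : continuous u -> mean (fun y => u (x - y)) = mean u.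
Proof.
move=> cu; rewrite -(mean_translate cX haar x cu).
by rewrite -(mean_opp cX haar (@continuous_translate u x cu)).
Qed.

Lemma mean_dist u v e : continuous u -> continuous v -> (forall x, `|u x - v x| <= e) ->
  `|mean u - mean v| <= e.
Proof.
move=> cu cv uv; rewrite -meanB// ler_norml -(mean_cst haar (- e)).
rewrite -[X in _ && (_ <= X)](mean_cst haar e).
have cuv := continuousBf cu cv.
by apply/andP; split; apply: ler_mean => //;
  try exact: cst_continuous; move=> x /=; have := uv x; rewrite ler_norml => /andP[].
Qed.

Lemma mean_sqr_eq0 u : continuous u -> mean (fun x => u x ^+ 2) = 0 -> u = fun=> 0.
Proof.
move=> cu u0; apply/funext => x; apply/eqP; apply: contra_eqT u0 => ux.
rewrite gt_eqF//; apply: (@mean_gt0 _ _ _ cX haar _ x).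
- exact: continuousXf.
- by move=> y; exact: sqr_ge0.
- by rewrite lt0r sqr_ge0 sqrf_eq0 ux.
Qed.

Lemma mean_cauchy_schwarz u v : continuous u -> continuous v ->
  mean (fun x => u x * v x) ^+ 2 <= mean (fun x => u x ^+ 2) * mean (fun x => v x ^+ 2).
Proof.
move=> cu cv; set s := mean (fun x => u x * v x).
set a := mean (fun x => u x ^+ 2); set t := mean (fun x => v x ^+ 2).
have cuv := continuousMf cu cv; have cuu := @continuousXf _ _ u 2 cu.
have cvv := @continuousXf _ _ v 2 cv.
have t0 : 0 <= t by apply: mean_ge0 => // x; exact: sqr_ge0.
have : 0 <= mean (fun x => (t * u x - s * v x) ^+ 2).
  by apply: mean_ge0 => // x; exact: sqr_ge0.
have -> : mean (fun x => (t * u x - s * v x) ^+ 2) = t * (t * a - s ^+ 2).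
  have -> : (fun x => (t * u x - s * v x) ^+ 2) =
      (fun x => (t ^+ 2 * u x ^+ 2 - (2 * t * s) * (u x * v x)) + s ^+ 2 * v x ^+ 2).
    by apply/funext => x; ring.
  have c1 := @continuousZf _ _ (t ^+ 2) _ cuu; have c2 := @continuousZf _ _ (2 * t * s) _ cuv.
  have c3 := @continuousZf _ _ (s ^+ 2) _ cvv; have c4 := continuousBf c1 c2.
  by rewrite meanD// meanB// !meanZ// -/s -/a -/t; ring.
have [t00|tn0] := eqVneq t 0.
  have v0 := mean_sqr_eq0 cv t00.
  have -> : s = 0.
    rewrite /s v0; rewrite -[RHS](mean_cst haar 0); congr mean.
    by apply/funext => x; rewrite mulr0.
  by rewrite t00 mulr0 expr0n.
by rewrite pmulr_rge0 ?lt0r ?tn0// subr_ge0 mulrC.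
Qed.

Definition convolution u v x : R := mean (fun y => u (x - y) * v y).
Local Notation convol := convolution.

Lemma convol_integrand_continuous u v : continuous u -> continuous v ->
  continuous (fun p : X * X => u (p.1 - p.2) * v p.2).
Proof.
move=> cu cv p; apply: cvgM.
  apply: (@continuous_comp _ _ _ (fun p : X * X => p.1 - p.2) u); last exact: cu.
  exact: sub_continuous.
by apply: (@continuous_comp _ _ _ snd v); [exact: cvg_snd|exact: cv].
Qed.

Lemma convol_slice_continuous u v x : continuous u -> continuous v ->
  continuous (fun y => u (x - y) * v y).
Proof. by move=> cu cv; apply: continuousMf => //; exact: continuous_reflect. Qed.

Lemma convol_continuous u v : continuous u -> continuous v -> continuous (convol u v).
Proof.
by move=> cu cv; exact: (mean_continuous cX haar (convol_integrand_continuous cu cv)).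
Qed.

Lemma convolC u v : continuous u -> continuous v -> convol u v = convol v u.
Proof.
move=> cu cv; apply/funext => x; rewrite /convolution.
rewrite -(mean_reflect x (@convol_slice_continuous u v x cu cv)); congr mean.
by apply/funext => y; rewrite subKr mulrC.
Qed.

(** Fubini, followed by translation by [z] in the inner mean. *)
Lemma convolA u v w : continuous u -> continuous v -> continuous w ->
  convol u (convol v w) = convol (convol u v) w.
Proof.
move=> cu cv cw; apply/funext => x; rewrite /convolution.
pose F (p : X * X) := u (x - p.1) * (v (p.1 - p.2) * w p.2).
have cF : continuous F.
  move=> p; apply: cvgM.
    apply: (@continuous_comp _ _ _ fst (fun y => u (x - y))); first exact: cvg_fst.
    exact: continuous_reflect.
  exact: convol_integrand_continuous.
transitivity (mean (fun y => mean (fun z => F (y, z)))).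
  congr mean; apply/funext => y; rewrite -meanZ//; exact: convol_slice_continuous.
rewrite mean_fubini//; congr mean; apply/funext => z.
have cs := @convol_slice_continuous u v (x - z) cu cv.
rewrite mulrC -meanZ//.
have cG : continuous (fun y => F (y, z)).
  apply: continuousMf; first exact: continuous_reflect.
  apply: continuousMf; last by move=> ?; exact: cvg_cst.
  rewrite (_ : (fun y => _) = (fun y => v (- z + y))); first exact: continuous_translate.
  by apply/funext => y; rewrite addrC.
rewrite -(mean_translate cX haar z cG); congr mean; apply/funext => y.
by rewrite /F /= opprD addrA [z + y]addrC addrK; ring.
Qed.

Lemma convolZl k u v : continuous u -> continuous v ->
  convol (fun x => k * u x) v = (fun x => k * convol u v x).
Proof.
move=> cu cv; apply/funext => x; rewrite /convolution -meanZ//; last exact: convol_slice_continuous.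
by congr mean; apply/funext => y; rewrite mulrA.
Qed.

Lemma convolZr k u v : continuous u -> continuous v ->
  convol u (fun x => k * v x) = (fun x => k * convol u v x).
Proof.
move=> cu cv; rewrite convolC//; last exact: continuousZf.
by rewrite convolZl// convolC.
Qed.

Lemma convolBl u v w : continuous u -> continuous v -> continuous w ->
  convol (fun x => u x - v x) w = (fun x => convol u w x - convol v w x).
Proof.
move=> cu cv cw; apply/funext => x; rewrite /convolution -meanB//; try exact: convol_slice_continuous.
by congr mean; apply/funext => y; rewrite mulrBl.
Qed.

Lemma convolBr u v w : continuous u -> continuous v -> continuous w ->
  convol w (fun x => u x - v x) = (fun x => convol w u x - convol w v x).
Proof.
move=> cu cv cw; rewrite convolC//; last exact: continuousBf.
by rewrite convolBl// (convolC cu)// (convolC cv).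
Qed.

(** An even real kernel convolves as a symmetric operator, and evenness turns values of convolutions
    at 0 into inner products. *)
Definition even_fun u := forall x, u (- x) = u x.

Lemma convol_even u v : continuous u -> continuous v -> even_fun u -> even_fun v ->
  even_fun (convol u v).
Proof.
move=> cu cv eu ev x; rewrite /convolution.
rewrite -(mean_opp cX haar (@convol_slice_continuous u v x cu cv)); congr mean.
by apply/funext => y; rewrite ev -(eu (x - - y)) opprB addrC.
Qed.

Lemma convol_at0 u v : even_fun u -> convol u v 0 = mean (fun x => u x * v x).
Proof. by move=> eu; congr mean; apply/funext => y; rewrite sub0r eu. Qed.

(** Cauchy-Schwarz, with invariance removing [x]. This is the device that upgrades L2 estimates to
    uniform ones. *)
Lemma convol_bound u v x : continuous u -> continuous v ->
  convol u v x ^+ 2 <= mean (fun x => u x ^+ 2) * mean (fun x => v x ^+ 2).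
Proof.
move=> cu cv; apply: le_trans (mean_cauchy_schwarz (@continuous_reflect u x cu) cv) _.
by rewrite (mean_reflect x (@continuousXf _ _ u 2 cu)).
Qed.

End Convolution.

Lemma eq_cvgn_lim (R : realType) (f g : nat -> R) (l l' : R) : f =1 g ->
  f @ \oo --> l -> g @ \oo --> l' -> l = l'.
Proof.
by move=> /funext <- fl fl'; rewrite -(cvg_lim (@Rhausdorff R) fl) (cvg_lim (@Rhausdorff R) fl').
Qed.

Section UniformLimits.
Context {R : realType} {X : topologicalType}.
Implicit Types (f : nat -> X -> R) (phi : X -> R).

Definition ucvg f phi := forall e : R, 0 < e ->
  exists N, forall n, (N <= n)%N -> forall x, `|f n x - phi x| <= e.

Lemma ucvg_cvg f phi x : ucvg f phi -> (fun n => f n x) @ \oo --> phi x.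
Proof.
move=> fphi; apply/cvgrPdist_le => e /fphi[N HN].
by exists N => // n /= /HN; rewrite distrC.
Qed.

Lemma ucauchy_ucvg f : (forall e : R, 0 < e -> exists N, forall n m,
    (N <= n)%N -> (N <= m)%N -> forall x, `|f n x - f m x| <= e) ->
  exists phi, ucvg f phi.
Proof.
move=> fC.
have fcvg x : cvg ((fun n => f n x) @ \oo).
  apply/cauchy_cvgP/cauchy_exP => e e0; have e2 : 0 < e / 2 by rewrite divr_gt0.
  have [N HN] := fC _ e2; exists (f N x); exists N => // n /= Nn.
  rewrite /ball /= distrC; apply: le_lt_trans (HN _ _ Nn (leqnn N) x) _.
  by rewrite ltr_pdivrMr// ltr_pMr// ltr1n.
exists (fun x => lim ((fun n => f n x) @ \oo)) => e /fC[N HN].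
exists N => n Nn x; rewrite distrC -[X in `|X|]opprB normrN.
have h : (fun m => `|f n x - f m x|) @ \oo --> `|f n x - lim ((fun n => f n x) @ \oo)|.
  by apply: cvg_norm; apply: cvgB; [exact: cvg_cst|exact: fcvg].
rewrite -(cvg_lim _ h)//; apply: limr_le; first by apply/cvg_ex; eexists; exact: h.
by exists N => // m /= Nm; exact: HN.
Qed.

Lemma ucvg_continuous f phi : (forall n, continuous (f n)) -> ucvg f phi -> continuous phi.
Proof.
move=> cf fphi x; apply/cvgrPdist_le => e e0.
have e3 : 0 < e / 3 by rewrite divr_gt0.
have [N HN] := fphi _ e3.
have /cvgrPdist_le/(_ _ e3) := cf N x.
apply: filterS => y Hy.
have -> : phi x - phi y = (f N x - f N y) - (f N x - phi x) + (f N y - phi y) by ring.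
have -> : e = e / 3 + e / 3 + e / 3 by field.
apply: le_trans (ler_normD _ _) _; apply: lerD; last exact: HN.
by apply: le_trans (ler_normB _ _) _; apply: lerD => //; exact: HN.
Qed.

End UniformLimits.
Arguments ucvg_cvg {R X f phi} x.

Section Projections.
Context {R : realType} {X : topologicalZmodType}.
Local Notation BX := (borel X).
Variable alpha : {measure set BX -> \bar R}.
Hypotheses (cX : compact [set: X]) (haar : is_haar alpha).

Local Notation mean := (haar_mean alpha).
Local Notation convol := (convolution alpha).
Implicit Types (u v w phi psi : X -> R) (k e : R).

Lemma ucvg_convol (f h : nat -> X -> R) phi psi x :
  (forall n, continuous (f n)) -> (forall n, continuous (h n)) ->
  ucvg f phi -> ucvg h psi ->
  (fun n => convol (f n) (h n) x) @ \oo --> convol phi psi x.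
Proof.
move=> cf ch fphi hpsi.
have cphi := ucvg_continuous cf fphi; have cpsi := ucvg_continuous ch hpsi.
have [B B0 HB] := compact_continuous_bounded cX cphi.
have [D D0 HD] := compact_continuous_bounded cX cpsi.
apply/cvgrPdist_le => e e0; pose M := B + D + 1.
have M0 : 0 < M by rewrite /M; lra.
(* The cap 1 bounds the quadratic term [d * d] by [d]; this is the 1 in [M]. *)
pose d := Num.min 1 (e / M).
have d0 : 0 < d by rewrite lt_min ltr01 divr_gt0.
have [N1 H1] := fphi _ d0; have [N2 H2] := hpsi _ d0.
exists (maxn N1 N2) => // n /=; rewrite geq_max => /andP[n1 n2].
apply: mean_dist => //; try by apply: convol_slice_continuous.
move=> y; rewrite distrC.
have h1 := H1 n n1 (x - y); have h2 := H2 n n2 y.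
have -> : f n (x - y) * h n y - phi (x - y) * psi y =
  (f n (x - y) - phi (x - y)) * (h n y - psi y) +
  (f n (x - y) - phi (x - y)) * psi y + phi (x - y) * (h n y - psi y) by ring.
have dM : d * M <= e by rewrite -ler_pdivlMr// ge_min lexx orbT.
have d1 : d <= 1 by rewrite ge_min lexx.
apply: le_trans (ler_normD _ _) _; rewrite normrM.
apply: (@le_trans _ _ (d * d + d * D + B * d)).
  apply: lerD; last by apply: ler_pM.
  apply: le_trans (ler_normD _ _) _; rewrite !normrM.
  by apply: lerD; apply: ler_pM.
by apply: le_trans dM; rewrite /M; nra.
Qed.

Variable k : X -> R.
Hypotheses (ck : continuous k) (ek : even_fun k).

(* Off by one: [cpow n] is the convolution power [n.+1] of [k]. *)
Fixpoint cpow n : X -> R := if n is n'.+1 then convol k (cpow n') else k.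

Lemma cpow_continuous n : continuous (cpow n).
Proof. by elim: n => [//|n IH]; exact: convol_continuous. Qed.

Lemma cpow_even n : even_fun (cpow n).
Proof. by elim: n => [//|n IH]; apply: convol_even => //; exact: cpow_continuous. Qed.

Lemma convol_cpow i j : convol (cpow i) (cpow j) = cpow (i + j).+1.
Proof.
have cc := cpow_continuous.
by elim: i => [//|i IH]; rewrite addSn -[RHS]/(convol k (cpow (i + j).+1)) -IH convolA.
Qed.

Lemma mean_cpow i j : mean (fun x => cpow i x * cpow j x) = cpow (i + j).+1 0.
Proof. by rewrite -convol_cpow convol_at0//; exact: cpow_even. Qed.

Let m n := cpow (n + n).+1 0.

Let mE n : m n = mean (fun x => cpow n x ^+ 2).
Proof. by rewrite /m -mean_cpow. Qed.

Hypothesis k_neq0 : k <> fun=> 0.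

Let m_logconvex n : m n.+1 ^+ 2 <= m n * m n.+2.
Proof.
have -> : m n.+1 = mean (fun x => cpow n x * cpow n.+2 x).
  by rewrite mean_cpow /m; congr (cpow _ 0); lia.
by rewrite !mE; apply: mean_cauchy_schwarz => //; exact: cpow_continuous.
Qed.

Let m_gt0 n : 0 < m n.
Proof.
have m_ge0 i : 0 <= m i by rewrite mE; apply: mean_ge0 => // x; exact: sqr_ge0.
have m0 : 0 < m 0.
  rewrite lt0r m_ge0 andbT; apply/eqP => m00.
  by apply: k_neq0; apply: (mean_sqr_eq0 cX haar) => //; rewrite -m00 mE.
(* Log-convexity passes positivity on only from two consecutive terms; for the first pair,
   [cpow 1 0 = m 0] shows that [cpow 1] is not zero. *)
suff : 0 < m n /\ 0 < m n.+1 by case.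
elim: n => [|n [_ h2]]; split.
- exact: m0.
- rewrite mE; apply: (@mean_gt0 _ _ _ cX haar _ 0).
  + exact/continuousXf/cpow_continuous.
  + by move=> y; exact: sqr_ge0.
  + by rewrite exprn_gt0.
- exact: h2.
rewrite lt0r m_ge0 andbT; apply/eqP => h.
by have := m_logconvex n; rewrite h mulr0 leNgt exprn_gt0.
Qed.

(** [cpow (n + n).+1] is [cpow n] convolved with itself, so [convol_bound] bounds its square
    everywhere, and a mean is at most a uniform bound. *)
Let m_double n : m (n + n).+1 <= m n ^+ 2.
Proof.
rewrite [leLHS]mE -[leRHS](mean_cst haar); apply: ler_mean => //.
- exact/continuousXf/cpow_continuous.
- by move=> ?; exact: cvg_cst.
move=> x; rewrite -convol_cpow [leRHS]expr2 mE.
by apply: convol_bound => //; exact: cpow_continuous.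
Qed.

Let m_bound n : m n.+1 <= m 0 * m n.
Proof.
rewrite [leLHS]mE -[leRHS](mean_cst haar); apply: ler_mean => //.
- exact/continuousXf/cpow_continuous.
- by move=> ?; exact: cvg_cst.
by move=> x; rewrite !mE; apply: convol_bound => //; exact: cpow_continuous.
Qed.

(* The normalised even powers [kap n] have L2 distances expressed through the
   convergent sequence [a], so they are Cauchy in L2; one more convolution makes
   them uniformly Cauchy. *)
Lemma power_projection : exists phi (Lam : R), [/\ continuous phi, even_fun phi,
  convol phi phi = phi, phi 0 != 0 & 0 < Lam /\
  convol (convol k k) phi = (fun x => Lam * phi x)].
Proof.
have [Lam L0 [a_ni a_ge1]] := power_sequence_growth m_gt0 m_logconvex m_double m_bound.
pose a n := m n / Lam ^+ n.+1.
pose kap n x := (Lam ^+ n.+1)^-1 * cpow (n + n).+1 x.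
have ckap n : continuous (kap n) by apply: continuousZf; exact: cpow_continuous.
have Ln0 n : Lam ^+ n != 0 by rewrite expf_neq0// gt_eqF.
have kapM i j : convol (kap i) (kap j) = kap (i + j).+1.
  have cc := cpow_continuous.
  rewrite (convolZl cX haar _ (cc _) (ckap j)) (convolZr cX haar _ (cc _) (cc _)).
  apply/funext => x; rewrite convol_cpow /kap mulrA -invfM -exprD.
  by congr (_^-1 * cpow _ _); [congr (_ ^+ _)|]; lia.
have ekap n : even_fun (kap n) by move=> x; rewrite /kap cpow_even.
have kap0 n : kap n 0 = a n by rewrite /kap /a mulrC.
have kap_dist i j : mean (fun x => (kap i x - kap j x) ^+ 2) =
    a (i + i).+1 - 2 * a (i + j).+1 + a (j + j).+1.
  rewrite -!kap0 -!kapM !convol_at0//.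
  have cm i' j' : continuous (fun x => kap i' x * kap j' x) by exact: continuousMf.
  have c2 : continuous (fun x => 2 * (kap i x * kap j x)) by exact: continuousZf.
  rewrite -meanZ// -meanB// -meanD//; last exact: continuousBf.
  by congr mean; apply/funext => x; ring.
have a_cvg : cvgn a.
  apply: nonincreasing_is_cvgn; first by apply/nonincreasing_seqP.
  by exists 1 => _ [n _ <-]; exact: a_ge1.
have kapC (e : R) : 0 < e -> exists N, forall i j, (N <= i)%N -> (N <= j)%N ->
    forall x, `|kap i x - kap j x| <= e.
  move=> e0.
  pose c := mean (fun x => kap 0 x ^+ 2) + 1.
  have c0 : 0 < c.
    by rewrite ltr_wpDl// mean_ge0// => x; exact: sqr_ge0.
  (* If the terms of [a] are within [d] of their limit, the mean square distance in [kap_dist] is at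
     most [4 * d]. The extra convolution by [kap 0], which accounts for [N.+1] below, costs a factor
     [c], and [c * (4 * d)] is [e ^+ 2]. *)
  pose d := e ^+ 2 / (4 * c).
  have d0 : 0 < d by rewrite divr_gt0 ?exprn_gt0 ?mulr_gt0.
  have /cvgrPdist_le/(_ d d0)[N _ HN] := a_cvg.
  exists N.+1 => -[//|i] [//|j] Ni Nj x.
  have HN' n : (N <= n)%N -> `|lim (a @ \oo) - a n| <= d by exact: HN.
  have bd : mean (fun x => (kap i x - kap j x) ^+ 2) <= 4 * d.
    rewrite kap_dist.
    have := HN' (i + i).+1; have := HN' (i + j).+1; have := HN' (j + j).+1.
    rewrite !ler_norml => /(_ _)/andP[|h1 h2]; first by lia.
    move=> /(_ _)/andP[|h3 h4]; first by lia.
    move=> /(_ _)/andP[|h5 h6]; first by lia.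
    lra.
  have -> : kap i.+1 x - kap j.+1 x = convol (kap 0) (fun x => kap i x - kap j x) x.
    by rewrite convolBr// !kapM.
  rewrite -ler_sqr ?nnegrE ?(ltW e0)// real_normK ?num_real//.
  apply: le_trans (convol_bound _ _ _ _ _) _ => //; first exact: continuousBf.
  have hc : mean (fun x => kap 0 x ^+ 2) <= c by rewrite lerDl.
  apply: (@le_trans _ _ (c * (4 * d))).
    apply: ler_pM => //; apply: mean_ge0 => // y; exact: sqr_ge0.
  suff -> : c * (4 * d) = e ^+ 2 by [].
  by rewrite /d; field; rewrite gt_eqF.
have [phi kphi] := ucauchy_ucvg kapC.
have cphi := ucvg_continuous ckap kphi.
exists phi, Lam; split=> //.
- move=> x; apply: (@eq_cvgn_lim _ (fun n => kap n (- x)) (fun n => kap n x) _ _ _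
    (ucvg_cvg (- x) kphi) (ucvg_cvg x kphi)).
  by move=> n; exact: ekap.
- apply/funext => x.
  apply: (@eq_cvgn_lim _ (fun n => convol (kap n) (kap n) x)
    (fun n => kap (n + n).+1 x) _ _ _
    (ucvg_convol (x := x) ckap ckap kphi kphi)); first by move=> n; rewrite kapM.
  apply: (cvg_comp (fun n => (n + n).+1) _ _ (ucvg_cvg x kphi)).
  by apply/cvgnyPge => A; exists A => // n /= An; lia.
- have h := ucvg_cvg 0 kphi; rewrite gt_eqF// (lt_le_trans ltr01)//.
  rewrite -(cvg_lim _ h)//; apply: limr_ge; first by apply/cvg_ex; eexists; exact: h.
  by apply: nearW => n; rewrite kap0; exact: a_ge1.
split=> //; apply/funext => x.
have h1 : ucvg (fun=> cpow 1) (cpow 1).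
  by move=> e e0; exists 0 => n _ y; rewrite subrr normr0 ltW.
apply: (@eq_cvgn_lim _ (fun n => convol (cpow 1) (kap n) x)
  (fun n => Lam * kap n.+1 x) _ _ _
  (ucvg_convol (x := x) (fun=> @cpow_continuous 1) ckap h1 kphi)).
  move=> n; rewrite (convolZr cX haar _ (@cpow_continuous 1) (@cpow_continuous _)).
  rewrite convol_cpow /kap [in RHS]mulrA; congr (_ * cpow _ _); last by lia.
  by rewrite [in RHS]exprS invfM mulrA divff ?mul1r// gt_eqF.
apply: cvgM; first exact: cvg_cst.
have h := ucvg_cvg x kphi.
by rewrite (cvg_shiftS (fun n => kap n x)).
Qed.

End Projections.

Section MinimalProjections.
Context {R : realType} {X : topologicalZmodType}.
Local Notation BX := (borel X).
Variable alpha : {measure set BX -> \bar R}.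
Hypotheses (cX : compact [set: X]) (haar : is_haar alpha).

Local Notation mean := (haar_mean alpha).
Local Notation convol := (convolution alpha).
Implicit Types (u v w phi psi s : X -> R) (k e : R).

(** Convolution by such a [phi] is an orthogonal projection, and [phi 0] is its trace, that is, its
    rank. *)
Definition projection phi :=
  [/\ continuous phi, even_fun phi, convol phi phi = phi & phi 0 != 0].

(** Idempotence makes [phi 0] the mean of [phi ^ 2], while [convol_bound] gives
    [phi x ^ 2 <= phi 0 ^ 2]; taking means, [phi 0 <= phi 0 ^ 2]. *)
Lemma projection_ge1 phi : projection phi -> 1 <= phi 0.
Proof.
move=> [cphi ephi pp p0].
have p0E : phi 0 = mean (fun x => phi x ^+ 2) by rewrite -{1}pp convol_at0.
have p_gt0 : 0 < phi 0.
  by rewrite lt0r p0 p0E mean_ge0// => x; exact: sqr_ge0.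
rewrite -(ler_pM2l p_gt0) mulr1 {1}p0E -[leRHS](mean_cst haar); apply: ler_mean => //.
- exact: continuousXf.
- by move=> ?; exact: cvg_cst.
by move=> x; rewrite -{1}pp p0E; exact: convol_bound.
Qed.

Definition minimal_projection phi := projection phi /\
  forall psi, projection psi -> convol phi psi = psi -> psi = phi.

Lemma ex_minimal_projection phi0 : projection phi0 ->
  exists2 phi, minimal_projection phi & convol phi0 phi = phi.
Proof.
have [N] : exists N, phi0 0 < N%:R.
  by exists (Num.truncn (phi0 0)).+1; rewrite truncnS_gt.
(* Splitting off a proper subprojection lowers the value at 0 by at least 1. *)
elim: N phi0 => [|N IH] phi0 phi0N p0.
  by have := lt_le_trans phi0N (le_trans ler01 (projection_ge1 p0)); rewrite ltxx.
have [cp0 ep0 pp0 n0] := p0.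
have [min|] := pselect (forall psi, projection psi -> convol phi0 psi = psi -> psi = phi0).
  by exists phi0.
move=> /existsNP[psi] /not_implyP[ppsi] /not_implyP[psi_le psi_neq].
have [cpsi epsi pp n1] := ppsi.
have cd := continuousBf cp0 cpsi.
have pd : convol (fun x => phi0 x - psi x) (fun x => phi0 x - psi x) =
    (fun x => phi0 x - psi x).
  rewrite convolBl// !convolBr// pp0 psi_le (convolC cX haar cpsi cp0) psi_le pp.
  by apply/funext => x; rewrite subrr subr0.
have ed : even_fun (fun x => phi0 x - psi x) by move=> x; rewrite ep0 epsi.
have d0 : phi0 0 - psi 0 != 0.
  apply/eqP => d0; apply: psi_neq; apply/esym/funext => x; apply/eqP.
  rewrite -subr_eq0; apply/eqP.
  have : (fun x => phi0 x - psi x) = fun=> 0.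
    apply: (mean_sqr_eq0 cX haar) => //.
    rewrite -[RHS]d0 -[RHS](congr1 (fun f => f 0) pd) convol_at0//.
  by move=> /(congr1 (fun f => f x)).
have d1 := projection_ge1 (And4 cd ed pd d0).
have [||phi mphi psiphi] := IH psi => //.
  by move: phi0N; rewrite -natr1 /= in d1 *; lra.
exists phi => //; have [[cphi _ _ _] _] := mphi.
by rewrite -psiphi convolA// psi_le.
Qed.

(* By minimality every even [w] with [phi * w = w] has [w * w] proportional to
   [phi]; compare this for [w = v] and [w = v - phi]. *)
Lemma minimal_projection_scalar phi v : minimal_projection phi ->
  continuous v -> even_fun v -> convol phi v = v ->
  exists k, v = fun x => k * phi x.
Proof.
move=> [[cphi ephi pp n0] min].
have sqr w : continuous w -> even_fun w -> convol phi w = w ->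
    exists k, convol w w = fun x => k * phi x.
  move=> cw ew pw; have [->|/eqP w0] := eqVneq w (fun=> 0).
    exists 0; apply/funext => x; rewrite mul0r -[RHS](mean_cst haar).
    by congr mean; apply/funext => y; rewrite mulr0.
  (* Since [psi] is a multiple of [w * w * psi] as convolutions, [phi] fixes it, and minimality
     gives [psi = phi]. The eigenvalue relation for [psi] then says that [w] convolved with itself
     is [Lam * phi]. *)
  have [psi [Lam [cpsi epsi ppsi psi0 [L0 wpsi]]]] := power_projection cX haar cw ew w0.
  have cww := convol_continuous cX haar cw cw.
  have psiE : psi = fun x => Lam^-1 * convol (convol w w) psi x.
    by apply/funext => x; rewrite wpsi mulrA mulVf ?mul1r// gt_eqF.
  have psi_le : convol phi psi = psi.
    rewrite psiE (convolZr cX haar _ cphi (convol_continuous cX haar cww cpsi)).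
    by rewrite (convolA cX haar cphi cww cpsi) (convolA cX haar cphi cw cw) pw.
  have psiphi := min psi (And4 cpsi epsi ppsi psi0) psi_le.
  exists Lam; rewrite -psiphi -wpsi psiphi.
  by rewrite (convolC cX haar cww cphi) (convolA cX haar cphi cw cw) pw.
move=> cv ev pv.
have [a Ha] := sqr _ cv ev pv.
have cd := continuousBf cv cphi.
have [|||b Hb] := sqr (fun x => v x - phi x) => //.
- by move=> x; rewrite ev ephi.
- by rewrite convolBr// pv pp.
(* Expanding the convolution square of [v - phi] gives [a * phi - 2 * v + phi = b * phi]; solve for
   [v]. *)
exists ((a + 1 - b) / 2); apply/funext => x.
move: Hb; rewrite convolBl// !convolBr// pp pv Ha (convolC cX haar cv cphi) pv.
by move=> /(congr1 (fun f => f x)) /=; lra.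
Qed.

Definition dalembert s :=
  [/\ continuous s, s 0 = 1 & forall x y, s (x + y) + s (x - y) = 2 * (s x * s y)].

(** The sum [v] of the translates of [phi] by [y] and [- y] is even and fixed by convolution with
    [phi], hence a multiple of [phi]. Its value at 0 identifies the scalar, and its value at [x] is
    the equation. *)
Lemma minimal_projection_dalembert phi : minimal_projection phi ->
  dalembert (fun x => phi x / phi 0).
Proof.
move=> mphi; have [[cphi ephi pp n0] _] := mphi.
split; [by move=> x; apply: cvgMl; exact: cphi|by rewrite divff|move=> x y].
pose v z := phi (y + z) + phi (- y + z).
have c1 := @continuous_translate _ _ phi y cphi.
have c2 := @continuous_translate _ _ phi (- y) cphi.
have cv : continuous v := continuousDf c1 c2.
have ev : even_fun v.
  move=> z; rewrite /v -opprD ephi -(ephi (y - z)) opprB [z - y]addrC.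
  by rewrite [LHS]addrC.
have tr z : convol phi (fun t => phi (z + t)) = fun t => phi (z + t).
  apply/funext => t; rewrite -[in RHS]pp /convolution.
  have cz := @continuous_translate _ _ phi z cphi.
  rewrite -(mean_translate cX haar (- z) (@convol_slice_continuous _ _ phi _ t cphi cz)).
  congr mean; apply/funext => a; rewrite addrA subrr add0r.
  by rewrite opprD opprK addrA [t + z]addrC.
have pv : convol phi v = v.
  rewrite /v (_ : (fun z => _) = (fun z => phi (y + z) - (- 1 * phi (- y + z)))); last first.
    by apply/funext => z; rewrite mulN1r opprK.
  have c3 := @continuousZf _ _ (-1) _ c2.
  by rewrite (convolBr cX haar c1 c3 cphi) (convolZr cX haar (-1) cphi c2) !tr.
have [a Ha] := minimal_projection_scalar mphi cv ev pv.
have h0 : 2 * phi y = a * phi 0.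
  by move/(congr1 (fun f => f 0)) : Ha; rewrite /v !addr0 ephi => <-; ring.
move/(congr1 (fun f => f x)) : Ha; rewrite /v => Ha.
have -> : phi (x + y) = a * phi x - phi (- y + x) by rewrite -Ha addrK addrC.
rewrite [x - y]addrC -mulrDl subrK.
have -> : a = 2 * phi y / phi 0 by rewrite h0 mulfK.
by field.
Qed.

Lemma dalembert_even s : dalembert s -> even_fun s.
Proof.
move=> [_ s0 sD] x; have := sD 0 x; rewrite s0 add0r sub0r => h; lra.
Qed.

(** As [v] is even, [s (x - y)] may be averaged with [s (x + y)], and the equation then factors out
    [s x]: [s] is an eigenfunction of convolution by any even function. *)
Lemma convol_dalembert s v : dalembert s -> continuous v -> even_fun v ->
  convol s v = fun x => s x * mean (fun y => s y * v y).
Proof.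
move=> ds cv ev; have [cs s0 sD] := ds; apply/funext => x.
have csl := @convol_slice_continuous _ _ s v x cs cv.
have h : convol s v x = mean (fun y => s (x + y) * v y).
  rewrite /convolution -(mean_opp cX haar csl); congr mean; apply/funext => y.
  by rewrite opprK ev.
have ct : continuous (fun y => s (x + y) * v y).
  by apply: continuousMf => //; exact: continuous_translate.
have : convol s v x + convol s v x = 2 * (s x * mean (fun y => s y * v y)).
  have csv := continuousMf cs cv; have csv' := @continuousZf _ _ (s x) _ csv.
  rewrite {1}h /convolution -(meanD cX haar ct csl).
  rewrite -(meanZ cX haar _ csv) -(meanZ cX haar _ csv').
  by congr mean; apply/funext => y; rewrite -mulrDl sD; ring.
by lra.
Qed.

(** The convolution of [s] and [s'] is their inner product times [s], and also times [s']; if [s]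
    and [s'] differ, this scalar must vanish. *)
Lemma dalembert_orthogonal s s' : dalembert s -> dalembert s' -> s <> s' ->
  mean (fun x => s x * s' x) = 0.
Proof.
move=> ds ds' ss'; apply/eqP; apply: contra_notT ss' => m0.
have [cs _ _] := ds; have [cs' _ _] := ds'.
have := convolC cX haar cs cs'.
rewrite (convol_dalembert ds cs' (dalembert_even ds')).
rewrite (convol_dalembert ds' cs (dalembert_even ds)).
move=> /(congr1 (fun f => f _)) h; apply/funext => x.
have := h x; rewrite (_ : (fun y => s' y * s y) = (fun y => s y * s' y)).
  by apply: mulIf.
by apply/funext => y; rewrite mulrC.
Qed.

Lemma dalembert_mean_sqr_gt0 s : dalembert s -> 0 < mean (fun x => s x * s x).
Proof.
move=> [cs s0 _]; apply: (@mean_gt0 _ _ _ cX haar _ 0).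
- exact: continuousMf.
- by move=> x; rewrite -expr2 sqr_ge0.
- by rewrite s0 mulr1.
Qed.

(** With [m] the mean of [s ^ 2], the convolution square of [s] is [m * s], and [convol_bound]
    bounds it by [m]. *)
Lemma dalembert_le1 s x : dalembert s -> `|s x| <= 1.
Proof.
move=> ds; have [cs s0 _] := ds; have m0 := dalembert_mean_sqr_gt0 ds.
have := convol_bound cX haar x cs cs.
rewrite (convol_dalembert ds cs (dalembert_even ds)).
rewrite (_ : (fun y => s y ^+ 2) = (fun y => s y * s y)); last first.
  by apply/funext => y; rewrite expr2.
move: m0; set m := mean _ => m0 h.
have h2 : s x ^+ 2 * m ^+ 2 <= 1 * m ^+ 2 by rewrite -exprMn mul1r [leRHS]expr2.
rewrite ler_pM2r ?exprn_gt0// in h2.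
by rewrite -(ler_pXn2r (n := 2))// ?nnegrE// expr1n real_normK ?num_real.
Qed.

End MinimalProjections.

(** * Infinitely many characters *)

Section ManyCharacters.
Context {R : realType} {X : topologicalZmodType}.
Local Notation BX := (borel X).
Variable alpha : {measure set BX -> \bar R}.
Hypotheses (cX : compact [set: X]) (hX : hausdorff_space X)
  (iX : infinite_set [set: X]) (haar : is_haar alpha).

Local Notation mass := (fine (alpha [set: BX])).
Local Notation mean := (haar_mean alpha).
Local Notation convol := (convolution alpha).
Implicit Types (u v w phi psi s : X -> R) (k e : R).

Lemma set1_borel (x : X) : measurable ([set x] : set BX).
Proof.
have cl : closed [set x] by exact: (accessible_closed_set1 (hausdorff_accessible hX)).
rewrite -[X in measurable X]setCK; apply: measurableC; apply: open_borel.
exact: closed_openC.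
Qed.

(** All points have equal measure; if it were positive, enough points of the infinite group would
    exceed the total mass. *)
Lemma haar_set1 (x : X) : alpha [set x] = 0%E.
Proof.
have invx y : alpha [set y] = alpha [set x].
  have [_ _ inv _ _] := haar.
  rewrite -(inv (y - x) _ (set1_borel x)); congr (alpha _).
  by rewrite image_set1 subrK.
apply/eqP; rewrite eq_le measure_ge0 andbT leNgt; apply/negP => x0.
have fx : alpha [set x] \is a fin_num.
  by rewrite ge0_fin_numE//; apply: haar_lty => //; exact: set1_borel.
pose a := fine (alpha [set x]).
have a0 : 0 < a by rewrite fine_gt0// x0 ltey_eq fx.
pose N := (Num.truncn (mass / a)).+1.
have [B _ BN] := infinite_set_fset N iX.
have aB : alpha (\big[setU/set0]_(y <- finmap.enum_fset B) [set y]) =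
    ((size (finmap.enum_fset B))%:R * a)%:E.
  rewrite measure_fbigsetU; last 2 first.
  - by move=> y _; exact: set1_borel.
  - by move=> y z _ _ [t /= [-> ->]].
  rewrite (eq_bigr (fun=> a%:E)); last by move=> y _; rewrite -[LHS]fineK; [congr (fine _)%:E; exact: invx|]; rewrite ge0_fin_numE//; apply: haar_lty => //; exact: set1_borel.
  by rewrite sumEFin big_const_seq count_predT iter_addr_0 mulr_natl.
have : ((size (finmap.enum_fset B))%:R * a <= mass).
  rewrite -lee_fin -aB -(massE haar); apply: le_measure; rewrite ?inE//.
  by apply: bigsetU_measurable => y _; exact: set1_borel.
apply/negP; rewrite -ltNge -ltr_pdivrMr//; apply: lt_le_trans (truncnS_gt _) _.
by rewrite ler_nat.
Qed.

Lemma small_open e : 0 < e -> exists V : set X, [/\ open V, V 0 & (alpha V < e%:E)%E].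
Proof.
move=> e0; have [_ _ _ outer _] := haar.
pose z : BX := (0 : X); have := outer [set z] (set1_borel 0).
rewrite (haar_set1 0) => h.
have : (ereal_inf [set alpha U | U in
    [set U : set BX | open (U : set X) /\ [set z] `<=` U]] < e%:E)%E.
  by rewrite -h lte_fin.
move=> /ereal_inf_lt[_ [U [oU U0] <-] aU].
by exists U; split=> //; exact: (U0 z).
Qed.

(** A Urysohn function for 0 and the complement of a small open set, averaged with its reflection to
    make it even. *)
Lemma small_bump e : 0 < e -> exists v, [/\ continuous v, even_fun v, v 0 = 1,
  forall x, 0 <= v x & mean v <= e].
Proof.
move=> e0; have m0 := mass_gt0 haar.
have [V [oV V0 aV]] := small_open (mulr_gt0 e0 m0).
have nX : normal_space X := compact_normal hX cX.
have clV : closed (~` V) by exact: open_closedC.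
have cl0 : closed [set (0 : X)] by exact: (accessible_closed_set1 (hausdorff_accessible hX)).
have V0' : [set (0 : X)] `&` ~` V = set0.
  by apply/seteqP; split=> // x [->].
have /(uniform_separatorP (R := R))[f [cf f01 f0 f1]] :=
  (normal_separatorP (R := R) (T := X)).1 nX _ _ cl0 clV V0'.
have f01' x : 0 <= f x <= 1.
  by have := f01 (f x); rewrite /= in_itv /=; apply; exists x.
have f00 : f 0 = 0 by apply: f0; exists 0.
have f1V x : ~ V x -> f x = 1 by move=> Vx; apply: f1; exists x.
pose g x := 1 - f x.
have cg : continuous g by apply: continuousBf => //; move=> ?; exact: cvg_cst.
have cgo : continuous (fun x => g (0 - x)) by exact: continuous_reflect.
have cgg := continuousDf cg cgo.
have g0 x : 0 <= g x by have /andP[_] := f01' x; rewrite /g; lra.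
have g1 x : g x <= 1 by have /andP[+ _] := f01' x; rewrite /g; lra.
exists (fun x => 2^-1 * (g x + g (0 - x))); split.
- exact: (@continuousZf _ _ 2^-1 _ cgg).
- by move=> x; rewrite !sub0r opprK [g x + _]addrC.
- by rewrite subr0 /g f00; lra.
- move=> x; apply: mulr_ge0; first by rewrite invr_ge0.
  by apply: addr_ge0; exact: g0.
rewrite (meanZ cX haar _ cgg) (meanD cX haar cg cgo) (mean_reflect cX haar 0 cg).
have -> : 2^-1 * (mean g + mean g) = mean g by field.
have mV := open_borel oV.
suff : \int[alpha]_x g x <= fine (alpha V).
  have lV : fine (alpha V) <= e * mass.
    rewrite -lee_fin fineK ?(ltW aV)//.
    by rewrite ge0_fin_numE// (lt_trans aV)// ltry.
  rewrite /haar_mean => h; rewrite mulrC ler_pdivrMr//.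
  exact: le_trans h lV.
have ig := continuous_integrable cX haar cg.
rewrite -(mul1r (fine _)) -(Rintegral_cst _ mV).
rewrite [leRHS]Rintegral_mkcond; apply: le_Rintegral => //.
  have c1 : continuous ((fun=> 1) : X -> R) by move=> ?; exact: cvg_cst.
  have i1 : alpha.-integrable (V : set BX) (EFin \o cst (1 : R)).
    by apply: integrableS (continuous_integrable cX haar c1).
  by move: i1 => /(integrable_mkcond _ mV); rewrite restrict_EFin.
move=> x _; rewrite patchE; case: ifPn => [//|].
by rewrite notin_setE => /f1V; rewrite /g => ->; rewrite subrr.
Qed.

(** Subtracting from a bump its orthogonal projection onto the span of [l] leaves an even [k]
    orthogonal to [l], so convolution by [k] kills [l]. A minimal projection below the spectral
    projection of [k] yields a solution that cannot be killed by [k]. *)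
Lemma ex_dalembert_notin (l : seq (X -> R)) : (forall s, s \in l -> dalembert s) ->
  exists2 s, dalembert s & s \notin l.
Proof.
move=> ld; wlog ul : l ld / uniq l.
  move=> /(_ (undup l)); rewrite undup_uniq; case=> //.
    by move=> s; rewrite mem_undup; exact: ld.
  by move=> s ds; rewrite mem_undup; exists s.
pose q s := mean (fun x => s x * s x).
have q0 s : s \in l -> 0 < q s by move=> /ld ds; exact: dalembert_mean_sqr_gt0.
pose C := \sum_(s <- l) (q s)^-1.
have C0 : 0 <= C by rewrite /C big_seq sumr_ge0// => s sl; rewrite invr_ge0 ltW ?q0.
(* With this mean for the bump, the projection [g] satisfies [g 0 <= C / (1 + C) < 1 = v 0], so
   [k 0] is not zero. *)
have e0 : 0 < (1 + C)^-1 by rewrite invr_gt0 ltr_wpDr.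
have [v [cv ev v0 v_ge0 mv]] := small_bump e0.
pose c s := mean (fun x => v x * s x) / q s.
have cl s : s \in l -> continuous s by move=> /ld [].
(* The default 0 outside [l] gives a family continuous at every index, as [mean_sum] requires. *)
pose f s : X -> R := if s \in l then s else fun=> 0.
have cf s : continuous (f s).
  by rewrite /f; case: ifPn => [/cl//|_ ?]; exact: cvg_cst.
pose g x := \sum_(s <- l) c s * f s x.
have gE x : g x = \sum_(s <- l) c s * s x.
  by rewrite /g big_seq [RHS]big_seq; apply: eq_bigr => s sl; rewrite /f sl.
have cg : continuous g := (mean_sum cX haar l c cf).2.
pose k x := v x - g x.
have ck : continuous k := continuousBf cv cg.
have ek : even_fun k.
  move=> x; rewrite /k ev !gE; congr (_ - _); rewrite big_seq [RHS]big_seq.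
  by apply: eq_bigr => s sl; rewrite (dalembert_even (ld _ sl)).
have cle s : s \in l -> c s <= (1 + C)^-1 * (q s)^-1.
  move=> sl; rewrite ler_pM2r ?invr_gt0 ?q0//; apply: le_trans mv.
  apply: ler_mean => //; first by apply: continuousMf => //; exact: cl.
  move=> x; rewrite ler_piMr//; have := dalembert_le1 cX haar x (ld _ sl).
  by rewrite ler_norml => /andP[].
have k0 : k 0 != 0.
  rewrite gt_eqF// /k v0 gE subr_gt0.
  apply: (@le_lt_trans _ _ ((1 + C)^-1 * C)).
    rewrite /C mulr_sumr big_seq [leRHS]big_seq; apply: ler_sum => s sl.
    by have [_ -> _] := ld _ sl; rewrite mulr1; exact: cle.
  by rewrite mulrC ltr_pdivrMr ?mul1r ?ltrDr ?ltr01// ltr_wpDr.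
have kort s : s \in l -> mean (fun x => s x * k x) = 0.
  move=> sl; have cs := cl _ sl.
  have -> : (fun x => s x * k x) = (fun x => v x * s x - \sum_(t <- l) c t * (s x * f t x)).
    apply/funext => x; rewrite /k mulrBr [s x * v x]mulrC; congr (_ - _).
    by rewrite /g mulr_sumr; apply: eq_bigr => t _; ring.
  have csf t : continuous (fun x => s x * f t x) by exact: continuousMf.
  have [h1 h2] := mean_sum cX haar l c csf.
  have cvs : continuous (fun x => v x * s x) by exact: continuousMf.
  rewrite (meanB cX haar cvs h2) h1 (bigD1_seq s)//= big1_seq ?addr0.
    by rewrite /f sl /c divfK ?subrr// gt_eqF// q0.
  move=> t /andP[ts tl]; rewrite /f tl dalembert_orthogonal ?mulr0//; try exact: ld.
  by move=> st; rewrite st eqxx in ts.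
have k_neq0 : k <> fun=> 0 by move=> kE; rewrite kE eqxx in k0.
have [psi [Lam [cpsi epsi ppsi psi0 [L0 Lpsi]]]] := power_projection cX haar ck ek k_neq0.
have [phi mphi psiphi] := ex_minimal_projection cX haar (And4 cpsi epsi ppsi psi0).
have ds := minimal_projection_dalembert cX haar mphi.
have [[cphi ephi pphi phi0] _] := mphi.
exists (fun x => phi x / phi 0) => //; apply/negP => sl.
set s := (fun x => _) in sl ds.
have [cs _ _] := ds.
have sk : convol s k = fun=> 0.
  by rewrite (convol_dalembert cX haar ds ck ek) kort//; apply/funext => x; rewrite mulr0.
have z0 u : convol (fun=> 0) u = fun=> 0.
  apply/funext => x; rewrite /convolution -[RHS](mean_cst haar); congr mean.
  by apply/funext => y; rewrite mul0r.
have ckk := convol_continuous cX haar ck ck.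
have spsi : convol s psi = fun=> 0.
  have -> : psi = fun x => Lam^-1 * convol (convol k k) psi x.
    by apply/funext => x; rewrite Lpsi mulrA mulVf ?mul1r// gt_eqF.
  rewrite (convolZr cX haar _ cs (convol_continuous cX haar ckk cpsi)).
  rewrite (convolA cX haar cs ckk cpsi) (convolA cX haar cs ck ck) sk !z0.
  by apply/funext => x; rewrite mulr0.
have sphi : convol s phi = fun=> 0.
  by rewrite -psiphi (convolA cX haar cs cpsi cphi) spsi z0.
have phiE : phi = fun x => phi 0 * s x.
  by apply/funext => x; rewrite /s mulrC divfK.
have := congr1 (fun f => f 0) sphi.
rewrite phiE (convolZr cX haar _ cs cs) convol_at0; last exact: dalembert_even.
by apply/eqP; rewrite mulf_neq0// gt_eqF// dalembert_mean_sqr_gt0.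
Qed.

Lemma dalembert_character s : dalembert s ->
  exists2 g : X -> R[i], character g & forall x, complex.Re (g x) = s x.
Proof.
move=> ds; have [cs s0 sD] := ds.
have es := dalembert_even ds.
suff [t ct [tD sD' st1]] : exists2 t : X -> R, continuous t &
    [/\ forall x y, t (x + y) = s x * t y + t x * s y,
        forall x y, s (x + y) = s x * s y - t x * t y &
        forall x, s x ^+ 2 + t x ^+ 2 = 1].
  exists (fun x => Complex (s x) (t x)) => //; split => //.
  - by move=> x y; rewrite sD' tD.
  - by move=> x; rewrite /= st1 sqrtr1.
(* If [s] takes only the values 1 and -1, it is a real character and its imaginary part is 0;
   otherwise there is a point where the sine is not zero. *)
have [s1|/existsNP[x0 sx0]] := pselect (forall x, s x ^+ 2 = 1).
  exists (fun=> 0); first by move=> ?; exact: cvg_cst.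
  split=> [x y|x y|x]; rewrite ?mulr0 ?mul0r ?addr0 ?subr0 ?expr0n ?addr0//.
  have := sD x y; have := s1 (x + y); have := s1 (x - y); have := s1 x; have := s1 y.
  set a := s (x + y); set b := s (x - y); set c := s x; set d := s y.
  move=> d1 c1 b1 a1 abcd.
  have h : (a - b) ^+ 2 = 0.
    have e1 : (a + b) ^+ 2 = 4 * (c ^+ 2 * d ^+ 2) by rewrite abcd; ring.
    have -> : (a - b) ^+ 2 = 2 * a ^+ 2 + 2 * b ^+ 2 - (a + b) ^+ 2 by ring.
    by rewrite e1 a1 b1 c1 d1; ring.
  move/eqP : h; rewrite sqrf_eq0 subr_eq0 => /eqP ab.
  by move: abcd; rewrite -ab; lra.
have sx1 : 0 < 1 - s x0 ^+ 2.
  have := dalembert_le1 cX haar x0 ds; rewrite -(ler_pXn2r (n := 2))// ?nnegrE//.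
  rewrite expr1n real_normK ?num_real// le_eqVlt => /orP[/eqP //|h].
  by rewrite subr_gt0.
(* If [s] is the real part of a character, its imaginary part is recovered from
   [s (x - x0) - s (x + x0) = 2 t x0 t x], where [t x0 = w] up to sign. *)
set w := Num.sqrt (1 - s x0 ^+ 2).
have w0 : 0 < w by rewrite sqrtr_gt0.
have w2 : w ^+ 2 = 1 - s x0 ^+ 2 by rewrite sqr_sqrtr// ltW.
pose t x := (2 * w)^-1 * (s (- x0 + x) - s (x0 + x)).
(* The product formula for sines, obtained by applying d'Alembert's equation to the four products
   and then to shifts by [x0 + x0], where [e2] is the double-angle formula. *)
have tt x y : t x * t y = 2^-1 * (s (x - y) - s (x + y)).
  have e2 : s (x0 + x0) = 2 * s x0 ^+ 2 - 1.
    by have := sD x0 x0; rewrite subrr s0 -expr2; lra.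
  have w20 : 2 * w != 0 by rewrite mulf_neq0 ?gt_eqF.
  apply: (mulfI (expf_neq0 2 w20)).
  have -> : (2 * w) ^+ 2 * (t x * t y) =
     (s (- x0 + x) - s (x0 + x)) * (s (- x0 + y) - s (x0 + y)).
    by rewrite /t; field; rewrite gt_eqF.
  rewrite exprMn w2.
  have h1 := sD (- x0 + x) (- x0 + y).
  have h2 := sD (- x0 + x) (x0 + y).
  have h3 := sD (x0 + x) (- x0 + y).
  have h4 := sD (x0 + x) (x0 + y).
  have h5 := sD (x + y) (x0 + x0).
  have h6 := sD (x - y) (x0 + x0).
  have a1 : - x0 + x + (- x0 + y) = x + y - (x0 + x0) by rewrite addrACA -opprD addrC.
  have a2 : - x0 + x - (- x0 + y) = x - y by rewrite opprD opprK addrACA addNr add0r.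
  have a3 : - x0 + x + (x0 + y) = x + y by rewrite addrACA addNr add0r.
  have a4 : - x0 + x - (x0 + y) = x - y - (x0 + x0) by rewrite opprD addrACA -opprD addrC.
  have a5 : x0 + x + (- x0 + y) = x + y by rewrite addrACA subrr add0r.
  have a6 : x0 + x - (- x0 + y) = x - y + (x0 + x0) by rewrite opprD opprK addrACA addrC.
  have a7 : x0 + x + (x0 + y) = x + y + (x0 + x0) by rewrite addrACA addrC.
  have a8 : x0 + x - (x0 + y) = x - y by rewrite opprD addrACA subrr add0r.
  rewrite a1 a2 in h1; rewrite a3 a4 in h2; rewrite a5 a6 in h3; rewrite a7 a8 in h4.
  rewrite e2 in h5 h6.
  have -> : (s (- x0 + x) - s (x0 + x)) * (s (- x0 + y) - s (x0 + y)) =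
    2^-1 * (2 * (s (- x0 + x) * s (- x0 + y)) - 2 * (s (- x0 + x) * s (x0 + y))
      - 2 * (s (x0 + x) * s (- x0 + y)) + 2 * (s (x0 + x) * s (x0 + y))) by field.
  rewrite -h1 -h2 -h3 -h4.
  have -> : s (x + y + (x0 + x0)) = 2 * (s (x + y) * (2 * s x0 ^+ 2 - 1)) -
    s (x + y - (x0 + x0)) by rewrite -h5 addrK.
  have -> : s (x - y + (x0 + x0)) = 2 * (s (x - y) * (2 * s x0 ^+ 2 - 1)) -
    s (x - y - (x0 + x0)) by rewrite -h6 addrK.
  by field.
exists t.
  apply: continuousZf; apply: continuousBf; exact: continuous_translate.
have tD x y : t (x + y) = s x * t y + t x * s y.
  have h1 := sD x (- x0 + y); have h2 := sD x (x0 + y).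
  have h3 := sD (- x0 + x) y; have h4 := sD (x0 + x) y.
  have a1 : x - (- x0 + y) = x0 + (x - y) by rewrite opprD opprK addrCA.
  have a2 : x - (x0 + y) = - x0 + (x - y) by rewrite opprD addrCA.
  rewrite a1 addrCA in h1; rewrite a2 addrCA in h2.
  rewrite -!addrA in h3 h4.
  rewrite /t; have -> : s x * ((2 * w)^-1 * (s (- x0 + y) - s (x0 + y))) +
    (2 * w)^-1 * (s (- x0 + x) - s (x0 + x)) * s y = (2 * w)^-1 *
    (s x * (s (- x0 + y) - s (x0 + y)) + (s (- x0 + x) - s (x0 + x)) * s y) by ring.
  by congr (_ * _); lra.
have sD' x y : s (x + y) = s x * s y - t x * t y.
  by rewrite tt; have := sD x y; lra.
split=> // x; have := sD' x (- x); rewrite subrr s0 es.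
have -> : t (- x) = - t x.
  rewrite /t -(es (- x0 - x)) -(es (x0 - x)) !opprB !opprK [x + x0]addrC [x - x0]addrC.
  by ring.
by rewrite !expr2; lra.
Qed.

Lemma infinite_dual : infinite_set (@dual_group R X).
Proof.
move=> /finite_seqP[l lE].
(* Filtering loses nothing, because the new [s] satisfies the equation itself. *)
pose l' := [seq s <- [seq (fun x => complex.Re (g x)) | g <- l] | `[< dalembert s >]].
have [|s ds] := @ex_dalembert_notin l'.
  by move=> s; rewrite mem_filter => /andP[/asboolP].
have [g cg gs] := dalembert_character ds.
rewrite mem_filter asboolT//= => /negP; apply; apply/mapP; exists g.
  by have : dual_group g by []; rewrite lE.
by apply/funext => x; rewrite gs.
Qed.

End ManyCharacters.

(** * Complex-valued functions, Fourier coefficients and norms *)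

Section ComplexContinuity.
Context {R : realType} {X : topologicalType}.
Local Notation C := R[i].
Local Notation normc := (@ComplexField.Normc.normc R).
Local Notation Re := (@complex.Re R).
Local Notation Im := (@complex.Im R).
Implicit Types (f g h : X -> C) (z : C).

Lemma normc_sqr z : normc z ^+ 2 = Re z ^+ 2 + Im z ^+ 2.
Proof. by case: z => a b; rewrite /= sqr_sqrtr// addr_ge0// sqr_ge0. Qed.

Lemma normc_ge0 z : 0 <= normc z.
Proof. by case: z => a b; exact: sqrtr_ge0. Qed.

Lemma normc_conj z : normc (conjc z) = normc z.
Proof. by case: z => a b; rewrite /= sqrrN. Qed.

Lemma mulc_conj z : z * conjc z = (normc z ^+ 2)%:C%C.
Proof.
rewrite normc_sqr; case: z => a b /=.
by apply/eqP; rewrite eq_complex /=; apply/andP; split; apply/eqP; ring.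
Qed.

Lemma normc_real (r : R) : 0 <= r -> normc r%:C%C = r.
Proof. by move=> r0; rewrite /= expr0n addr0 sqrtr_sqr ger0_norm. Qed.

Lemma ler_Re_normc z : Re z <= normc z.
Proof.
case: z => a b /=; apply: le_trans (ler_norm a) _.
by rewrite -sqrtr_sqr ler_sqrt ?addr_ge0 ?sqr_ge0// lerDl sqr_ge0.
Qed.

(** Coordinatewise, the form in which [character] states continuity. *)
Definition ccontinuous f := continuous (fun x => Re (f x)) /\ continuous (fun x => Im (f x)).

Lemma ccontinuousD f g : ccontinuous f -> ccontinuous g -> ccontinuous (fun x => f x + g x).
Proof.
move=> [f1 f2] [g1 g2]; split.
  rewrite (_ : (fun x => _) = fun x => Re (f x) + Re (g x)); first exact: continuousDf.
  by apply/funext => x; case: (f x) (g x) => [? ?] [? ?].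
rewrite (_ : (fun x => _) = fun x => Im (f x) + Im (g x)); first exact: continuousDf.
by apply/funext => x; case: (f x) (g x) => [? ?] [? ?].
Qed.

Lemma ccontinuousM f g : ccontinuous f -> ccontinuous g -> ccontinuous (fun x => f x * g x).
Proof.
move=> [f1 f2] [g1 g2]; split.
  rewrite (_ : (fun x => _) = fun x => Re (f x) * Re (g x) - Im (f x) * Im (g x)).
    by apply: continuousBf; exact: continuousMf.
  by apply/funext => x; case: (f x) (g x) => [? ?] [? ?].
rewrite (_ : (fun x => _) = fun x => Re (f x) * Im (g x) + Im (f x) * Re (g x)).
  by apply: continuousDf; exact: continuousMf.
by apply/funext => x; case: (f x) (g x) => [? ?] [? ?].
Qed.

Lemma ccontinuousJ f : ccontinuous f -> ccontinuous (fun x => conjc (f x)).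
Proof.
move=> [f1 f2]; split.
  by rewrite (_ : (fun x => _) = fun x => Re (f x))//; apply/funext => x; case: (f x).
rewrite (_ : (fun x => _) = fun x => - Im (f x)).
  by move=> x; apply: cvgN; exact: f2.
by apply/funext => x; case: (f x).
Qed.

Lemma ccontinuous_cst z : ccontinuous (fun=> z).
Proof. by split=> x; exact: cvg_cst. Qed.

Lemma ccontinuous_real (u : X -> R) : continuous u ->
  ccontinuous (fun x => (u x)%:C%C).
Proof. by move=> cu; split => //= x; exact: cvg_cst. Qed.

Lemma ccontinuousZ z f : ccontinuous f -> ccontinuous (fun x => z * f x).
Proof. exact/ccontinuousM/ccontinuous_cst. Qed.

Lemma ccontinuous_sum (I : Type) (r : seq I) (F : I -> X -> C) :
  (forall i, ccontinuous (F i)) -> ccontinuous (fun x => \sum_(i <- r) F i x).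
Proof.
move=> cF; elim: r => [|i r IH].
  rewrite (_ : (fun x => _) = fun=> 0); first exact: ccontinuous_cst.
  by apply/funext => x; rewrite big_nil.
rewrite (_ : (fun x => _) = fun x => F i x + \sum_(j <- r) F j x).
  exact: ccontinuousD.
by apply/funext => x; rewrite big_cons.
Qed.

Lemma continuous_normc f : ccontinuous f -> continuous (fun x => normc (f x)).
Proof.
move=> [f1 f2].
rewrite (_ : (fun x => _) = fun x => Num.sqrt (Re (f x) ^+ 2 + Im (f x) ^+ 2)).
  move=> x; apply: (continuous_cvg _ (@sqrt_continuous R _)).
  by apply: (continuousDf (continuousXf (n := 2) f1) (continuousXf (n := 2) f2)).
by apply/funext => x; case: (f x).
Qed.

End ComplexContinuity.

Section ComplexMean.
Context {R : realType} {X : topologicalZmodType}.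
Local Notation BX := (borel X).
Variable alpha : {measure set BX -> \bar R}.
Hypotheses (cX : compact [set: X]) (haar : is_haar alpha).

Local Notation C := R[i].
Local Notation mass := (fine (alpha [set: BX])).
Local Notation mean := (haar_mean alpha).
Local Notation normc := (@ComplexField.Normc.normc R).
Local Notation Re := (@complex.Re R).
Local Notation Im := (@complex.Im R).
Implicit Types (f g h : X -> C) (z : C).

Definition cmean f : C := Complex (mean (fun x => Re (f x))) (mean (fun x => Im (f x))).

Lemma cmeanD f g : ccontinuous f -> ccontinuous g ->
  cmean (fun x => f x + g x) = cmean f + cmean g.
Proof.
move=> [f1 f2] [g1 g2]; rewrite /cmean; congr Complex; rewrite -meanD//; congr mean;
by apply/funext => x; case: (f x) (g x) => [? ?] [? ?].
Qed.

Lemma cmeanZ z f : ccontinuous f -> cmean (fun x => z * f x) = z * cmean f.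
Proof.
case: z => a b [f1 f2]; rewrite /cmean.
have cZ (k : R) (u : X -> R) : continuous u -> continuous (fun x : X => k * u x) by exact: continuousZf.
congr Complex; rewrite -!meanZ//; [rewrite -meanB//|rewrite -meanD//]; try exact: cZ;
  by congr mean; apply/funext => x; case: (f x).
Qed.

Lemma cmean_cst z : cmean (fun=> z) = z.
Proof. by rewrite /cmean !mean_cst//; case: z. Qed.

Lemma cmean_sum (I : Type) (r : seq I) (F : I -> X -> C) :
  (forall i, ccontinuous (F i)) ->
  cmean (fun x => \sum_(i <- r) F i x) = \sum_(i <- r) cmean (F i).
Proof.
move=> cF; elim: r => [|i r IH].
  rewrite big_nil -[RHS]cmean_cst; congr cmean.
  by apply/funext => x; rewrite big_nil.
rewrite big_cons -IH -cmeanD//; last exact: ccontinuous_sum.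
by congr cmean; apply/funext => x; rewrite big_cons.
Qed.

Lemma cmean_translate f y : ccontinuous f -> cmean (fun x => f (y + x)) = cmean f.
Proof.
move=> [f1 f2]; rewrite /cmean (mean_translate cX haar y f1).
by rewrite (mean_translate cX haar y f2).
Qed.

Section Characters.
Implicit Types a b : X -> C.

Lemma character_ccontinuous a : character a -> ccontinuous a.
Proof. by case. Qed.

Lemma character_norm a x : character a -> normc (a x) = 1.
Proof. by case. Qed.

Lemma character_mulJ a x : character a -> a x * conjc (a x) = 1.
Proof. by move=> ca; rewrite mulc_conj character_norm// expr1n. Qed.

Lemma character1 : character ((fun=> 1) : X -> C).
Proof.
split=> [x|x|x y|x]; [exact: cvg_cst|exact: cvg_cst|by rewrite mulr1|].
by rewrite ComplexField.Normc.normc1.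
Qed.

Lemma characterM a b : character a -> character b -> character (fun x => a x * b x).
Proof.
move=> ca cb; have [c1 c2] := ccontinuousM (character_ccontinuous ca) (character_ccontinuous cb).
case: ca => _ _ aD a1; case: cb => _ _ bD b1; split=> // [x y|x].
  by rewrite aD bD mulrACA.
by rewrite ComplexField.Normc.normcM a1 b1 mulr1.
Qed.

Lemma characterJ a : character a -> character (fun x => conjc (a x)).
Proof.
move=> ca; have [c1 c2] := ccontinuousJ (character_ccontinuous ca).
case: ca => _ _ aD a1; split=> // [x y|x]; first by rewrite aD rmorphM.
by rewrite normc_conj.
Qed.

Lemma cmean_character a : character a -> cmean a = if a == (fun=> 1) then 1 else 0.
Proof.
move=> ca; case: eqVneq => [->|/eqP a1]; first exact: cmean_cst.
have [x ax] : exists x, a x <> 1.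
  by apply/existsNP => a1'; apply: a1; apply/funext.
have cca := character_ccontinuous ca.
have : cmean a = a x * cmean a.
  rewrite -cmeanZ// -[LHS](cmean_translate x cca); congr cmean.
  by apply/funext => y; case: ca => _ _ -> _.
move=> /eqP; rewrite -subr_eq0 -{1}[cmean a]mul1r -mulrBl mulf_eq0 subr_eq0.
by move=> /orP[/eqP/esym//|/eqP].
Qed.

Definition fourier_coef f a : C := cmean (fun x => f x * conjc (a x)).
Local Notation fcoef := fourier_coef.

Lemma character_eqJ a b : character b ->
  ((fun x => a x * conjc (b x)) == (fun=> 1)) = (a == b).
Proof.
move=> cb; apply/eqP/eqP => [h|->]; last by apply/funext => x; exact: character_mulJ.
apply/funext => x; have := congr1 (fun f => f x * b x) h.
by rewrite /= mul1r -mulrA [_ * b x]mulrC character_mulJ// mulr1.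
Qed.

Lemma fcoef_character a b : character a -> character b ->
  fcoef a b = if a == b then 1 else 0.
Proof.
move=> ca cb; rewrite /fourier_coef cmean_character ?character_eqJ//.
by apply: characterM => //; exact: characterJ.
Qed.

Lemma fcoefD f g a : ccontinuous f -> ccontinuous g -> character a ->
  fcoef (fun x => f x + g x) a = fcoef f a + fcoef g a.
Proof.
move=> cf cg /characterJ/character_ccontinuous ca; rewrite /fourier_coef.
rewrite -cmeanD; try exact: ccontinuousM.
by congr cmean; apply/funext => x; rewrite mulrDl.
Qed.

Lemma fcoefZ z f a : ccontinuous f -> character a ->
  fcoef (fun x => z * f x) a = z * fcoef f a.
Proof.
move=> cf /characterJ/character_ccontinuous ca; rewrite /fourier_coef.
rewrite -cmeanZ; last exact: ccontinuousM.
by congr cmean; apply/funext => x; rewrite mulrA.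
Qed.

Lemma fcoefM f a b : fcoef (fun x => a x * f x) b = fcoef f (fun x => conjc (a x) * b x).
Proof.
by congr cmean; apply/funext => x; rewrite rmorphM /= conjcK mulrCA mulrA.
Qed.

Lemma fcoef_sum (I : Type) (r : seq I) (F : I -> X -> C) a :
  (forall i, ccontinuous (F i)) -> character a ->
  fcoef (fun x => \sum_(i <- r) F i x) a = \sum_(i <- r) fcoef (F i) a.
Proof.
move=> cF /characterJ/character_ccontinuous ca; rewrite /fourier_coef.
rewrite -cmean_sum; last by move=> i; exact: ccontinuousM.
by congr cmean; apply/funext => x; rewrite mulr_suml.
Qed.

Lemma fourierE f a : fourier alpha f a = mass%:C%C * fcoef f a.
Proof.
have m0 : mass != 0 by rewrite gt_eqF// mass_gt0.
rewrite /fourier /fourier_coef /cintegral /cmean /haar_mean.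
apply/eqP; rewrite eq_complex /=; apply/andP; split; apply/eqP;
  by rewrite mul0r ?subr0 ?addr0 mulrA mulfV ?mul1r.
Qed.

Lemma normc_fourier f a : normc (fourier alpha f a) = mass * normc (fcoef f a).
Proof.
by rewrite fourierE ComplexField.Normc.normcM normc_real// ltW// mass_gt0.
Qed.

End Characters.

End ComplexMean.

Section FourierNorms.
Context {R : realType} {X : topologicalZmodType}.
Local Notation BX := (borel X).
Variable alpha : {measure set BX -> \bar R}.
Hypotheses (cX : compact [set: X]) (haar : is_haar alpha).

Local Notation C := R[i].
Local Notation mass := (fine (alpha [set: BX])).
Local Notation mean := (haar_mean alpha).
Local Notation normc := (@ComplexField.Normc.normc R).
Local Notation Re := (@complex.Re R).
Local Notation Im := (@complex.Im R).
Implicit Types (f g h : X -> C) (z w : C) (p q : \bar R).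

Lemma cmeasurable_normc f : cmeasurable f ->
  measurable_fun [set: BX] (fun x => normc (f x) : R).
Proof.
move=> [f1 f2].
rewrite (_ : (fun x => _) = fun x => Num.sqrt (Re (f x) ^+ 2 + Im (f x) ^+ 2)).
  apply: (@measurableT_comp _ _ _ _ _ _ (@Num.sqrt R) _
    (fun x : BX => Re (f x) ^+ 2 + Im (f x) ^+ 2)).
    by apply: continuous_measurable_fun; exact: sqrt_continuous.
  by apply: measurable_funD; apply: measurable_funX.
by apply/funext => x; case: (f x).
Qed.

Lemma ccontinuous_cmeasurable f : ccontinuous f -> cmeasurable f.
Proof. by move=> [f1 f2]; split; exact: continuous_borel. Qed.

Lemma cmeasurableM f g : cmeasurable f -> cmeasurable g -> cmeasurable (fun x => f x * g x).
Proof.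
move=> [f1 f2] [g1 g2]; split.
  rewrite (_ : (fun x => _) = fun x => Re (f x) * Re (g x) - Im (f x) * Im (g x)).
    by apply: measurable_funB; exact: measurable_funM.
  by apply/funext => x; case: (f x) (g x) => [? ?] [? ?].
rewrite (_ : (fun x => _) = fun x => Re (f x) * Im (g x) + Im (f x) * Re (g x)).
  by apply: measurable_funD; exact: measurable_funM.
by apply/funext => x; case: (f x) (g x) => [? ?] [? ?].
Qed.

Lemma cintegrableM_bounded f g M : cintegrable alpha f -> cmeasurable g ->
  (forall x, normc (g x) <= M) -> cintegrable alpha (fun x => f x * g x).
Proof.
move=> [mf if_] mg gM; split; first exact: cmeasurableM.
have mn := cmeasurable_normc mf.
apply: (@le_lt_trans _ _ (\int[alpha]_x (`|M|%:E * (normc (f x))%:E))%E).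
  apply: ge0_le_integral => //.
  - by move=> x _; rewrite lee_fin normc_ge0.
  - by apply/measurable_EFinP; apply: cmeasurable_normc; exact: cmeasurableM.
  - by apply: measurable_funeM; apply/measurable_EFinP.
  move=> x _; rewrite -EFinM lee_fin ComplexField.Normc.normcM mulrC.
  by rewrite ler_wpM2r ?normc_ge0// (le_trans (gM x))// ler_norm.
rewrite ge0_integralZl//; last 2 first.
- by apply/measurable_EFinP.
- by move=> x _; rewrite lee_fin normc_ge0.
by rewrite lte_mul_pinfty.
Qed.

Lemma cintegrable_Re h : cintegrable alpha h ->
  alpha.-integrable [set: BX] (fun x => (Re (h x))%:E).
Proof.
move=> [[h1 h2] ih]; apply/integrableP; split; first exact/measurable_EFinP.
apply: le_lt_trans ih; apply: ge0_le_integral => //.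
- by apply/measurable_EFinP; apply: measurableT_comp.
- by apply/measurable_EFinP; exact: (cmeasurable_normc (conj h1 h2)).
move=> x _; rewrite lee_fin; case: (h x) => a b /=.
by rewrite -sqrtr_sqr ler_sqrt ?addr_ge0 ?sqr_ge0// lerDl sqr_ge0.
Qed.

Lemma cintegrable_Im h : cintegrable alpha h ->
  alpha.-integrable [set: BX] (fun x => (Im (h x))%:E).
Proof.
move=> [[h1 h2] ih]; apply/integrableP; split; first exact/measurable_EFinP.
apply: le_lt_trans ih; apply: ge0_le_integral => //.
- by apply/measurable_EFinP; apply: measurableT_comp.
- by apply/measurable_EFinP; exact: (cmeasurable_normc (conj h1 h2)).
move=> x _; rewrite lee_fin; case: (h x) => a b /=.
by rewrite -sqrtr_sqr ler_sqrt ?addr_ge0 ?sqr_ge0// lerDr sqr_ge0.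
Qed.

Lemma Re_cintegralZ w h : cintegrable alpha h ->
  Re (w * cintegral alpha h) = Rintegral alpha [set: BX] (fun x => Re (w * h x)).
Proof.
move=> ih; have i1 := cintegrable_Re ih; have i2 := cintegrable_Im ih.
case: w => a b /=; rewrite -!RintegralZl// -RintegralB//.
- by apply: eq_Rintegral => x _; case: (h x).
- by rewrite (_ : _ \o _ = fun x => (a%:E * (Re (h x))%:E)%E)//; exact: integrableZl.
- by rewrite (_ : _ \o _ = fun x => (b%:E * (Im (h x))%:E)%E)//; exact: integrableZl.
Qed.

Lemma fourier_cintegrable f a : cintegrable alpha f -> character a ->
  cintegrable alpha (fun x => f x * conjc (a x)).
Proof.
move=> if_ ca; apply: (cintegrableM_bounded if_ (M := 1)).
  exact/ccontinuous_cmeasurable/ccontinuousJ/character_ccontinuous.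
by move=> x; rewrite normc_conj (character_norm x ca).
Qed.

(** Multiplying by the conjugate of the value [z] makes the integral real, so that the inequality
    between real parts applies under the integral. *)
Lemma normc_fourier_le f a : cintegrable alpha f -> character a ->
  ((normc (fourier alpha f a))%:E <= \int[alpha]_x (normc (f x))%:E)%E.
Proof.
move=> if_ ca; set z := fourier alpha f a.
have ifa := fourier_cintegrable if_ ca.
have [z0|z0] := eqVneq (normc z) 0.
  by rewrite z0; apply: integral_ge0 => x _; rewrite lee_fin normc_ge0.
have zp : 0 < normc z by rewrite lt0r z0 normc_ge0.
have I0 : (0 <= \int[alpha]_x (normc (f x))%:E)%E.
  by apply: integral_ge0 => x _; rewrite lee_fin normc_ge0.
have If : (\int[alpha]_x (normc (f x))%:E)%E \is a fin_num.
  by rewrite ge0_fin_numE//; case: if_.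
rewrite -(fineK If) lee_fin -(ler_pM2l zp).
have -> : normc z * normc z = Re (conjc z * z).
  by rewrite [in RHS]mulrC mulc_conj /= expr2.
rewrite Re_cintegralZ//.
have in_ : alpha.-integrable [set: BX] (EFin \o (fun x => normc (f x))).
  case: if_ => mf If'; apply/integrableP; split.
    by apply/measurable_EFinP; exact: cmeasurable_normc.
  by under eq_integral do rewrite /= ger0_norm ?normc_ge0//.
rewrite -[X in _ <= _ * X]/(Rintegral alpha [set: BX] (fun x => normc (f x))) -RintegralZl//.
apply: le_Rintegral => //.
- have := cintegrable_Re (h := fun x => f x * conjc (a x) * conjc z).
  rewrite (_ : _ \o _ = fun x => (Re (f x * conjc (a x) * conjc z))%:E); last first.
    by apply/funext => x /=; rewrite mulrC.
  apply; apply: (cintegrableM_bounded ifa (M := normc z)).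
    exact/ccontinuous_cmeasurable/ccontinuous_cst.
  by move=> x; rewrite normc_conj.
- rewrite (_ : _ \o _ = fun x => ((normc z)%:E * (normc (f x))%:E)%E)//.
  exact: integrableZl.
move=> x _; apply: le_trans (ler_Re_normc _) _.
by rewrite !ComplexField.Normc.normcM !normc_conj (character_norm x ca) mulr1.
Qed.

Lemma fourierZ (k : R) f a : cintegrable alpha f -> character a ->
  fourier alpha (fun x => k%:C%C * f x) a = k%:C%C * fourier alpha f a.
Proof.
move=> if_ ca; have ifa := fourier_cintegrable if_ ca.
have i1 := cintegrable_Re ifa; have i2 := cintegrable_Im ifa.
rewrite /fourier /cintegral; apply/eqP; rewrite eq_complex /= mul0r subr0 mul0r addr0.
rewrite -!RintegralZl//; apply/andP; split; apply/eqP; apply: eq_Rintegral => x _;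
  by rewrite -mulrA; case: (f x * _) => ? ? /=; rewrite mul0r ?subr0 ?addr0.
Qed.

Lemma cmeasurable_poweR f (r : R) : cmeasurable f ->
  measurable_fun [set: BX] (fun x => (`|(normc (f x))%:E| `^ r)%E).
Proof.
move=> mf; apply: (@measurableT_comp _ _ _ _ _ _ (fun y : \bar R => (y `^ r)%E)).
  exact: measurable_poweR.
by apply: measurableT_comp => //; apply/measurable_EFinP; exact: cmeasurable_normc.
Qed.

Lemma cLnormZ (k : R) f p : 0 < k -> (0 < p)%E -> cmeasurable f ->
  cLnorm alpha p (fun x => k%:C%C * f x) = (k%:E * cLnorm alpha p f)%E.
Proof.
move=> k0 p0 mf; rewrite /cLnorm unlock; case: p p0 => [r| |//].
  rewrite lte_fin => r0.
  under eq_integral => x _.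
    rewrite ComplexField.Normc.normcM normc_real ?(ltW k0)// EFinM abseM poweRM//.
    rewrite gee0_abs ?lee_fin ?(ltW k0)//; over.
  rewrite ge0_integralZl//; last 3 first.
  - exact: cmeasurable_poweR.
  - by move=> x _; exact: poweR_ge0.
  - exact: poweR_ge0.
  rewrite poweRM ?poweR_ge0//; last by apply: integral_ge0 => x _; exact: poweR_ge0.
  by rewrite -poweRrM divff ?gt_eqF// poweRe1// lee_fin ltW.
move=> _; have [m0 _ _ _ _] := haar; rewrite m0 -ess_sup_pZl//.
congr (ess_sup _ _); apply/funext => x /=.
rewrite ComplexField.Normc.normcM normc_real ?(ltW k0)// normrM EFinM.
by rewrite (gtr0_norm k0).
Qed.

Lemma cLnorm_gt0 f a p : (0 < p)%E -> cintegrable alpha f -> character a ->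
  0 < normc (fourier alpha f a) -> (0 < cLnorm alpha p f)%E.
Proof.
move=> p0 if_ ca; rewrite lt0e Lnorm_ge0 andbT; apply: contraTneq => f0.
rewrite -leNgt -lee_fin; apply: le_trans (normc_fourier_le if_ ca) _.
have mf : measurable_fun [set: BX] (fun x => (normc (f x))%:E).
  by apply/measurable_EFinP; apply: cmeasurable_normc; case: if_.
have ae0 := Lnorm_eq0_eq0 mf p0 f0.
rewrite (ae_eq_integral (cst 0%E))//.
by rewrite integral0.
Qed.

Lemma cLnorm_le f p M : 0 <= M -> (0 < p)%E -> cmeasurable f ->
  (forall x, normc (f x) <= M) ->
  (cLnorm alpha p f <= (M * mass `^ recip p)%:E)%E.
Proof.
move=> M0 p0 mf fM; rewrite /cLnorm unlock; case: p p0 => [r| |//]; last first.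
  move=> _; have [m0 _ _ _ _] := haar; rewrite m0 /= powRr0 mulr1.
  by apply/ess_supP; apply/nearW => x /=; rewrite lee_fin ger0_norm ?normc_ge0.
rewrite lte_fin => r0 /=.
have mass0 := mass_gt0 haar.
have -> : M * mass `^ r^-1 = (M `^ r * mass) `^ r^-1.
  by rewrite powRM ?powR_ge0 ?(ltW mass0)// -powRrM divff ?gt_eqF// powRr1.
rewrite -poweR_EFin; apply: gt0_ler_poweR.
- by rewrite invr_ge0 ltW.
- by rewrite in_itv /= leey andbT integral_ge0// => x _; exact: poweR_ge0.
- by rewrite in_itv /= leey andbT lee_fin mulr_ge0 ?powR_ge0 ?ltW.
apply: (@le_trans _ _ (\int[alpha]_(x in [set: BX]) (M `^ r)%:E)%E).
  apply: ge0_le_integral => //.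
  - exact: cmeasurable_poweR.
  move=> x _; rewrite /= lee_fin ger0_norm ?normc_ge0//.
  by apply: ge0_ler_powR; rewrite ?nnegrE ?normc_ge0 ?(ltW r0).
by rewrite integral_cst// massE// EFinM.
Qed.

(** The power of [(size A)%:R / mass] is the dual norm of the indicator of [A]; at [q = +oo] it is
    1, since [recip q] is 0. *)
Lemma dual_Lnorm_ge q (F : (X -> C) -> C) (A : seq (X -> C)) d : (0 < q)%E ->
  uniq A -> (0 < size A)%N -> (forall a, a \in A -> character a) ->
  0 <= d -> (forall a, a \in A -> d <= normc (F a)) ->
  ((((size A)%:R / mass) `^ recip q * d)%:E <= dual_Lnorm alpha q F)%E.
Proof.
move=> q0 uA A0 cA d0 dA; rewrite /dual_Lnorm; case: q q0 => [r| |//]; last first.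
  move=> _ /=; rewrite powRr0 mul1r.
  case: A A0 cA dA uA => [//|a A] _ cA dA _.
  apply: ereal_sup_ge; exists (normc (F a))%:E; last by rewrite lee_fin dA ?mem_head.
  by exists a => //; apply: cA; rewrite mem_head.
rewrite lte_fin => r0 /=; have m0 := mass_gt0 haar.
have -> : ((size A)%:R / mass) `^ r^-1 * d = (mass^-1 * ((size A)%:R * d `^ r)) `^ r^-1.
  rewrite [in RHS]mulrA [mass^-1 * _]mulrC [RHS]powRM ?powR_ge0 ?divr_ge0 ?(ltW m0)//.
  by rewrite -powRrM divff ?gt_eqF// powRr1.
rewrite -poweR_EFin; apply: gt0_ler_poweR.
- by rewrite invr_ge0 ltW.
- by rewrite in_itv /= leey andbT lee_fin !mulr_ge0 ?invr_ge0 ?powR_ge0 ?(ltW m0).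
- rewrite in_itv /= leey andbT mule_ge0 ?lee_fin ?invr_ge0 ?(ltW m0)//.
  by apply: esum_ge0 => x _ /=; rewrite lee_fin powR_ge0.
rewrite EFinM lee_wpmul2l ?lee_fin ?invr_ge0 ?(ltW m0)//.
apply: esum_ge; exists [set` A].
  by split; [exact: finite_seq|move=> a /cA].
rewrite -fsbig_seq// -[X in (X%:E <= _)%E](_ : \sum_(a <- A) d `^ r = _); last first.
  by rewrite big_const_seq count_predT iter_addr_0 mulr_natl.
rewrite -sumEFin big_seq [leRHS]big_seq; apply: lee_sum => a aA.
rewrite /= lee_fin; apply: ge0_ler_powR; rewrite ?nnegrE ?normc_ge0 ?(ltW r0)//.
exact: dA.
Qed.

(** All lower bounds for the constant come from here: dividing [f] by its norm, nonzero because some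
    Fourier coefficient is, gives an admissible function. *)
Lemma Cpq_ge p q f (A : seq (X -> C)) d B : (0 < p)%E -> (0 < q)%E ->
  uniq A -> (0 < size A)%N -> (forall a, a \in A -> character a) ->
  cintegrable alpha f -> (cLnorm alpha p f <= B%:E)%E ->
  0 < d -> (forall a, a \in A -> d <= normc (fourier alpha f a)) ->
  ((((size A)%:R / mass) `^ recip q * (d / B))%:E <= Cpq alpha p q)%E.
Proof.
move=> p0 q0 uA A0 cA if_ fB d0 dA.
have [a aA] : exists a, a \in A.
  by case: A A0 {uA cA dA} => [//|a A] _; exists a; rewrite mem_head.
have N0 : (0 < cLnorm alpha p f)%E.
  by apply: (cLnorm_gt0 p0 if_ (cA _ aA)); apply: lt_le_trans d0 (dA _ aA).
have Nfin : cLnorm alpha p f \is a fin_num.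
  by rewrite ge0_fin_numE ?(ltW N0)//; apply: le_lt_trans fB (ltry _).
pose N := fine (cLnorm alpha p f).
have NE : cLnorm alpha p f = N%:E by rewrite fineK.
rewrite NE lte_fin in N0; rewrite NE lee_fin in fB.
have iN : cintegrable alpha (fun x => (N^-1)%:C%C * f x).
  rewrite (_ : (fun x => _) = fun x => f x * (N^-1)%:C%C); last first.
    by apply/funext => x; rewrite mulrC.
  apply: (cintegrableM_bounded if_ (M := N^-1)).
    exact/ccontinuous_cmeasurable/ccontinuous_cst.
  by move=> x; rewrite normc_real// invr_ge0 ltW.
apply: (@le_trans _ _ (dual_Lnorm alpha q (fourier alpha (fun x => (N^-1)%:C%C * f x)))).
  apply: (@le_trans _ _ ((((size A)%:R / mass) `^ recip q * (d / N))%:E)).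
    rewrite lee_fin ler_wpM2l ?powR_ge0// ler_pM2l// lef_pV2// posrE//.
    exact: lt_le_trans fB.
  apply: dual_Lnorm_ge => // [|b bA]; first by rewrite divr_ge0 ?ltW.
  rewrite fourierZ//; last exact: cA.
  rewrite ComplexField.Normc.normcM normc_real ?invr_ge0 ?(ltW N0)// mulrC.
  by rewrite ler_pM2l ?invr_gt0// dA.
apply: ereal_sup_ubound; exists (fun x => (N^-1)%:C%C * f x) => //; split=> //.
rewrite cLnormZ ?invr_gt0//; last by case: if_.
by rewrite NE -EFinM mulVf// gt_eqF.
Qed.

Lemma ccontinuous_cintegrable f : ccontinuous f -> cintegrable alpha f.
Proof.
move=> cf; split; first exact: ccontinuous_cmeasurable.
have [M M0 HM] := compact_continuous_bounded cX (continuous_normc cf).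
have /integrableP[_] := continuous_integrable cX haar (continuous_normc cf).
by under eq_integral do rewrite /= ger0_norm ?normc_ge0//.
Qed.

End FourierNorms.

(** * The regions R2 and R3 *)

Section LowerBounds.
Context {R : realType} {X : topologicalZmodType}.
Local Notation BX := (borel X).
Variable alpha : {measure set BX -> \bar R}.
Hypotheses (cX : compact [set: X]) (hX : hausdorff_space X)
  (iX : infinite_set [set: X]) (haar : is_haar alpha).

Local Notation C := R[i].
Local Notation mass := (fine (alpha [set: BX])).
Local Notation mean := (haar_mean alpha).
Local Notation fcoef := (fourier_coef alpha).
Local Notation normc := (@ComplexField.Normc.normc R).
Implicit Types (f g h : X -> C) (z w : C) (p q : \bar R).

Lemma powR_unbounded (K s M : R) : 0 < K -> 0 < s ->
  exists n0 : nat, forall n, (n0 <= n)%N -> M <= K * n%:R `^ s.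
Proof.
move=> K0 s0; pose y := Num.max 0 (M / K).
have y0 : 0 <= y by rewrite le_max lexx.
exists (Num.truncn (y `^ s^-1)).+1 => n n0.
rewrite mulrC -ler_pdivrMr//; apply: (@le_trans _ _ y); first by rewrite le_max lexx orbT.
have -> : y = (y `^ s^-1) `^ s by rewrite -powRrM mulVf ?powRr1// gt_eqF.
apply: ge0_ler_powR; rewrite ?nnegrE ?powR_ge0 ?(ltW s0)//.
by apply: le_trans (ltW (truncnS_gt _)) _; rewrite ler_nat.
Qed.

Lemma ex_character_notin (l : seq (X -> C)) :
  exists2 g : X -> C, character g & g \notin l.
Proof.
apply: contrapT => H; apply: (infinite_dual cX hX iX haar).
apply: (@sub_finite_set _ _ [set` l]); last exact: finite_seq.
by move=> g cg /=; apply: contrapT => /negP gl; apply: H; exists g.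
Qed.

Lemma normc_nat n : normc n%:R = n%:R.
Proof. by rewrite -(rmorph_nat (real_complex R)) normc_real. Qed.

(** The pair [(P, Q)] is replaced by [P + g Q] and [P - g Q]. By the parallelogram law the sum of
    squares doubles pointwise, starting from 2, whence [n.+1]. *)
Lemma rudin_shapiro n : exists P Q : X -> C, exists A : seq (X -> C),
  [/\ ccontinuous P, ccontinuous Q,
      [/\ uniq A, size A = (2 ^ n)%N & forall a, a \in A -> character a],
      forall x, normc (P x) ^+ 2 + normc (Q x) ^+ 2 = (2 ^ n.+1)%:R &
      forall a, character a -> normc (fcoef P a) = (a \in A)%:R /\
        normc (fcoef Q a) = (a \in A)%:R].
Proof.
elim: n => [|n [P [Q [A [cP cQ [uA sA cA] PQ coefA]]]]].
  exists (fun=> 1), (fun=> 1), [:: fun=> 1]; split.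
  - exact: ccontinuous_cst.
  - exact: ccontinuous_cst.
  - by split=> // a; rewrite inE => /eqP ->; exact: character1.
  - by move=> x; rewrite ComplexField.Normc.normc1 expr1n.
  move=> a ca; rewrite fcoef_character ?inE//; last exact: character1.
  rewrite eq_sym; case: (a == _).
    by rewrite ComplexField.Normc.normc1.
  by rewrite ComplexField.Normc.normc0.
(* Avoiding the quotients of elements of [A] makes [A] and [g A] disjoint, so that the coefficients
   keep modulus 1. *)
have [g cg gA] := ex_character_notin [seq (fun x => a x * conjc (b x)) | a <- A, b <- A].
pose mulg (b : X -> C) : X -> C := fun x => g x * b x.
pose mulgV (b : X -> C) : X -> C := fun x => conjc (g x) * b x.
have mulgK : cancel mulg mulgV.
  by move=> b; apply/funext => x; rewrite /mulg /mulgV mulrA [_ * g x]mulrC character_mulJ ?mul1r.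
have mulgVK : cancel mulgV mulg.
  by move=> b; apply/funext => x; rewrite /mulg /mulgV mulrA character_mulJ ?mul1r.
have gAA a : a \in A -> mulgV a \notin A.
  move=> aA; apply: contra gA => gaA; apply/allpairsP; exists (a, mulgV a); split=> //=.
  apply/funext => x; rewrite /mulgV rmorphM /= conjcK mulrCA character_mulJ ?mulr1//.
  exact: cA.
have cmulgV a : character a -> character (mulgV a).
  by move=> ca; apply: characterM => //; exact: characterJ.
have memg a : (a \in [seq mulg b | b <- A]) = (mulgV a \in A).
  by rewrite -{1}(mulgVK a) mem_map//; exact: can_inj mulgK.
have cg' := character_ccontinuous cg.
have cgQ : ccontinuous (fun x => g x * Q x) by exact: ccontinuousM.
have cgQ' : ccontinuous (fun x => - 1 * (g x * Q x)) by exact: ccontinuousZ.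
exists (fun x => P x + g x * Q x), (fun x => P x + - 1 * (g x * Q x)).
exists (A ++ [seq mulg b | b <- A]); split.
- exact: ccontinuousD.
- exact: ccontinuousD.
- split.
  + rewrite cat_uniq uA map_inj_uniq ?uA ?andbT /=; last exact: can_inj mulgK.
    by apply/hasPn => a; rewrite memg => ga; apply/negP => /gAA; rewrite ga.
  + by rewrite size_cat size_map sA addnn expnS mul2n.
  move=> a; rewrite mem_cat memg => /orP[/cA//|/cA ca].
  by rewrite -(mulgVK a); exact: characterM.
- move=> x; have -> : normc (P x + g x * Q x) ^+ 2 + normc (P x + -1 * (g x * Q x)) ^+ 2 =
      2 * (normc (P x) ^+ 2 + normc (g x * Q x) ^+ 2).
    rewrite !normc_sqr; case: (P x) (g x * Q x) => [a b] [c d] /=; ring.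
  rewrite ComplexField.Normc.normcM (character_norm x cg) mul1r PQ.
  by rewrite -natrM -expnS.
move=> a ca; have cga := cmulgV _ ca.
rewrite !fcoefD// fcoefZ// fcoefM -/(mulgV a) mem_cat memg.
have [nP nQ] := coefA _ ca; have [nP' nQ'] := coefA _ cga.
have [aA|aA] := boolP (a \in A).
  rewrite (negbTE (gAA _ aA)) in nQ'.
  have -> := ComplexField.Normc.eq0_normc nQ'.
  by rewrite mulr0 !addr0 nP aA.
rewrite (negbTE aA) in nP; have -> := ComplexField.Normc.eq0_normc nP.
by rewrite !add0r mulN1r normcN.
Qed.

Let mass0 : 0 < mass := mass_gt0 haar.

Lemma eqy_unbounded (x : \bar R) : (forall M : R, (M%:E <= x)%E) -> x = +oo%E.
Proof.
case: x => [r| |] // H; first by have := H (r + 1); rewrite lee_fin gerDl ler10.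
by have := H 0.
Qed.

Lemma Cpq_region3 p q : (0 < p)%E -> (0 < q)%E -> recip q > 1 / 2 ->
  Cpq alpha p q = +oo%E.
Proof.
move=> p0 q0 q2; apply: eqy_unbounded => M.
(* [K] gathers the factors free of [n]; what remains is the number of characters to the power
   [recip q], divided by its square root from the sup norm. *)
pose K := mass^-1 `^ recip q * (mass / (Num.sqrt 2 * mass `^ recip p)).
have K0 : 0 < K.
  by rewrite mulr_gt0 ?powR_gt0 ?invr_gt0// divr_gt0// mulr_gt0 ?sqrtr_gt0 ?powR_gt0.
have s0 : 0 < recip q - 1 / 2 by rewrite subr_gt0.
have [n H] := powR_unbounded M K0 s0.
have [P [Q [A [cP cQ [uA sA cA] PQ coefA]]]] := rudin_shapiro n.
pose B := Num.sqrt (2 ^ n.+1)%:R * mass `^ recip p : R.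
have PB : (cLnorm alpha p P <= B%:E)%E.
  apply: cLnorm_le => //; first exact: ccontinuous_cmeasurable.
  move=> x; rewrite -(ler_pXn2r (n := 2))// ?nnegrE ?normc_ge0 ?sqrtr_ge0//.
  by rewrite sqr_sqrtr// -(PQ x) lerDl sqr_ge0.
apply: (@le_trans _ _ ((((size A)%:R / mass) `^ recip q * (mass / B))%:E)); last first.
  apply: (Cpq_ge haar p0 q0 uA _ cA _ PB) => //.
  - by rewrite sA expn_gt0.
  - exact: ccontinuous_cintegrable.
  move=> a aA; rewrite normc_fourier//.
  by have [-> _] := coefA _ (cA _ aA); rewrite aA mulr1.
rewrite lee_fin; apply: le_trans (H (2 ^ n)%N _) _; first exact/ltnW/ltn_expl.
have N0 : 0 < (2 ^ n)%:R :> R by rewrite ltr0n expn_gt0.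
rewrite sA powRM ?invr_ge0 ?(ltW mass0)// /K /B expnS natrM sqrtrM//.
rewrite powRB ?(gt_eqF N0) ?implybT// div1r powR12_sqrt ?(ltW N0)//.
set r := Num.sqrt (2 ^ n)%:R; have r0 : r != 0 by rewrite gt_eqF// sqrtr_gt0.
have t0 : Num.sqrt 2 != 0 :> R by rewrite gt_eqF// sqrtr_gt0.
have u0 : mass `^ recip p != 0 by rewrite gt_eqF// powR_gt0.
suff -> : mass^-1 `^ recip q * (mass / (Num.sqrt 2 * mass `^ recip p)) *
  ((2 ^ n)%:R `^ recip q / r) = (2 ^ n)%:R `^ recip q * mass^-1 `^ recip q *
  (mass / (Num.sqrt 2 * r * mass `^ recip p)) by [].
by field; rewrite r0 t0 u0.
Qed.

End LowerBounds.

Section Region2.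
Context {R : realType} {X : topologicalZmodType}.
Local Notation BX := (borel X).
Variable alpha : {measure set BX -> \bar R}.
Hypotheses (cX : compact [set: X]) (hX : hausdorff_space X)
  (iX : infinite_set [set: X]) (haar : is_haar alpha).

Local Notation C := R[i].
Local Notation mass := (fine (alpha [set: BX])).
Local Notation mean := (haar_mean alpha).
Local Notation fcoef := (fourier_coef alpha).
Local Notation normc := (@ComplexField.Normc.normc R).
Implicit Types (f g h a b : X -> C) (z w : C) (p q : \bar R).

Let mulf a b : X -> C := fun x => a x * b x.
Let powf a k : X -> C := fun x => a x ^+ k.

Lemma character_pow a k : character a -> character (powf a k).
Proof.
move=> ca; elim: k => [|k IH].
  rewrite (_ : powf a 0 = fun=> 1); first exact: character1.
  by apply/funext => x; rewrite /powf expr0.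
rewrite (_ : powf a k.+1 = mulf a (powf a k)); first exact: characterM.
by apply/funext => x; rewrite /powf /mulf exprS.
Qed.

(** Adjoining to [A] the finitely many powers of a new character keeps it finite and closed under
    products. The trivial character lies in [A] as a power of any element, so the new set contains
    both [A] and [g]. *)
Lemma ex_finite_semigroup N : (forall a, character a -> exists2 m, (0 < m)%N & powf a m = fun=> 1) ->
  exists A : seq (X -> C), [/\ uniq A, (N < size A)%N, forall a, a \in A -> character a &
    forall a b, a \in A -> b \in A -> mulf a b \in A].
Proof.
move=> tors; elim: N => [|N [A [uA sA cA mA]]].
  exists [:: fun=> 1]; split=> // [a|a b].
    by rewrite inE => /eqP ->; exact: character1.
  rewrite !mem_seq1 => /eqP ea /eqP eb; apply/eqP; apply/funext => x.
  by rewrite ea eb /mulf mulr1.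
have [g cg gA] := ex_character_notin cX hX iX haar A.
have [m m0 gm] := tors _ cg.
have gmod k : powf g k = powf g (k %% m).
  apply/funext => x; rewrite /powf {1}(divn_eq k m) exprD mulnC exprM.
  by have := congr1 (fun f => f x) gm; rewrite /powf => ->; rewrite expr1n mul1r.
pose A' := undup [seq mulf a (powf g k) | a <- A, k <- iota 0 m].
have memA' a k : a \in A -> mulf a (powf g k) \in A'.
  move=> aA; rewrite gmod mem_undup; apply/allpairsP; exists (a, (k %% m)%N); split=> //=.
  by rewrite mem_iota /= add0n ltn_mod.
have one : (fun=> 1) \in A.
  have [a aA] : exists a, a \in A.
    by case: (A) sA => [//|a A''] _; exists a; rewrite mem_head.
  have [j j0 aj] := tors _ (cA _ aA).
  rewrite -aj; case: j j0 {aj} => // j _; elim: j => [|j IH].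
    by rewrite (_ : powf a 1 = a)//; apply/funext => x; rewrite /powf expr1.
  rewrite (_ : powf a j.+2 = mulf a (powf a j.+1)); first exact: mA.
  by apply/funext => x; rewrite /powf /mulf exprS.
exists A'; split.
- exact: undup_uniq.
- have sub : {subset g :: A <= A'}.
    move=> a; rewrite inE => /orP[/eqP ->|aA].
      rewrite (_ : g = mulf (fun=> 1) (powf g 1)); first exact: memA'.
      by apply/funext => x; rewrite /mulf /powf mul1r expr1.
    rewrite (_ : a = mulf a (powf g 0)); first exact: memA'.
    by apply/funext => x; rewrite /mulf /powf mulr1.
  apply: leq_trans (uniq_leq_size _ sub); first by rewrite /= ltnS.
  by rewrite /= gA.
- move=> a; rewrite mem_undup => /allpairsP[[b k] /= [bA _ ->]].
  by apply: characterM; [exact: cA|exact: character_pow].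
move=> a b; rewrite !mem_undup => /allpairsP[[a1 k1] /= [a1A _ ->]].
move=> /allpairsP[[b1 l1] /= [b1A _ ->]]; rewrite -[_ \in _]mem_undup -/A'.
rewrite (_ : mulf _ _ = mulf (mulf a1 b1) (powf g (k1 + l1))).
  by apply: memA'; exact: mA.
by apply/funext => x; rewrite /mulf /powf exprD mulrACA.
Qed.

(* An element of infinite order gives a progression [A] and its first half [B]; if
   every character has finite order, a large finite subgroup serves for both. *)
Lemma ex_almost_closed N : exists A B : seq (X -> C),
  [/\ uniq A, uniq B, (N < size A)%N & (size A <= 2 * size B)%N] /\
  [/\ forall a, a \in A -> character a, forall b, b \in B -> character b &
    forall b, b \in B -> (size A <= 2 * count (fun a => mulf a b \in A) A)%N].
Proof.
have [tors|] := pselect (forall a, character a -> exists2 m, (0 < m)%N & powf a m = fun=> 1).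
  have [A [uA sA cA mA]] := ex_finite_semigroup N tors.
  exists A, A; split; split=> //; first by rewrite leq_pmull.
  move=> b bA; rewrite (_ : count _ _ = size A) ?leq_pmull//.
  by apply/eqP; rewrite -all_count; apply/allP => a aA; exact: mA.
move=> /existsNP[g] /not_implyP[cg gm].
have inj : injective (powf g).
  have lt k l : (k < l)%N -> powf g k <> powf g l.
    move=> kl gkl; apply: gm; exists (l - k)%N; first by rewrite subn_gt0.
    apply/funext => x; have := congr1 (fun f => f x) gkl.
    rewrite /powf -(subnK (ltnW kl)) exprD addnK -[LHS]mul1r.
    move=> /mulIf -> //; rewrite expf_neq0//; apply/eqP => gx0.
    have := character_norm x cg; rewrite gx0 ComplexField.Normc.normc0.
    by move/esym/eqP; rewrite oner_eq0.
  by move=> k l kl; case: (ltngtP k l) => // /lt; rewrite kl.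
pose N' := N.+1; pose A0 := [seq powf g k | k <- iota 0 (N' + N')].
have sA0 : size A0 = (N' + N')%N by rewrite size_map size_iota.
have memA0 k : (k < N' + N')%N -> powf g k \in A0.
  by move=> kN; apply/mapP; exists k => //; rewrite mem_iota.
exists A0, [seq powf g k | k <- iota 0 N']; split; split.
- by rewrite map_inj_uniq ?iota_uniq.
- by rewrite map_inj_uniq ?iota_uniq.
- by rewrite sA0 /N'; lia.
- by rewrite sA0 size_map size_iota; lia.
- by move=> _ /mapP[k _ ->]; exact: character_pow.
- by move=> _ /mapP[k _ ->]; exact: character_pow.
move=> b /mapP[l + ->] {b}; rewrite mem_iota add0n => /andP[_ lN].
rewrite sA0 addnn -mul2n leq_pmul2l// {2}/A0 count_map.
(* For [l < N'], the first [N'] exponents stay below [N' + N'] after adding [l]. *)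
apply: (@leq_trans (count (fun k => (k < N')%N) (iota 0 (N' + N')))).
  rewrite iotaD count_cat -{1}(size_iota 0 N'); apply: leq_trans (leq_addr _ _).
  by apply/eq_leq/esym/eqP; rewrite -all_count; apply/allP => k; rewrite mem_iota.
apply: sub_count => k kN /=.
rewrite (_ : mulf _ _ = powf g (k + l)); first by apply: memA0; lia.
by apply/funext => x; rewrite /mulf /powf exprD.
Qed.

Let mass0 : 0 < mass := mass_gt0 haar.

Section Fejer.
Variable A : seq (X -> C).
Hypotheses (uA : uniq A) (cA : forall a, a \in A -> character a).

Let D x := \sum_(a <- A) a x.
Let F x := D x * conjc (D x).

(** The default 1 makes every index a character, so sums over [A] need no membership side
    conditions. *)
Let t a : X -> C := if a \in A then a else fun=> 1.

Let ct a : character (t a).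
Proof. by rewrite /t; case: ifPn => [/cA//|_]; exact: character1. Qed.

Let Dt : D = fun x => \sum_(a <- A) t a x.
Proof.
by apply/funext => x; rewrite /D big_seq [RHS]big_seq; apply: eq_bigr => a aA; rewrite /t aA.
Qed.

Let cD : ccontinuous D.
Proof. by rewrite Dt; apply: ccontinuous_sum => a; exact: character_ccontinuous. Qed.

Lemma fejer_ccontinuous : ccontinuous F.
Proof. exact: (ccontinuousM cD (ccontinuousJ cD)). Qed.

Let cF := fejer_ccontinuous.

Let fcoef_D b : character b -> fcoef D b = (b \in A)%:R.
Proof.
move=> cb; rewrite Dt fcoef_sum//; last by move=> a; exact: character_ccontinuous.
rewrite big_seq (eq_bigr (fun a => if a == b then 1 else 0)); last first.
  by move=> a aA; rewrite fcoef_character// /t aA.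
rewrite -big_seq -big_mkcond /= big_const_seq iter_addr_0.
by rewrite -(count_uniq_mem b uA).
Qed.

(** Only the conjugate factor of [F] is expanded: each of its terms contributes a coefficient of
    [D], which is 0 or 1. *)
Lemma fejer_coef b : character b ->
  fcoef F b = (count (fun a => mulf a b \in A) A)%:R.
Proof.
move=> cb; transitivity (\sum_(a <- A) fcoef D (mulf (t a) b)).
  rewrite /fourier_coef -cmean_sum//; last first.
    move=> a; apply: ccontinuousM => //; apply: ccontinuousJ.
    by apply: ccontinuousM; exact: character_ccontinuous.
  congr cmean; apply/funext => x.
  have cDt : conjc (D x) = \sum_(a <- A) conjc (t a x) by rewrite Dt rmorph_sum.
  rewrite /F -mulrA cDt; move: (D x) => d; rewrite mulr_suml mulr_sumr.
  by apply: eq_bigr => a _; rewrite /mulf rmorphM.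
rewrite -sum1_count natr_sum [RHS]big_mkcond /= big_seq [RHS]big_seq.
apply: eq_bigr => a aA; rewrite fcoef_D; last exact: characterM.
by rewrite /t aA; case: ifP.
Qed.

(** With [N] the size of [A], [|F| <= N ^ 2] everywhere, and the mean of [|F|] is its coefficient at
    the trivial character, namely [N]. Then [|F| ^ r <= N ^ (2 r - 2) |F|] gives the exponent
    [2 * r - 1]. *)
Lemma fejer_Lnorm (r : R) : 1 <= r ->
  (cLnorm alpha r%:E F <= ((mass * (size A)%:R `^ (2 * r - 1)) `^ r^-1)%:E)%E.
Proof.
move=> r1; have r0 : 0 < r by apply: lt_le_trans r1.
have [A0|A0] := eqVneq (size A) 0%N.
  have F0 x : normc (F x) <= 0.
    by rewrite /F /D (size0nil A0) big_nil mul0r ComplexField.Normc.normc0.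
  apply: le_trans (cLnorm_le haar (lexx 0) _ (ccontinuous_cmeasurable cF) F0) _.
    by rewrite lte_fin.
  by rewrite mul0r lee_fin powR_ge0.
set N := (size A)%:R : R; have N0 : 0 < N by rewrite ltr0n lt0n.
have Dle x : normc (D x) <= N.
  rewrite /D /N; elim: (A) cA => [|a s IH] cs.
    by rewrite big_nil ComplexField.Normc.normc0.
  rewrite big_cons /=; apply: le_trans (le_normcD _ _) _.
  rewrite -natr1 addrC lerD//; last by rewrite (character_norm x (cs _ (mem_head _ _))).
  by apply: IH => b bs; apply: cs; rewrite inE bs orbT.
have FE x : normc (F x) = normc (D x) ^+ 2.
  by rewrite /F ComplexField.Normc.normcM normc_conj expr2.
have mF : mean (fun x => normc (F x)) = N.
  have h := fejer_coef character1.
  have cnt : count (fun a => mulf a (fun=> 1) \in A) A = size A.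
    apply/eqP; rewrite -all_count; apply/allP => a aA.
    by rewrite (_ : mulf a _ = a)//; apply/funext => x; rewrite /mulf mulr1.
  have -> : N = complex.Re (fcoef F (fun=> 1)).
    by rewrite h cnt -(rmorph_nat (real_complex R)).
  transitivity (mean (fun x => complex.Re (F x * conjc (1 : C)))); last by [].
  by congr mean; apply/funext => x; rewrite conjc1 mulr1 FE /F mulc_conj.
rewrite /cLnorm unlock -poweR_EFin; apply: gt0_ler_poweR.
- by rewrite invr_ge0 ltW.
- by rewrite in_itv /= leey andbT integral_ge0// => x _; exact: poweR_ge0.
- by rewrite in_itv /= leey andbT lee_fin mulr_ge0 ?powR_ge0 ?ltW.
have cnF := continuous_normc cF.
apply: (@le_trans _ _ (\int[alpha]_(x in [set: BX]) (N `^ (2 * r - 2) * normc (F x))%:E)%E).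
  apply: ge0_le_integral => //.
  - by move=> x _; exact: poweR_ge0.
  - exact: (cmeasurable_poweR r (ccontinuous_cmeasurable cF)).
  - apply/measurable_EFinP; apply: continuous_borel.
    exact: (@continuousZf _ _ (N `^ (2 * r - 2)) _ cnF).
  move=> x _; rewrite /= lee_fin ger0_norm ?normc_ge0//.
  have nF0 := normc_ge0 (F x).
  rewrite -(mulr_powRB1 nF0 r0) mulrC ler_wpM2r//.
  have -> : 2 * r - 2 = 2 * (r - 1) by ring.
  rewrite powRrM; apply: ge0_ler_powR; rewrite ?nnegrE ?powR_ge0 ?subr_ge0//.
  rewrite FE powR_mulrn ?(ltW N0)// ler_pXn2r ?nnegrE ?normc_ge0 ?(ltW N0)//.
have iF := continuous_integrable cX haar cnF.
under eq_integral do rewrite EFinM.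
rewrite integralZl//.
rewrite (integral_mean cX haar cnF) mF.
rewrite -EFinM lee_fin mulrCA ler_wpM2l ?(ltW mass0)//.
rewrite -{2}(powRr1 (ltW N0)) -powRD; last by rewrite (gt_eqF N0) implybT.
by have -> : 2 * r - 2 + 1 = 2 * r - 1 by ring.
Qed.

End Fejer.

Lemma Cpq_region2 p q : (0 < p)%E -> (0 < q)%E -> 1 < recip p + recip q ->
  1 / 2 < recip p -> Cpq alpha p q = +oo%E.
Proof.
move=> p0 q0 pq p2; apply: eqy_unbounded => M.
case: p p0 pq p2 => [r| |//]; last by move=> _ _ /=; rewrite ltNge divr_ge0.
rewrite lte_fin => r0 /= rq r2.
have [r1|r1] := ltP r 1; last first.
  (* The kernel has coefficients at least [mass * N / 2] on at least [N / 2] characters, which gives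
     both halves in [K]. Against [fejer_Lnorm] the ratio grows like [N] to the power
     [r^-1 + recip q - 1]. *)
  pose K := 2^-1 * (2 * mass)^-1 `^ recip q * mass / mass `^ r^-1.
  have K0 : 0 < K by rewrite /K !mulr_gt0 ?invr_gt0 ?powR_gt0 ?invr_gt0 ?mulr_gt0.
  have s0 : 0 < r^-1 + recip q - 1 by rewrite subr_gt0.
  have [n H] := powR_unbounded M K0 s0.
  have [A [B [[uA uB nA AB] [cA cB HB]]]] := ex_almost_closed n.
  set N := (size A)%:R : R; have N0 : 0 < N by rewrite ltr0n (leq_ltn_trans _ nA).
  pose F x := (\sum_(a <- A) a x) * conjc (\sum_(a <- A) a x).
  have sB : N / 2 <= (size B)%:R by rewrite ler_pdivrMr// -natrM ler_nat mulnC.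
  have B0 : (0 < size B)%N.
    by rewrite -(ltr_nat R); apply: lt_le_trans sB; rewrite divr_gt0.
  have cF : ccontinuous F by exact: fejer_ccontinuous.
  apply: (@le_trans _ _ ((((size B)%:R / mass) `^ recip q *
    ((mass * (N / 2)) / (mass * N `^ (2 * r - 1)) `^ r^-1))%:E)); last first.
    apply: (Cpq_ge haar _ q0 uB B0 cB (f := F)).
    - by rewrite lte_fin.
    - exact: ccontinuous_cintegrable.
    - exact: fejer_Lnorm.
    - by rewrite mulr_gt0// divr_gt0.
    move=> b bB; rewrite normc_fourier// ler_pM2l// fejer_coef//; last exact: cB.
    rewrite normc_nat ler_pdivrMr// -natrM ler_nat mulnC.
    exact: HB.
  rewrite lee_fin; apply: le_trans (H (size A) (ltnW nA)) _.
  apply: (@le_trans _ _ ((N / 2 / mass) `^ recip q *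
    ((mass * (N / 2)) / (mass * N `^ (2 * r - 1)) `^ r^-1))).
    have e1 : (N / 2 / mass) = N * (2 * mass)^-1.
      by rewrite invfM mulrA.
    rewrite e1 powRM ?invr_ge0 ?mulr_ge0 ?(ltW mass0) ?(ltW N0)//.
    rewrite [(mass * N `^ _) `^ _]powRM ?powR_ge0 ?(ltW mass0)// -powRrM.
    have e2 : r^-1 + recip q - 1 = recip q + 1 - (2 * r - 1) / r.
      by field; rewrite gt_eqF.
    rewrite -/N e2 powRB ?(gt_eqF N0) ?implybT//.
    rewrite powRD ?(gt_eqF N0) ?implybT// powRr1 ?(ltW N0)//.
    set a := N `^ recip q; set b := N `^ _; set d := mass `^ _; rewrite /K.
    have b0 : b != 0 by rewrite gt_eqF// powR_gt0.
    have d0 : d != 0 by rewrite gt_eqF// powR_gt0.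
    set k := (2 * mass)^-1 `^ _.
    suff -> : 2^-1 * k * mass / d * (a * N / b) = a * k * (mass * (N / 2) / (d * b)) by [].
    by field; rewrite b0 d0.
  rewrite ler_wpM2r ?divr_ge0 ?mulr_ge0 ?powR_ge0 ?(ltW mass0) ?(ltW N0)//.
  apply: ge0_ler_powR; rewrite ?nnegrE ?divr_ge0 ?(ltW mass0) ?(ltW N0)//.
    by clear -q0; case: q q0 => [t| |]//=; rewrite lte_fin => t0; rewrite invr_ge0 ltW.
  by rewrite ler_pM2r ?invr_gt0.
(* For [r < 1] the trivial character alone suffices: an indicator of measure [u] gives
   [u / u ^ (1 / r)], unbounded as [u] shrinks. *)
pose K := mass^-1 `^ recip q.
have K0 : 0 < K by rewrite powR_gt0// invr_gt0.
have s0 : 0 < r^-1 - 1 by rewrite subr_gt0 invf_gt1.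
have [n H] := powR_unbounded M K0 s0.
have n0 : 0 < n.+1%:R^-1 :> R by rewrite invr_gt0.
have [U [oU U0 aU]] := small_open hX iX haar n0.
have mU := open_borel oU.
have U_gt0 := haar_open_gt0 cX haar oU U0.
pose u := fine (alpha U).
have uE : alpha U = u%:E by rewrite fineK// ge0_fin_numE// haar_lty.
rewrite uE lte_fin in U_gt0; rewrite uE lte_fin in aU.
pose f : X -> C := fun x => (\1_(U : set BX) x : R)%:C%C.
have mf : cmeasurable f.
  split; first exact: (@measurable_indic _ _ _ _ (U : set BX)).
  exact: measurable_cst.
have nf x : normc (f x) = \1_(U : set BX) x.
  by rewrite /f normc_real// indicE.
have intU : (\int[alpha]_x (\1_(U : set BX) x)%:E = u%:E)%E.
  by rewrite integral_indic// setIT uE.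
have if_ : cintegrable alpha f.
  by split=> //; under eq_integral do rewrite nf; rewrite intU ltry.
have Lf : (cLnorm alpha r%:E f <= (u `^ r^-1)%:E)%E.
  rewrite /cLnorm unlock -poweR_EFin -intU.
  rewrite le_eqVlt; apply/orP; left; apply/eqP; congr poweR.
  apply: eq_integral => x _; rewrite nf indicE; case: (x \in U).
    by rewrite abse1 poweR1r.
  by rewrite abse0 poweR0r// gt_eqF.
have f1 : normc (fourier alpha f (fun=> 1)) = u.
  rewrite /fourier /cintegral.
  have -> : Rintegral alpha [set: BX] (fun x => complex.Im (f x * conjc 1)) = 0.
    rewrite (@eq_Rintegral _ _ _ alpha _ (fun=> 0)) ?Rintegral_cst ?mul0r// => x _.
    by rewrite conjc1 mulr1.
  rewrite (@eq_Rintegral _ _ _ alpha _ (fun x => \1_(U : set BX) x)); last first.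
    by move=> x _; rewrite conjc1 mulr1.
  by rewrite /Rintegral intU /= expr0n addr0 sqrtr_sqr gtr0_norm.
apply: (@le_trans _ _ ((((size [:: (fun=> 1) : X -> C])%:R / mass) `^ recip q *
    (u / u `^ r^-1))%:E)); last first.
  apply: (Cpq_ge haar _ q0 _ _ _ if_ Lf U_gt0) => //.
  - by move=> a; rewrite mem_seq1 => /eqP ->; exact: character1.
  - by move=> a; rewrite mem_seq1 => /eqP ->; rewrite f1.
rewrite lee_fin; apply: le_trans (H n.+1 (leqnSn n)) _.
rewrite /= div1r /K ler_wpM2l ?powR_ge0//.
have -> : u / u `^ r^-1 = u^-1 `^ (r^-1 - 1).
  rewrite -{1}(powRr1 (ltW U_gt0)) -powRB ?(gt_eqF U_gt0) ?implybT//.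
  by rewrite -opprB powRN -powR_inv1 ?powR_ge0// -powRrM mulrC powRrM powR_inv1// ltW.
apply: ge0_ler_powR; rewrite ?nnegrE ?invr_ge0 ?(ltW U_gt0) ?(ltW s0)//.
by rewrite -[leLHS]invrK lef_pV2 ?posrE ?invr_gt0// ltW.
Qed.

End Region2.

(** * The Hausdorff-Young inequality *)

Section RealPowers.
Context {R : realType}.
Implicit Types (a b p q r t : R).

Lemma ln_lt_sub1 t : 0 < t -> t != 1 -> ln t < t - 1.
Proof.
move=> t0 t1; have lt0 : ln t != 0 by rewrite ln_eq0.
by have := expR_gt1Dx lt0; rewrite lnK ?posrE// => h; lra.
Qed.

(** With [m] the weighted mean of [x = a ^ p] and [y = b ^ q], equality says that [ln m] is the
    weighted mean of [ln x] and [ln y]. The tangent to [ln] at [m] lies strictly above it elsewhere,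
    so [x] and [y] both equal [m]. *)
Lemma young_eq a b p q : 0 <= a -> 0 <= b -> 0 < p -> 0 < q -> p^-1 + q^-1 = 1 ->
  a * b = a `^ p / p + b `^ q / q -> a `^ p = b `^ q.
Proof.
move=> a0 b0 p0 q0 pq.
have ip0 : 0 < p^-1 by rewrite invr_gt0.
have iq0 : 0 < q^-1 by rewrite invr_gt0.
have [->|an0] := eqVneq a 0.
  rewrite mul0r powR0 ?gt_eqF// mul0r add0r => /esym/eqP.
  by rewrite mulf_eq0 invr_eq0 (gt_eqF q0) orbF => /eqP.
have [->|bn0] := eqVneq b 0.
  rewrite mulr0 powR0 ?gt_eqF// mul0r addr0 => /esym/eqP.
  by rewrite mulf_eq0 invr_eq0 (gt_eqF p0) orbF => /eqP.
have {an0}a0 : 0 < a by rewrite lt0r an0.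
have {bn0}b0 : 0 < b by rewrite lt0r bn0.
move=> abE; apply/eqP; apply: contraT => xy.
set x := a `^ p in abE xy *; set y := b `^ q in abE xy *.
have x0 : 0 < x by rewrite powR_gt0.
have y0 : 0 < y by rewrite powR_gt0.
set m := x / p + y / q in abE.
have m0 : 0 < m by rewrite addr_gt0// divr_gt0.
have lnab : ln (a * b) = p^-1 * ln x + q^-1 * ln y.
  rewrite lnM ?posrE// /x /y !ln_powR !mulrA !mulVf ?mul1r// gt_eqF//.
have lnx z : 0 < z -> ln z = ln (z / m) + ln m.
  by move=> z0; rewrite -lnM ?posrE ?divr_gt0// divfK// gt_eqF.
have e1 : ln m = p^-1 * (ln (x / m) + ln m) + q^-1 * (ln (y / m) + ln m).
  by rewrite -!lnx// -lnab abE.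
have e2 : p^-1 * ln (x / m) + q^-1 * ln (y / m) = 0.
  have : (p^-1 + q^-1) * ln m = ln m by rewrite pq mul1r.
  by move: e1; rewrite !mulrDr mulrDl; lra.
have le1 z : 0 < z -> ln (z / m) <= z / m - 1.
  move=> z0; have [->|z1] := eqVneq (z / m) 1; first by rewrite ln1 subrr.
  by apply/ltW/ln_lt_sub1 => //; exact: divr_gt0.
have e3 : p^-1 * (x / m - 1) + q^-1 * (y / m - 1) = 0.
  have -> : p^-1 * (x / m - 1) + q^-1 * (y / m - 1) = (x / p + y / q) / m - (p^-1 + q^-1).
    by field; rewrite !gt_eqF.
  by rewrite pq -/m divff ?subrr// gt_eqF.
have xm : x / m = 1.
  apply/eqP; apply: contraT => xm; have h := ln_lt_sub1 (divr_gt0 x0 m0) xm.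
  have h2 := le1 y y0; exfalso.
  have h3 : p^-1 * ln (x / m) < p^-1 * (x / m - 1) by rewrite ltr_pM2l.
  have h4 : q^-1 * ln (y / m) <= q^-1 * (y / m - 1) by rewrite ler_pM2l.
  by lra.
have ym : y / m = 1.
  apply/eqP; apply: contraT => ym; have h := ln_lt_sub1 (divr_gt0 y0 m0) ym.
  have h2 := le1 x x0; exfalso.
  have h3 : q^-1 * ln (y / m) < q^-1 * (y / m - 1) by rewrite ltr_pM2l.
  have h4 : p^-1 * ln (x / m) <= p^-1 * (x / m - 1) by rewrite ler_pM2l.
  by lra.
by move: xy; rewrite -(divfK (lt0r_neq0 m0) x) -(divfK (lt0r_neq0 m0) y) xm ym eqxx.
Qed.

Lemma powR_inv a p : 0 <= a -> a^-1 `^ p = (a `^ p)^-1.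
Proof. by move=> a0; rewrite -(powR_inv1 a0) -powRrM mulN1r powRN. Qed.

(* The parameters [s] and [t] are the p-th and q-th power norms in the proofs of
   Hoelder's inequality. *)
Lemma young_scaled a b p q s t : 0 <= a -> 0 <= b -> 0 < p -> 0 < q -> p^-1 + q^-1 = 1 ->
  0 < s -> 0 < t ->
  a * b <= s `^ p^-1 * t `^ q^-1 * (a `^ p / s / p + b `^ q / t / q).
Proof.
move=> a0 b0 p0 q0 pq s0 t0.
have S0 : 0 < s `^ p^-1 by rewrite powR_gt0.
have T0 : 0 < t `^ q^-1 by rewrite powR_gt0.
have h := conjugate_powR (divr_ge0 a0 (ltW S0)) (divr_ge0 b0 (ltW T0)) p0 q0 pq.
have -> : a `^ p / s = (a / s `^ p^-1) `^ p.
  rewrite powRM ?invr_ge0 ?(ltW S0)// powR_inv ?(ltW S0)// -powRrM mulVf ?gt_eqF//.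
  by rewrite powRr1// ltW.
have -> : b `^ q / t = (b / t `^ q^-1) `^ q.
  rewrite powRM ?invr_ge0 ?(ltW T0)// powR_inv ?(ltW T0)// -powRrM mulVf ?gt_eqF//.
  by rewrite powRr1// ltW.
rewrite -ler_pdivrMl ?mulr_gt0//; apply: le_trans h.
move: S0 T0; set S := s `^ _; set T := t `^ _ => S0 T0.
suff -> : (S * T)^-1 * (a * b) = a / S * (b / T) by [].
by field; rewrite !gt_eqF.
Qed.

Lemma hoelder_sum (I : finType) (u v : I -> R) p q :
  (forall i, 0 <= u i) -> (forall i, 0 <= v i) -> 0 < p -> 0 < q -> p^-1 + q^-1 = 1 ->
  \sum_i u i * v i <= (\sum_i u i `^ p) `^ p^-1 * (\sum_i v i `^ q) `^ q^-1.
Proof.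
move=> u0 v0 p0 q0 pq; set s := \sum_i u i `^ p; set t := \sum_i v i `^ q.
have s_ge0 : 0 <= s by apply: sumr_ge0 => i _; exact: powR_ge0.
have t_ge0 : 0 <= t by apply: sumr_ge0 => i _; exact: powR_ge0.
have [s0|sn0] := eqVneq s 0.
  rewrite big1 ?mulr_ge0 ?powR_ge0// => i _.
  have /eqP := psumr_eq0P (fun i _ => powR_ge0 (u i) p) s0 (i := i) isT.
  by rewrite powR_eq0 => /andP[/eqP -> _]; rewrite mul0r.
have [t0|tn0] := eqVneq t 0.
  rewrite big1 ?mulr_ge0 ?powR_ge0// => i _.
  have /eqP := psumr_eq0P (fun i _ => powR_ge0 (v i) q) t0 (i := i) isT.
  by rewrite powR_eq0 => /andP[/eqP -> _]; rewrite mulr0.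
have s0 : 0 < s by rewrite lt0r sn0.
have t0 : 0 < t by rewrite lt0r tn0.
apply: (@le_trans _ _ (\sum_i s `^ p^-1 * t `^ q^-1 * (u i `^ p / s / p + v i `^ q / t / q))).
  by apply: ler_sum => i _; exact: young_scaled.
rewrite -mulr_sumr big_split /= -!mulr_suml -/s -/t !divff// !mul1r pq mulr1.
exact: lexx.
Qed.

Lemma continuous_powR (T : topologicalType) (u : T -> R) r : 0 < r ->
  continuous u -> (forall x, 0 <= u x) -> continuous (fun x => u x `^ r).
Proof.
(* The exponential form of the power is available only where [u] is positive; at a zero, take [e] to
   the power [r^-1] as tolerance. *)
move=> r0 cu u0 x; have [ux0|uxn0] := eqVneq (u x) 0.
  apply/cvgrPdist_lt => e e0; rewrite ux0 powR0 ?gt_eqF//.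
  have e1 : 0 < e `^ r^-1 by rewrite powR_gt0.
  have /cvgrPdist_lt/(_ _ e1) := cu x.
  apply: filterS => y; rewrite ux0 !sub0r !normrN (ger0_norm (u0 y)) => uy.
  rewrite ger0_norm ?powR_ge0//.
  have -> : e = (e `^ r^-1) `^ r by rewrite -powRrM mulVf ?gt_eqF// powRr1// ltW.
  by apply: gt0_ltr_powR; rewrite ?nnegrE ?powR_ge0.
have ux : 0 < u x by rewrite lt0r uxn0 u0.
have nux : \forall y \near x, 0 < u y by apply: (cvgr_gt _ (cu x)).
have h : (fun y => expR (r * ln (u y))) @ x --> expR (r * ln (u x)).
  apply: (continuous_cvg _ (@continuous_expR R _)).
  apply: cvgM; first exact: cvg_cst.
  by apply: (continuous_cvg _ (continuous_ln ux)); exact: cu.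
rewrite /continuous_at {2}/powR gt_eqF//.
apply: cvg_trans h; apply: near_eq_cvg.
by near=> y; rewrite /powR gt_eqF//; near: y.
Unshelve. all: by end_near. Qed.

Lemma powRDn0 (x r s : R) : r + s != 0 -> x `^ r * x `^ s = x `^ (r + s).
Proof. by move=> /negbTE rs; rewrite powRD// rs. Qed.

Lemma ler_powR2 (r x y : R) : 0 <= r -> 0 <= x -> x <= y -> x `^ r <= y `^ r.
Proof.
by move=> r0 x0 xy; apply: ge0_ler_powR => //; rewrite nnegrE// (le_trans x0).
Qed.

End RealPowers.

Section HausdorffYoung.
Context {R : realType} {X : topologicalZmodType}.
Local Notation BX := (borel X).
Variable alpha : {measure set BX -> \bar R}.
Hypotheses (cX : compact [set: X]) (haar : is_haar alpha).

Local Notation C := R[i].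
Local Notation mass := (fine (alpha [set: BX])).
Local Notation mean := (haar_mean alpha).
Local Notation cmean := (cmean alpha).
Local Notation fcoef := (fourier_coef alpha).
Local Notation normc := (@ComplexField.Normc.normc R).
Local Notation Re := (@complex.Re R).

Lemma mean_hoelder (u v : X -> R) (p q : R) : continuous u -> continuous v ->
  (forall x, 0 <= u x) -> (forall x, 0 <= v x) -> 0 < p -> 0 < q -> p^-1 + q^-1 = 1 ->
  mean (fun x => u x * v x) <=
    mean (fun x => u x `^ p) `^ p^-1 * mean (fun x => v x `^ q) `^ q^-1.
Proof.
move=> cu cv u0 v0 p0 q0 pq.
have cup := continuous_powR p0 cu u0; have cvq := continuous_powR q0 cv v0.
have [s sE] : exists s, s = mean (fun x => u x `^ p) by eexists.
have [t tE] : exists t, t = mean (fun x => v x `^ q) by eexists.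
rewrite -sE -tE.
have s_ge0 : 0 <= s by rewrite sE; apply: mean_ge0 => // x; exact: powR_ge0.
have t_ge0 : 0 <= t by rewrite tE; apply: mean_ge0 => // x; exact: powR_ge0.
have zero (w : X -> R) r : 0 < r -> continuous (fun x => w x `^ r) ->
    mean (fun x => w x `^ r) = 0 -> forall x, w x = 0.
  move=> r0 cw w0 x; apply/eqP; apply: contra_eqT w0 => wx.
  apply/negbT/gt_eqF/(mean_gt0 cX haar (x := x) cw (fun y => powR_ge0 _ _)).
  by rewrite lt0r powR_ge0 andbT powR_eq0 (negbTE wx).
have [s0|sn0] := eqVneq s 0.
  rewrite (_ : (fun x => u x * v x) = fun=> 0) ?mean_cst ?mulr_ge0 ?powR_ge0//.
  by apply/funext => x; rewrite (zero _ _ p0 cup (etrans (esym sE) s0)) mul0r.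
have [t0|tn0] := eqVneq t 0.
  rewrite (_ : (fun x => u x * v x) = fun=> 0) ?mean_cst ?mulr_ge0 ?powR_ge0//.
  by apply/funext => x; rewrite (zero _ _ q0 cvq (etrans (esym tE) t0)) mulr0.
have s0 : 0 < s by rewrite lt0r sn0.
have t0 : 0 < t by rewrite lt0r tn0.
have := fun x => young_scaled (u0 x) (v0 x) p0 q0 pq s0 t0.
set k := s `^ p^-1 * t `^ q^-1; move: k => k young.
have c1 : continuous (fun x => k / (s * p) * u x `^ p) by exact: continuousZf.
have c2 : continuous (fun x => k / (t * q) * v x `^ q) by exact: continuousZf.
apply: (@le_trans _ _ (mean (fun x => k / (s * p) * u x `^ p + k / (t * q) * v x `^ q))).
  apply: ler_mean => //; [exact: continuousMf|exact: continuousDf|move=> x].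
  apply: le_trans (young x) _; suff -> : k * (u x `^ p / s / p + v x `^ q / t / q) =
    k / (s * p) * u x `^ p + k / (t * q) * v x `^ q by [].
  by field; rewrite !gt_eqF.
rewrite (meanD cX haar c1 c2) (meanZ cX haar _ cup) (meanZ cX haar _ cvq) -sE -tE.
suff -> : k / (s * p) * s + k / (t * q) * t = k * (p^-1 + q^-1) by rewrite pq mulr1.
by field; rewrite !gt_eqF.
Qed.

(** Monotonicity of power means, from Hoelder's inequality against the constant 1, whose mean is
    1. *)
Lemma mean_power_le (u : X -> R) (s q : R) : continuous u -> (forall x, 0 <= u x) ->
  0 < s -> s <= q -> mean (fun x => u x `^ s) <= mean (fun x => u x `^ q) `^ (s / q).
Proof.
move=> cu u0 s0; rewrite le_eqVlt => /orP[/eqP <-|sq].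
  rewrite divff ?gt_eqF// powRr1//.
  by apply: mean_ge0 => // x; exact: powR_ge0.
have q0 : 0 < q by apply: lt_trans sq.
have c1 : continuous ((fun=> 1) : X -> R) by move=> ?; exact: cvg_cst.
have qs : 0 < q / s by rewrite divr_gt0.
have d0 : 0 < q - s by rewrite subr_gt0.
have qs' : 0 < q / (q - s) by rewrite divr_gt0.
have conj : (q / s)^-1 + (q / (q - s))^-1 = 1 by field; rewrite !gt_eqF.
have := mean_hoelder (continuous_powR s0 cu u0) c1 (fun x => powR_ge0 _ _) (fun=> ler01) qs qs' conj.
rewrite (_ : (fun x => u x `^ s * 1) = fun x => u x `^ s); last first.
  by apply/funext => x; rewrite mulr1.
rewrite (_ : (fun x => (u x `^ s) `^ (q / s)) = fun x => u x `^ q); last first.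
  by apply/funext => x; rewrite -powRrM mulrCA divff ?mulr1// gt_eqF.
rewrite (_ : (fun x => 1 `^ _) = (fun=> 1)); last by apply/funext => x; rewrite powR1.
by rewrite mean_cst// powR1 mulr1 invf_div.
Qed.

(** Here [S] is the q-th power sum of coefficients tested against their own extremal element, so the
    bound involves [S] again. Raise to the power [q] and cancel [S ^ (q - 1)]. *)
Lemma duality_bound (S c K q : R) : 0 <= S -> 0 <= c -> 0 <= K -> 1 < q ->
  S <= c * (K * S `^ (q - 1)) `^ q^-1 -> S <= K * c `^ q.
Proof.
move=> S0 c0 K0 q1 h; have q0 : 0 < q by apply: lt_trans q1.
have [->|Sn0] := eqVneq S 0; first by rewrite mulr_ge0 ?powR_ge0.
have Sp : 0 < S by rewrite lt0r Sn0.
have h2 : S `^ q <= c `^ q * (K * S `^ (q - 1)).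
  have -> : c `^ q * (K * S `^ (q - 1)) = (c * (K * S `^ (q - 1)) `^ q^-1) `^ q.
    rewrite powRM ?powR_ge0// -powRrM mulVf ?gt_eqF// powRr1// mulr_ge0//.
    exact: powR_ge0.
  by apply: ge0_ler_powR; rewrite ?nnegrE ?mulr_ge0 ?powR_ge0 ?(ltW q0).
rewrite -(mulr_powRB1 S0 q0) mulrA ler_pM2r ?powR_gt0// in h2.
by rewrite mulrC.
Qed.

Variables (n : nat) (gam : 'I_n -> X -> C).
Hypotheses (gam_char : forall k, character (gam k)) (gam_inj : injective gam).
Implicit Types (a b : 'I_n -> C) (f g : X -> C).

Definition trig a x : C := \sum_k a k * gam k x.

Let cgam k : ccontinuous (gam k). Proof. exact: character_ccontinuous. Qed.

Lemma trig_ccontinuous a : ccontinuous (trig a).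
Proof. by apply: ccontinuous_sum => k; exact: ccontinuousZ. Qed.

Lemma fcoef_trig a k : fcoef (trig a) (gam k) = a k.
Proof.
rewrite /trig fcoef_sum//; last by move=> j; exact: ccontinuousZ.
rewrite (bigD1 k)//= big1 ?addr0; last first.
  move=> j jk; rewrite fcoefZ// fcoef_character// (inj_eq gam_inj).
  by rewrite (negbTE jk) mulr0.
by rewrite fcoefZ// fcoef_character// eqxx mulr1.
Qed.

Lemma cmean_trigJ f a : ccontinuous f ->
  cmean (fun x => f x * conjc (trig a x)) = \sum_k conjc (a k) * fcoef f (gam k).
Proof.
move=> cf; pose F k x : C := conjc (a k) * (f x * conjc (gam k x)).
have cfg k : ccontinuous (fun x => f x * conjc (gam k x)).
  by apply: ccontinuousM => //; exact: ccontinuousJ.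
transitivity (cmean (fun x => \sum_k F k x)).
  congr cmean; apply/funext => x; rewrite /trig rmorph_sum /= mulr_sumr.
  by apply: eq_bigr => k _; rewrite /F rmorphM /= mulrCA.
rewrite cmean_sum//; last by move=> k; exact: ccontinuousZ.
by apply: eq_bigr => k _; rewrite /F cmeanZ.
Qed.

Lemma mean_normc_sqr f : mean (fun x => normc (f x) ^+ 2) = Re (cmean (fun x => f x * conjc (f x))).
Proof.
rewrite /cmean /=; congr mean; apply/funext => x.
by rewrite mulc_conj.
Qed.

Lemma trig_parseval a : mean (fun x => normc (trig a x) ^+ 2) = \sum_k normc (a k) ^+ 2.
Proof.
rewrite mean_normc_sqr cmean_trigJ; last exact: trig_ccontinuous.
rewrite (eq_bigr (fun k => (normc (a k) ^+ 2)%:C%C)); last first.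
  by move=> k _; rewrite fcoef_trig mulrC mulc_conj.
by rewrite -rmorph_sum.
Qed.

Lemma bessel f : ccontinuous f ->
  \sum_k normc (fcoef f (gam k)) ^+ 2 <= mean (fun x => normc (f x) ^+ 2).
Proof.
move=> cf; pose d k := fcoef f (gam k); pose g := trig d.
have cg : ccontinuous g := trig_ccontinuous d.
have cfn := continuousXf (n := 2) (continuous_normc cf).
have cgn := continuousXf (n := 2) (continuous_normc cg).
have cfg : ccontinuous (fun x => f x * conjc (g x)) by apply: ccontinuousM => //; exact: ccontinuousJ.
have [cr _] := cfg.
have E : Re (cmean (fun x => f x * conjc (g x))) = \sum_k normc (d k) ^+ 2.
  rewrite cmean_trigJ// (eq_bigr (fun k => (normc (d k) ^+ 2)%:C%C)); last first.
    by move=> k _; rewrite mulrC mulc_conj.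
  by rewrite -rmorph_sum.
have : 0 <= mean (fun x => normc (f x - g x) ^+ 2).
  by apply: mean_ge0 => // x; exact: sqr_ge0.
have -> : (fun x => normc (f x - g x) ^+ 2) =
    (fun x => (normc (f x) ^+ 2 - 2 * Re (f x * conjc (g x))) + normc (g x) ^+ 2).
  apply/funext => x; rewrite !normc_sqr; case: (f x) (g x) => [? ?] [? ?] /=; ring.
have c2 := @continuousZf _ _ 2 _ cr.
have c3 := continuousBf cfn c2.
rewrite (meanD cX haar c3 cgn) (meanB cX haar cfn c2) (meanZ cX haar _ cr).
rewrite -[mean (fun x => Re _)]/(Re (cmean (fun x => f x * conjc (g x)))) E trig_parseval.
by rewrite -/d; lra.
Qed.

Definition psum (r : R) a := \sum_k normc (a k) `^ r.

Lemma psum_ge0 (r : R) a : 0 <= psum r a.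
Proof. by apply: sumr_ge0 => k _; exact: powR_ge0. Qed.

(** The q-th power of the inequality from [l^p] to [L^q] with [p = q / (q - 1)]: the exponent
    [q - 1] is [q / p], and the norm constant is the q-th root of [K]. *)
Definition trig_bound (q K : R) := forall a,
  mean (fun x => normc (trig a x) `^ q) <= K * psum (q / (q - 1)) a `^ (q - 1).

Lemma trigZ (r : R) a x : trig (fun k => r%:C%C * a k) x = r%:C%C * trig a x.
Proof. by rewrite /trig mulr_sumr; apply: eq_bigr => k _; rewrite mulrA. Qed.

Lemma normc_trig a x : normc (trig a x) <= \sum_k normc (a k).
Proof.
rewrite /trig; elim/big_ind2 : _ => [|z1 z2 t1 t2 h1 h2|k _].
- by rewrite ComplexField.Normc.normc0.
- by apply: le_trans (le_normcD _ _) _; exact: lerD.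
- by rewrite ComplexField.Normc.normcM (character_norm x (gam_char k)) mulr1.
Qed.

Lemma conj_exponent (q : R) : 1 < q -> 0 < q / (q - 1) /\ (q / (q - 1))^-1 + q^-1 = 1.
Proof.
move=> q1; have q0 : 0 < q by apply: lt_trans q1.
have d0 : 0 < q - 1 by rewrite subr_gt0.
by split; [rewrite divr_gt0|field; rewrite !gt_eqF].
Qed.

(** The bound is independent of [q], as needed for an iteration that sends [q] to [2 * q - 2] at
    each step. *)
Lemma trig_bound_card (q : R) : 1 < q -> trig_bound q n%:R.
Proof.
move=> q1 a; have [p0 pq] := conj_exponent q1; have q0 : 0 < q by apply: lt_trans q1.
set p := q / (q - 1) in p0 pq *.
have cn := continuous_normc (trig_ccontinuous a).
rewrite -[leRHS](mean_cst haar); apply: ler_mean => //.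
- by apply: continuous_powR => // x; exact: normc_ge0.
- by move=> ?; exact: cvg_cst.
move=> x; have := hoelder_sum (fun k => normc_ge0 (a k)) (fun=> ler01) p0 q0 pq.
under eq_bigr do rewrite mulr1.
under [X in _ * X `^ _]eq_bigr do rewrite powR1.
rewrite sumr_const card_ord -/(psum p a) => h.
have h2 := le_trans (normc_trig a x) h.
have -> : n%:R * psum p a `^ (q - 1) = (psum p a `^ p^-1 * n%:R `^ q^-1) `^ q.
  rewrite powRM ?powR_ge0// -!powRrM mulVf ?gt_eqF// powRr1// mulrC; congr (_ `^ _ * _).
  by rewrite /p; field; rewrite !gt_eqF// subr_gt0.
by apply: ge0_ler_powR; rewrite ?nnegrE ?normc_ge0 ?mulr_ge0 ?powR_ge0 ?(ltW q0).
Qed.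

(* Complex coefficients as a real row vector, whose compact sets are available. *)
Definition coords (v : 'rV[R]_(n + n)) (k : 'I_n) : C :=
  Complex (v ord0 (lshift n k)) (v ord0 (rshift n k)).

Lemma coordsK a : exists v, coords v = a.
Proof.
exists (row_mx (\row_k Re (a k)) (\row_k complex.Im (a k))).
apply/funext => k; rewrite /coords row_mxEl row_mxEr !mxE.
by case: (a k).
Qed.

Lemma coords_ccontinuous k : ccontinuous (fun v => coords v k).
Proof. by split=> v; exact: coord_continuous. Qed.

Lemma psum_continuous (r : R) : 0 < r -> continuous (fun v => psum r (coords v)).
Proof.
move=> r0; apply: continuous_sumf => k; apply: continuous_powR => //.
  exact/continuous_normc/coords_ccontinuous.
by move=> v; exact: normc_ge0.
Qed.

Lemma mean_trig_continuous (q : R) : 0 < q ->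
  continuous (fun v => mean (fun x => normc (trig (coords v) x) `^ q)).
Proof.
move=> q0; pose F (z : 'rV[R]_(n + n) * X) := normc (trig (coords z.1) z.2) `^ q.
apply: (mean_continuous cX haar (F := F)); apply: continuous_powR => //; last first.
  by move=> z; exact: normc_ge0.
apply: continuous_normc; apply: ccontinuous_sum => k; apply: ccontinuousM.
  have [c1 c2] := coords_ccontinuous k.
  by split=> z; [apply: (@continuous_comp _ _ _ fst (fun v => Re (coords v k)))
    |apply: (@continuous_comp _ _ _ fst (fun v => complex.Im (coords v k)))];
    (try exact: cvg_fst); [exact: c1|exact: c2].
have [c1 c2] := cgam k.
by split=> z; [apply: (@continuous_comp _ _ _ snd (fun x => Re (gam k x)))
  |apply: (@continuous_comp _ _ _ snd (fun x => complex.Im (gam k x)))];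
  (try exact: cvg_snd); [exact: c1|exact: c2].
Qed.

Lemma psum_sphere_compact (p : R) : 0 < p -> compact [set v | psum p (coords v) = 1].
Proof.
move=> p0; pose B := [set v : 'rV[R]_(n + n) | forall i, `[(-1 : R), 1]%classic (v ord0 i)].
apply: (@subclosed_compact _ _ B).
- apply: (@closed_comp _ _ (fun v => psum p (coords v)) [set x | x = 1]).
    by move=> v _; exact: psum_continuous.
  exact: closed_eq.
- by apply: (@rV_compact R (n + n) (fun=> `[(-1 : R), 1]%classic)) => i; exact: segment_compact.
move=> v /= v1 i.
have le1 k : normc (coords v k) <= 1.
  have h : normc (coords v k) `^ p <= 1.
    rewrite -v1 /psum (bigD1 k)//= lerDl sumr_ge0// => j _; exact: powR_ge0.
  rewrite leNgt; apply/negP => h1; move: h; apply/negP; rewrite -ltNge.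
  have -> : 1 = 1 `^ p :> R by rewrite powR1.
  by apply: gt0_ltr_powR; rewrite ?nnegrE ?normc_ge0.
have sq1 k : normc (coords v k) ^+ 2 <= 1.
  by rewrite -(expr1n _ 2) ler_pXn2r ?nnegrE ?normc_ge0.
suff h : -1 <= v ord0 i <= 1 by rewrite /B /= in_itv.
rewrite -ler_norml -(ler_pXn2r (n := 2))// ?nnegrE// expr1n real_normK ?num_real//.
case: (split_ordP i) => k ->; apply: le_trans (sq1 k);
  by rewrite normc_sqr /= ?lerDl ?lerDr sqr_ge0.
Qed.

(** The unit sphere of coefficients is compact, and by homogeneity a maximum there is the best
    constant for all coefficients. *)
Lemma ex_trig_max (q : R) : (0 < n)%N -> 1 < q ->
  exists2 a, psum (q / (q - 1)) a = 1 &
    trig_bound q (mean (fun x => normc (trig a x) `^ q)).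
Proof.
move=> n0 q1; have [p0 pq] := conj_exponent q1; have q0 : 0 < q by apply: lt_trans q1.
set p := q / (q - 1) in p0 pq *.
have pE : p^-1 * q = q - 1 by rewrite /p; field; rewrite !gt_eqF// subr_gt0.
pose K := [set v | psum p (coords v) = 1].
have K0 : K !=set0.
  pose k0 := Ordinal n0; pose e k : C := if k == k0 then 1 else 0.
  have e1 : e k0 = 1 by rewrite /e eqxx.
  have [v vE] := coordsK e.
  exists v; rewrite /K /mkset vE /psum (bigD1 k0)// e1 ComplexField.Normc.normc1 powR1.
  rewrite big1 => [|k kk0]; first by rewrite /= addr0.
  by rewrite /e (negbTE kk0) ComplexField.Normc.normc0 powR0// gt_eqF.
have [v vK vmax] := compact_EVT_max K0 (psum_sphere_compact p0)
  (continuous_subspaceT (mean_trig_continuous q0)).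
exists (coords v); first by move: vK; rewrite inE.
set M := mean _; move=> a; have [N0|Nn0] := eqVneq (psum p a) 0.
  have a0 k : a k = 0.
    apply: ComplexField.Normc.eq0_normc; apply: (powR_eq0_eq0 (p := p)).
    exact: (psumr_eq0P (fun i _ => powR_ge0 _ _) N0).
  rewrite N0 powR0 ?mulr0; last by rewrite gt_eqF// subr_gt0.
  rewrite (_ : (fun x => _) = fun=> 0) ?mean_cst//.
  apply/funext => x; rewrite /trig big1 ?ComplexField.Normc.normc0 ?powR0 ?gt_eqF//.
  by move=> k _; rewrite a0 mul0r.
have Np : 0 < psum p a by rewrite lt0r Nn0 psum_ge0.
pose r := (psum p a `^ p^-1)^-1.
have r0 : 0 < r by rewrite invr_gt0 powR_gt0.
have [w wE] := coordsK (fun k => r%:C%C * a k).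
have wK : w \in K.
  rewrite inE /K /= wE /psum.
  under eq_bigr do rewrite ComplexField.Normc.normcM normc_real ?(ltW r0)//
    powRM ?(ltW r0) ?normc_ge0//.
  rewrite -mulr_sumr -/(psum p a) /r powR_inv ?powR_ge0// -powRrM mulVf ?gt_eqF//.
  by rewrite powRr1 ?(ltW Np)// mulVf.
have := vmax _ wK; rewrite wE.
have cn := continuous_powR q0 (continuous_normc (trig_ccontinuous a)) (fun x => normc_ge0 _).
rewrite (_ : (fun x => normc (trig (fun k => r%:C%C * a k) x) `^ q) =
    fun x => r `^ q * normc (trig a x) `^ q); last first.
  apply/funext => x; rewrite trigZ ComplexField.Normc.normcM normc_real ?(ltW r0)//.
  by rewrite powRM ?(ltW r0) ?normc_ge0.
rewrite (meanZ cX haar _ cn) -/M /r powR_inv ?powR_ge0// -powRrM pE.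
by rewrite mulrC ler_pdivrMr ?powR_gt0.
Qed.

(* The extremal element in the duality between [l^q] and [l^(q / (q - 1))]. *)
Definition dual_coef (q : R) (d : 'I_n -> C) k : C := (normc (d k) `^ (q - 2))%:C%C * d k.

Lemma normc_dual (q : R) (z : C) : 2 <= q ->
  normc ((normc z `^ (q - 2))%:C%C * z) = normc z `^ (q - 1).
Proof.
move=> q2; rewrite ComplexField.Normc.normcM normc_real ?powR_ge0// mulrC.
have -> : q - 2 = q - 1 - 1 by ring.
by rewrite mulr_powRB1 ?normc_ge0//; lra.
Qed.

Lemma normc_powRD (q : R) (z : C) : 2 <= q -> normc z `^ (q - 2) * normc z ^+ 2 = normc z `^ q.
Proof.
move=> q2; rewrite -powR_mulrn ?normc_ge0// powRDn0 ?subrK//.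
by rewrite gt_eqF//; lra.
Qed.

Lemma Re_dual (q : R) (z : C) : 2 <= q ->
  Re (conjc ((normc z `^ (q - 2))%:C%C * z) * z) = normc z `^ q.
Proof.
move=> /(normc_powRD z) <-; rewrite normc_sqr; move: (_ `^ _) => r.
by case: z => a b /=; ring.
Qed.

Lemma psum_dual (q : R) (d : 'I_n -> C) : 2 <= q ->
  psum (q / (q - 1)) (dual_coef q d) = psum q d.
Proof.
move=> q2; apply: eq_bigr => k _; rewrite normc_dual// -powRrM.
by congr (_ `^ _); field; rewrite gt_eqF//; lra.
Qed.

Lemma psum_interpolation (q : R) a : 2 < q -> psum (q / (q - 1)) a = 1 ->
  psum ((2 * q - 2) / (2 * q - 2 - 1)) a `^ (2 * q - 2 - 1) <= psum (2 / (q - 1)) a.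
Proof.
move=> q2 a1; (* Hoelder with exponents [w] and [w / (w - 1)], putting the weight
   [q / (q - 1)], whose sum is 1, on the second factor. *)
have [w wE] : exists w, w = 2 * q - 2 - 1 by eexists.
have w0 : 0 < w by lra.
have w1 : 0 < w - 1 by lra.
have q10 : 0 < q - 1 by lra.
have wn0 := lt0r_neq0 w0; have w1n0 := lt0r_neq0 w1; have q1n0 := lt0r_neq0 q10.
have w'0 : 0 < w / (w - 1) by rewrite divr_gt0.
have conj : w^-1 + (w / (w - 1))^-1 = 1 by field; rewrite wn0 w1n0.
pose u (k : 'I_n) := normc (a k) `^ (2 / (q - 1) / w).
pose v (k : 'I_n) := normc (a k) `^ (q / (q - 1) * ((w - 1) / w)).
have := hoelder_sum (u := u) (v := v) (fun k => powR_ge0 _ _) (fun k => powR_ge0 _ _) w0 w'0 conj.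
rewrite -wE.
have -> : \sum_k u k * v k = psum ((2 * q - 2) / w) a.
  have e1 : 2 / (q - 1) / w + q / (q - 1) * ((w - 1) / w) = (2 * q - 2) / w.
    have -> : 2 / (q - 1) / w + q / (q - 1) * ((w - 1) / w) = (2 + q * (w - 1)) / (q - 1) / w.
      by field; rewrite wn0 q1n0.
    by congr (_ / _); apply: (canLR (mulfK q1n0)); rewrite wE; ring.
  by apply: eq_bigr => k _; rewrite powRDn0 e1// gt_eqF// divr_gt0//; lra.
rewrite [X in X `^ w^-1](_ : _ = psum (2 / (q - 1)) a); last first.
  by apply: eq_bigr => k _; rewrite -powRrM divfK.
rewrite [X in _ * X `^ _](_ : _ = 1); last first.
  rewrite -[RHS]a1; apply: eq_bigr => k _; rewrite -powRrM; congr (_ `^ _).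
  by field; rewrite wn0 w1n0 q1n0.
rewrite powR1 mulr1 => h.
have -> : psum (2 / (q - 1)) a = (psum (2 / (q - 1)) a `^ w^-1) `^ w.
  by rewrite -powRrM mulVf// powRr1// psum_ge0.
by apply: ge0_ler_powR; rewrite ?nnegrE ?psum_ge0 ?powR_ge0 ?(ltW w0).
Qed.

(* The coefficients [d] of [|g| ^ (q - 2) * g] have [l^q] norm at most [K] by duality,
   while [K <= \sum_k |a k| |d k|]: equality holds throughout and determines [|d k|]. *)
Lemma trig_extremal (q : R) a : 2 < q -> psum (q / (q - 1)) a = 1 ->
  let K := mean (fun x => normc (trig a x) `^ q) in 0 < K -> trig_bound q K ->
  K ^+ 2 * psum (2 / (q - 1)) a <= mean (fun x => normc (trig a x) `^ (2 * q - 2)).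
Proof.
move=> q2 a1 K K0 aK; have q1 : 1 < q by lra.
have q0 : 0 < q by lra.
have q10 : 0 < q - 1 by lra.
have [p0 pq] := conj_exponent q1; set p := q / (q - 1) in p0 pq a1 *.
have q2' := ltW q2.
pose g := trig a; have cg : ccontinuous g := trig_ccontinuous a.
have cng := continuous_normc cg.
pose h x : C := (normc (g x) `^ (q - 2))%:C%C * g x.
have ch : ccontinuous h.
  apply: ccontinuousM => //; apply: ccontinuous_real; apply: continuous_powR => //.
    by rewrite subr_gt0.
  by move=> x; exact: normc_ge0.
have nh x : normc (h x) = normc (g x) `^ (q - 1) by exact: normc_dual.
have cnh := continuous_normc ch.
pose d k := fcoef h (gam k).
have E b : Re (cmean (fun x => h x * conjc (trig b x))) = \sum_k Re (conjc (b k) * d k).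
  by rewrite cmean_trigJ// raddf_sum.
have Sle : psum q d <= K `^ q.
  pose b := dual_coef q d; have cb := trig_ccontinuous b; have cnb := continuous_normc cb.
  have -> : K `^ q = K * (K `^ p^-1) `^ q.
    rewrite -powRrM -[X in _ = X * _](powRr1 (ltW K0)) powRDn0.
      by congr (_ `^ _); rewrite /p; field; rewrite !gt_eqF.
    by rewrite gt_eqF// addr_gt0// mulr_gt0// invr_gt0.
  apply: duality_bound => //; [exact: psum_ge0|exact: powR_ge0|exact: ltW|].
  rewrite [leLHS](_ : _ = Re (cmean (fun x => h x * conjc (trig b x)))); last first.
    by rewrite E; apply: eq_bigr => k _; rewrite Re_dual.
  have [cr _] : ccontinuous (fun x => h x * conjc (trig b x)).
    by apply: ccontinuousM => //; exact: ccontinuousJ.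
  apply: (@le_trans _ _ (mean (fun x => normc (h x) * normc (trig b x)))).
    apply: ler_mean => //; first exact: continuousMf.
    move=> x; apply: le_trans (ler_Re_normc _) _.
    by rewrite ComplexField.Normc.normcM normc_conj.
  apply: le_trans (mean_hoelder cnh cnb (fun x => normc_ge0 _) (fun x => normc_ge0 _) p0 q0 pq) _.
  have -> : (fun x => normc (h x) `^ p) = (fun x => normc (g x) `^ q).
    apply/funext => x; rewrite nh -powRrM; congr (_ `^ _).
    by rewrite /p; field; rewrite gt_eqF.
  rewrite -/K ler_wpM2l ?powR_ge0//.
  apply: ler_powR2; [by rewrite invr_ge0 ltW|by apply: mean_ge0 => // x; exact: powR_ge0|].
  by apply: le_trans (aK b) _; rewrite psum_dual.
have Kle : K <= \sum_k normc (a k) * normc (d k).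
  have -> : K = Re (cmean (fun x => h x * conjc (trig a x))).
    rewrite /cmean /=; congr mean; apply/funext => x; rewrite /h -mulrA mulc_conj.
    by rewrite -rmorphM normc_powRD.
  rewrite E; apply: ler_sum => k _; apply: le_trans (ler_Re_normc _) _.
  by rewrite ComplexField.Normc.normcM normc_conj.
pose D k := normc (d k) / K.
have D0 k : 0 <= D k by rewrite divr_ge0 ?normc_ge0 ?ltW.
(* [G k] is the defect in Young's inequality. The defects are nonnegative and, by [Sle] and [Kle],
   have sum at most 0, so each of them vanishes. *)
pose G k := normc (a k) `^ p / p + D k `^ q / q - normc (a k) * D k.
have G0 k : 0 <= G k.
  by rewrite subr_ge0; apply: conjugate_powR => //; exact: normc_ge0.
have Gs : \sum_k G k = 0.
  apply/eqP; rewrite eq_le sumr_ge0 ?andbT//.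
  rewrite big_split /= sumrN big_split /= -!mulr_suml.
  rewrite -[X in X / p]/(psum p a) a1.
  have h1 : \sum_k D k `^ q <= 1.
    rewrite (eq_bigr (fun k => normc (d k) `^ q * (K `^ q)^-1)); last first.
      by move=> k _; rewrite powRM ?normc_ge0 ?invr_ge0 ?(ltW K0)// powR_inv// ltW.
    by rewrite -mulr_suml ler_pdivrMr ?powR_gt0// mul1r.
  have h2 : 1 <= \sum_k normc (a k) * D k.
    rewrite (eq_bigr (fun k => normc (a k) * normc (d k) / K)); last first.
      by move=> k _; rewrite mulrA.
    by rewrite -mulr_suml ler_pdivlMr// mul1r.
  have h3 : (\sum_k D k `^ q) / q <= q^-1 by rewrite ler_pdivrMr// mulVf// gt_eqF.
  by rewrite mul1r; lra.
have DE k : normc (d k) ^+ 2 = K ^+ 2 * normc (a k) `^ (2 / (q - 1)).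
  have := psumr_eq0P (fun i _ => G0 i) Gs (i := k) isT.
  move=> /eqP; rewrite subr_eq0 => /eqP/esym.
  move=> /(young_eq (normc_ge0 _) (D0 k) p0 q0 pq) AD.
  have -> : normc (d k) = K * D k by rewrite /D mulrC divfK// gt_eqF.
  rewrite exprMn; congr (_ * _).
  have -> : D k = (D k `^ q) `^ q^-1 by rewrite -powRrM divff ?gt_eqF// powRr1.
  rewrite -AD -powR_mulrn ?powR_ge0// -!powRrM; congr (_ `^ _).
  by rewrite /p; field; rewrite !gt_eqF.
(* By [DE] the left side is the sum of the [|d k| ^ 2], which Bessel bounds by the mean of
   [|h| ^ 2]; as [|h| = |g| ^ (q - 1)], the exponent [2 * q - 2] appears. *)
rewrite /psum mulr_sumr; under eq_bigr do rewrite -DE.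
apply: le_trans (bessel ch) _.
rewrite (_ : (fun x => normc (h x) ^+ 2) = fun x => normc (trig a x) `^ (2 * q - 2)).
  exact: lexx.
apply/funext => x; rewrite nh -powR_mulrn ?powR_ge0// -powRrM.
by congr (_ `^ _); ring.
Qed.

Lemma trig_boundW (q K K' : R) : K <= K' -> trig_bound q K -> trig_bound q K'.
Proof.
by move=> KK' bK a; apply: le_trans (bK a) _; rewrite ler_wpM2r// powR_ge0.
Qed.

(** At a maximiser, [trig_extremal] puts [K ^ 2 * s] below the mean at exponent [2 * q - 2], and
    [bK1] with [psum_interpolation] puts that mean below [K1 * s]; cancel [s]. *)
Lemma trig_bound_step (q K1 : R) : (0 < n)%N -> 2 < q -> 0 <= K1 ->
  trig_bound (2 * q - 2) K1 -> trig_bound q (Num.sqrt K1).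
Proof.
move=> n0 q2 K10 bK1; have q1 : 1 < q by lra.
have [a a1 aK] := ex_trig_max n0 q1.
set K := mean _ in aK; have [p0 pq] := conj_exponent q1; have q10 : 0 < q - 1 by lra.
apply: (trig_boundW _ aK).
have K_ge0 : 0 <= K by apply: mean_ge0 => // x; exact: powR_ge0.
have [->|Kn0] := eqVneq K 0; first exact: sqrtr_ge0.
have K0 : 0 < K by rewrite lt0r Kn0.
have h := trig_extremal q2 a1 K0 aK.
set s := psum (2 / (q - 1)) a in h.
have s0 : 0 < s.
  rewrite lt0r psum_ge0 andbT; apply/eqP => s0; move: a1.
  rewrite /psum big1 => [/eqP|k _]; first by rewrite eq_sym oner_eq0.
  rewrite (_ : normc (a k) = 0) ?powR0 ?gt_eqF//; apply: (powR_eq0_eq0 (p := 2 / (q - 1))).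
  exact: (psumr_eq0P (fun i _ => powR_ge0 _ _) s0).
suff K2 : K ^+ 2 <= K1 by rewrite -(ger0_norm K_ge0) -sqrtr_sqr ler_wsqrtr.
rewrite -(ler_pM2r s0); apply: le_trans h _; apply: le_trans (bK1 a) _.
by rewrite ler_wpM2l// psum_interpolation.
Qed.

Lemma trig_bound_one (q : R) : 2 <= q -> trig_bound q 1.
Proof.
have [n0 q2|n0] := posnP n.
  apply: (@trig_boundW _ n%:R); first by rewrite n0 ler01.
  by apply: trig_bound_card; lra.
rewrite le_eqVlt => /orP[/eqP <- a|q2].
  have -> : 2 - 1 = 1 :> R by ring.
  rewrite divr1 powRr1 ?psum_ge0// mul1r.
  under [X in haar_mean _ X]funext => x do rewrite powR_mulrn ?normc_ge0//.
  rewrite trig_parseval /psum; under [leRHS]eq_bigr do rewrite powR_mulrn ?normc_ge0//.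
  exact: lexx.
(* Since [sqrt (1 + x) <= 1 + x / 2], each step halves the excess over 1. The exponent is quantified
   inside the induction because it changes at every step. *)
have step j : forall r, 2 < r -> trig_bound r (1 + n%:R / 2 ^+ j).
  elim: j => [|j IH] r r2.
    apply: (@trig_boundW _ n%:R); first by rewrite expr0 divr1 lerDr.
    by apply: trig_bound_card; lra.
  have x0 : 0 <= n%:R / 2 ^+ j :> R by rewrite divr_ge0// exprn_ge0.
  have r2' : 2 < 2 * r - 2 by lra.
  apply: trig_boundW (trig_bound_step n0 r2 _ (IH _ r2')); last by rewrite addr_ge0.
  rewrite exprS invfM mulrCA; move: x0; set x := _ / _ => x0.
  have y0 : 0 <= 1 + 2^-1 * x by rewrite addr_ge0// mulr_ge0.
  rewrite -(ger0_norm y0) -sqrtr_sqr ler_wsqrtr//.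
  have := sqr_ge0 x; lra.
move=> a; set M := mean _; set P := _ `^ _; rewrite mul1r.
have P0 : 0 <= P by exact: powR_ge0.
apply/ler_addgt0Pr => e e0; have nP0 : 0 <= n%:R * P / e.
  by rewrite divr_ge0 ?mulr_ge0 ?(ltW e0).
have := archi_boundP nP0; set j := Num.bound _ => hj.
apply: le_trans (step j q q2 a) _; rewrite -/P mulrDl mul1r lerD2l mulrAC.
rewrite ler_pdivrMr ?exprn_gt0// -ler_pdivrMl// mulrC.
by apply: le_trans (ltW hj) _; rewrite -natrX ler_nat ltnW// ltn_expl.
Qed.

End HausdorffYoung.

(** * The region R1 *)

Section FourierUpperBound.
Context {R : realType} {X : topologicalZmodType}.
Local Notation BX := (borel X).
Variable alpha : {measure set BX -> \bar R}.
Hypotheses (cX : compact [set: X]) (haar : is_haar alpha).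

Local Notation C := R[i].
Local Notation mass := (fine (alpha [set: BX])).
Local Notation mean := (haar_mean alpha).
Local Notation normc := (@ComplexField.Normc.normc R).
Local Notation Re := (@complex.Re R).

Section UnitBall.
Variables (f : X -> C) (p : \bar R).
Hypotheses (p0 : (0 < p)%E) (if_ : cintegrable alpha f) (f1 : cLnorm alpha p f = 1%E).

Let mf : measurable_fun [set: BX] (fun x => normc (f x)).
Proof. by apply: cmeasurable_normc; case: if_. Qed.

(** Hoelder with the exponent [s] conjugate to [p], which is at most [q]; power means then pass from
    [s] to [q]. The mass enters to the power [1 / s = 1 - recip p]. At [p = +oo], [f] is almost
    everywhere at most 1 in modulus and [s] is 1. *)
Lemma integral_normc_le (g : X -> C) (q : R) : ccontinuous g -> 0 < q ->
  recip p + q^-1 <= 1 ->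
  (\int[alpha]_x (normc (f x) * normc (g x))%:E <=
    (mass `^ (1 - recip p) * mean (fun x => (normc (g x) `^ q)%R) `^ q^-1)%:E)%E.
Proof.
move=> cg q0; have m0 := mass_gt0 haar.
have cng := continuous_normc cg; have mg := continuous_borel cng.
have g0 x : 0 <= normc (g x) := normc_ge0 (g x).
case: p p0 f1 => [r| |//] r0; rewrite /cLnorm /= => fr pq; last first.
  have f_ae : \forall x \ae alpha, (normc (f x) <= 1).
    have := ess_sup_ge alpha (fun x => `|(normc (f x))%:E|%E).
    move: fr; rewrite unlock; case: haar => -> _ _ _ _ /= -> /=.
    by apply: filterS => x; rewrite lee_fin ger0_norm ?normc_ge0.
  apply: (@le_trans _ _ (\int[alpha]_x (normc (g x))%:E)%E).
    apply: ae_ge0_le_integral => //.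
    - by move=> x _; rewrite lee_fin mulr_ge0 ?normc_ge0.
    - by apply/measurable_EFinP; exact: measurable_funM.
    - by move=> x _; rewrite lee_fin normc_ge0.
    - exact/measurable_EFinP.
    apply: filterS f_ae; first exact: (ae_filter_ringOfSetsType alpha).
    move=> x fx _; rewrite lee_fin.
    by rewrite ler_piMl ?normc_ge0.
  rewrite (integral_mean cX haar)// lee_fin subr0 powRr1 ?(ltW m0)//.
  rewrite ler_wpM2l ?(ltW m0)//.
  have q1 : 1 <= q by move: pq; rewrite add0r invf_le1.
  have := mean_power_le cX haar cng g0 ltr01 q1.
  under [X in haar_mean _ X <= _]funext => x do rewrite powRr1 ?normc_ge0//.
  by rewrite div1r.
rewrite lte_fin in r0.
have iq0 : 0 < q^-1 by rewrite invr_gt0.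
have r1 : 0 < 1 - r^-1 by lra.
have [s sE] : exists s, s^-1 = 1 - r^-1 by exists (1 - r^-1)^-1; rewrite invrK.
have s0 : 0 < s by rewrite -invr_gt0 sE.
have sq : s <= q by rewrite -lef_pV2 ?posrE// sE; lra.
have rs : r^-1 + s^-1 = 1 by rewrite sE; ring.
have := hoelder alpha mf mg r0 s0 rs.
rewrite Lnorm1 [X in (_ <= X * _)%E -> _]fr mul1e.
under eq_integral do rewrite /= ger0_norm ?mulr_ge0 ?normc_ge0//.
move=> h; apply: le_trans h _; rewrite unlock /=.
under eq_integral do rewrite ger0_norm ?normc_ge0//.
have cgs := continuous_powR s0 cng g0.
have M0 : 0 <= mean (fun x => normc (g x) `^ s).
  by apply: mean_ge0 => // x; exact: powR_ge0.
rewrite (integral_mean cX haar cgs) poweR_EFin lee_fin (powRM _ (ltW m0) M0).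
rewrite -sE; apply: ler_wpM2l; first exact: powR_ge0.
have -> : q^-1 = (s / q) * s^-1 by rewrite mulrAC divff ?mul1r// gt_eqF.
rewrite powRrM; apply: ler_powR2; [by rewrite invr_ge0 ltW|exact: M0|].
exact: (mean_power_le cX haar cng g0 s0 sq).
Qed.

(** The sum is the integral of [f] against the conjugate of the trigonometric polynomial with
    coefficients [dual_coef q F]. That polynomial is controlled by [trig_bound_one], and
    [duality_bound] with [K = 1] concludes. *)
Lemma psum_fourier_le (q : R) n (gam : 'I_n -> X -> C) :
  (forall k, character (gam k)) -> injective gam -> 2 <= q -> recip p + q^-1 <= 1 ->
  psum q (fun k => fourier alpha f (gam k)) <= mass `^ ((1 - recip p) * q).
Proof.
move=> cgam igam q2 pq; have m0 := mass_gt0 haar; have q0 : 0 < q by lra.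
pose F k := fourier alpha f (gam k); pose b := dual_coef q F.
have cb : ccontinuous (trig gam b) := trig_ccontinuous cgam b.
have ifk k := fourier_cintegrable if_ (cgam k).
pose u k x : R := Re (conjc (b k) * (f x * conjc (gam k x))).
have iu k : alpha.-integrable [set: BX] (EFin \o u k).
  apply: cintegrable_Re; rewrite (_ : (fun x => _) = fun x => (f x * conjc (gam k x)) * conjc (b k)).
    apply: (cintegrableM_bounded (ifk k) (M := normc (b k))) => [|x].
      by apply: ccontinuous_cmeasurable; exact: ccontinuous_cst.
    by rewrite normc_conj.
  by apply/funext => x; rewrite mulrC.
have E : psum q F = Rintegral alpha [set: BX] (fun x => \sum_k u k x).
  transitivity (\sum_k Rintegral alpha [set: BX] (u k)).
    by apply: eq_bigr => k _; rewrite -Re_cintegralZ// -[cintegral _ _]/(F k) Re_dual.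
  rewrite /psum; elim: (index_enum _) => [|k r IH].
    rewrite big_nil; under eq_Rintegral do rewrite big_nil.
    by rewrite Rintegral_cst// mul0r.
  rewrite big_cons IH -RintegralD//; [|exact: iu|]; last first.
    rewrite (_ : _ \o _ = fun x => (\sum_(j <- r) (u j x)%:E)%E).
      by apply: integrable_sum => // j _; exact: iu.
    by apply/funext => x /=; rewrite sumEFin.
  by apply: eq_Rintegral => x _; rewrite big_cons.
pose M x := normc (f x) * normc (trig gam b x).
have cnb := continuous_normc cb.
have I0 : (0 <= \int[alpha]_x (M x)%:E)%E.
  by apply: integral_ge0 => x _; rewrite lee_fin mulr_ge0 ?normc_ge0.
have IM := integral_normc_le cb q0 pq; rewrite -/(M _) in IM.
have If : (\int[alpha]_x (M x)%:E)%E \is a fin_num.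
  by rewrite ge0_fin_numE//; apply: le_lt_trans IM (ltry _).
have iM : alpha.-integrable [set: BX] (EFin \o M).
  apply/integrableP; split.
    by apply/measurable_EFinP; apply: measurable_funM => //; exact: continuous_borel.
  under eq_integral do rewrite /= ger0_norm ?mulr_ge0 ?normc_ge0//.
  by rewrite -ge0_fin_numE.
rewrite -/F -[leRHS]mul1r powRrM.
apply: duality_bound; [exact: psum_ge0|exact: powR_ge0|exact: ler01|lra|].
apply: (@le_trans _ _ (fine (\int[alpha]_x (M x)%:E))).
  rewrite E; apply: le_Rintegral => //.
    rewrite (_ : _ \o _ = fun x => (\sum_j (u j x)%:E)%E).
      by apply: integrable_sum => // j _; exact: iu.
    by apply/funext => x /=; rewrite sumEFin.
  move=> x _; rewrite /M -(normc_conj (trig gam b x)) -ComplexField.Normc.normcM.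
  apply: le_trans (ler_Re_normc _); rewrite /trig rmorph_sum mulr_sumr raddf_sum /=.
  by apply: ler_sum => k _; rewrite /u mulrCA -rmorphM lexx.
move: IM; rewrite -{1}(fineK If) lee_fin => IM; apply: le_trans IM _.
rewrite ler_wpM2l ?powR_ge0//; apply: ler_powR2; first by rewrite invr_ge0 ltW.
  by apply: mean_ge0 => // x; exact: powR_ge0.
apply: le_trans (trig_bound_one cX haar cgam igam q2 b) _.
by rewrite psum_dual.
Qed.

Lemma normc_fourier_unit g : character g -> recip p <= 1 ->
  normc (fourier alpha f g) <= mass `^ (1 - recip p).
Proof.
(* At [recip p = 1] the conjugate exponent is infinite and the L1 bound is used; otherwise Hoelder
   is applied against the constant 1. *)
move=> cg; rewrite le_eqVlt => /orP[/eqP p1|p1].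
  have pE : p = 1%E.
    case: p p0 p1 => [r| |//] _ /=; last by move/eqP; rewrite eq_sym oner_eq0.
    by move=> r1; rewrite -[r]invrK r1 invr1.
  rewrite p1 subrr powRr0 -lee_fin; apply: le_trans (normc_fourier_le if_ cg) _.
  move: f1; rewrite pE /cLnorm Lnorm1 => <-.
  by under [leRHS]eq_integral do rewrite /= ger0_norm ?normc_ge0//.
have q0 : 0 < (1 - recip p)^-1 by rewrite invr_gt0 subr_gt0.
have := integral_normc_le (ccontinuous_cst (1 : C)) q0.
rewrite invrK addrC subrK => /(_ (lexx _)).
under eq_integral do rewrite ComplexField.Normc.normc1 mulr1.
under [X in haar_mean _ X]funext => x do rewrite ComplexField.Normc.normc1 powR1.
rewrite (mean_cst haar) powR1 mulr1 -lee_fin; apply: le_trans.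
exact: normc_fourier_le.
Qed.

Lemma dual_Lnorm_fourier_le q : (0 < q)%E -> recip p + recip q <= 1 -> recip q <= 1 / 2 ->
  (dual_Lnorm alpha q (fourier alpha f) <= (mass `^ (1 - recip p - recip q))%:E)%E.
Proof.
have m0 := mass_gt0 haar.
case: q => [q| |//]; last first.
  move=> _ /=; rewrite addr0 subr0 => p1 _; apply: ge_ereal_sup => _ [g cg <-].
  by rewrite lee_fin; exact: normc_fourier_unit.
rewrite lte_fin /= => q0 pq q2.
have q2' : 2 <= q by rewrite -lef_pV2 ?posrE// -[2^-1]div1r.
have -> : mass `^ (1 - recip p - q^-1) = (mass^-1 * mass `^ ((1 - recip p) * q)) `^ q^-1.
  rewrite powRM ?powR_ge0 ?invr_ge0 ?(ltW m0)// powR_inv ?(ltW m0)// -powRrM -powRN.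
  by rewrite mulfK ?gt_eqF// -powRD ?(gt_eqF m0) ?implybT// addrC.
rewrite -poweR_EFin; apply: gt0_ler_poweR.
- by rewrite invr_ge0 ltW.
- rewrite in_itv /= leey andbT mule_ge0 ?lee_fin ?invr_ge0 ?(ltW m0)//.
  by apply: esum_ge0 => x _ /=; rewrite lee_fin powR_ge0.
- by rewrite in_itv /= leey andbT lee_fin mulr_ge0 ?invr_ge0 ?powR_ge0 ?(ltW m0).
rewrite EFinM lee_wpmul2l ?lee_fin ?invr_ge0 ?(ltW m0)//.
(* The sum over the dual is a supremum over finite sets; each is enumerated without repetition to
   give an injective [gam]. *)
apply: ge_ereal_sup => _ [A [finA Adual] <-].
rewrite fsbig_finite//=; have us := finmap.fset_uniq (fset_set A).
have cs g : g \in finmap.enum_fset (fset_set A) -> character g.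
  by move=> gA; apply: Adual; move: gA; rewrite in_fset_set// inE.
move: us cs; set s := finmap.enum_fset _ => us cs.
rewrite big_tnth; pose gam k := tnth (in_tuple s) k.
have cgam k : character (gam k) by apply: cs; exact: mem_tnth.
have igam : injective gam by apply/tuple_uniqP.
by rewrite sumEFin lee_fin; exact: psum_fourier_le.
Qed.

End UnitBall.

Lemma Cpq_region1 p q : (0 < p)%E -> (0 < q)%E -> recip p + recip q <= 1 -> recip q <= 1 / 2 ->
  Cpq alpha p q = (mass `^ (1 - recip p - recip q))%:E.
Proof.
move=> p0 q0 pq q2; have m0 := mass_gt0 haar; apply/eqP; rewrite eq_le; apply/andP; split.
  by apply: ge_ereal_sup => _ [f [if_ f1] <-]; exact: dual_Lnorm_fourier_le.
(* The lower bound tests the constant 1 at the trivial character, where its transform is the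
   mass. *)
have c1 := ccontinuous_cst (X := X) (1 : C).
have n1 : (cLnorm alpha p ((fun=> 1%R) : X -> C) <= (mass `^ recip p)%:E)%E.
  rewrite -[X in X%:E]mul1r; apply: (cLnorm_le haar ler01 p0 (ccontinuous_cmeasurable c1)) => x.
  by rewrite ComplexField.Normc.normc1.
have := Cpq_ge haar p0 q0 (A := [:: (fun=> 1)]) isT isT _ (ccontinuous_cintegrable cX haar c1) n1 m0.
have -> : (1%:R / mass) `^ recip q * (mass / mass `^ recip p) = mass `^ (1 - recip p - recip q).
  rewrite div1r powR_inv ?(ltW m0)// -!powRN -{2}(powRr1 (ltW m0)).
  by rewrite -!powRD ?(gt_eqF m0) ?implybT// addrC.
apply=> a; rewrite inE => /eqP ->; first exact: character1.
rewrite normc_fourier// fcoef_character ?eqxx ?ComplexField.Normc.normc1 ?mulr1//;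
  exact: character1.
Qed.

End FourierUpperBound.

Theorem theorem3p1 (R : realType) (X : topologicalZmodType)
    (alpha : {measure set (borel X) -> \bar R}) (p q : \bar R) :
  hausdorff_space X -> compact [set: X] -> infinite_set [set: X] ->
  is_haar alpha ->
  (0 < p)%E -> (0 < q)%E ->
  (recip p + recip q <= 1 -> recip q <= 1 / 2 ->
     Cpq alpha p q = ((fine (alpha [set: borel X])) `^ (1 - recip p - recip q))%:E) /\
  ((1 < recip p + recip q /\ 1 / 2 < recip p) \/
   (recip p <= 1 / 2 /\ 1 / 2 < recip q) ->
     Cpq alpha p q = +oo%E).
Proof.
move=> hX cX iX haar p0 q0; split=> [pq q2|].
  exact: (Cpq_region1 cX haar).
move=> [[pq p2]|[p2 q2]]; first exact: (Cpq_region2 cX hX iX haar).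
exact: (Cpq_region3 cX hX iX haar).
Qed.
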